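(* The following decision problem is in NP: given a finite annotated $\mathcal{ELH}^r$ TBox $\mathcal{T}$ (with the commutative, idempotent provenance semantics described in the context), two concept names $A_0, B_0$, and a monomial $m$, decide whether $\mathcal{T} \models (A_0 \sqsubseteq B_0, m)$.
   Context: Fix pairwise disjoint countable sets $N_C$ (concept names), $N_R$ (role names) and $N_V$ (provenance variables). A monomial is a finite product $x_1\times\cdots\times x_k$ of variables from $N_V$ (the empty product is $1$); $N_M$ denotes the set of all monomials. The provenance semiring is the trio semiring of polynomials with natural coefficients over $N_V$, whose product $\times$ is associative, commutative and idempotent. Restricted $\mathcal{ELH}^r$ axioms: general concept inclusions $C \sqsubseteq D$ where $C ::= A \mid \exists R.C \mid C \sqcap C \mid \top$ and $D ::= A \mid \exists R$ (with $A\in N_C$, $R\in N_R$); role inclusions $R \sqsubseteq S$; range restrictions $\mathsf{ran}(R) \sqsubseteq A$ ($R,S\in N_R$, $A\in N_C$). An annotated TBox is a finite set of pairs $(\alpha, v)$ with $\alpha$ such an axiom and $v \in N_V \cup \{1\}$. An annotated interpretation is $\mathcal{I}=(\Delta^\mathcal{I},\Delta^\mathcal{I}_{\mathsf m},\cdot^\mathcal{I})$ with $\Delta^\mathcal{I},\Delta^\mathcal{I}_{\mathsf m}$ nonempty disjoint sets, $A^\mathcal{I}\subseteq \Delta^\mathcal{I}\times\Delta^\mathcal{I}_{\mathsf m}$ for $A\in N_C$, $R^\mathcal{I}\subseteq\Delta^\mathcal{I}\times\Delta^\mathcal{I}\times\Delta^\mathcal{I}_{\mathsf m}$ for $R\in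 N_R$, and $\mu^\mathcal{I}\in\Delta^\mathcal{I}_{\mathsf m}$ for every $\mu\in N_M$, such that $\mu^\mathcal{I}=\nu^\mathcal{I}$ iff $\mu,\nu$ are equal modulo associativity, commutativity and idempotency of $\times$. It is extended by: $\top^\mathcal{I}=\Delta^\mathcal{I}\times\{1^\mathcal{I}\}$; $(\exists R)^\mathcal{I}=\{(d,\mu^\mathcal{I})\mid \exists e\,(d,e,\mu^\mathcal{I})\in R^\mathcal{I}\}$; $(C\sqcap D)^\mathcal{I}=\{(d,(\mu\times\nu)^\mathcal{I})\mid (d,\mu^\mathcal{I})\in C^\mathcal{I},(d,\nu^\mathcal{I})\in D^\mathcal{I}\}$; $(\mathsf{ran}(R))^\mathcal{I}=\{(e,\mu^\mathcal{I})\mid\exists d\,(d,e,\mu^\mathcal{I})\in R^\mathcal{I}\}$; $(\exists R.C)^\mathcal{I}=\{(d,(\mu\times\nu)^\mathcal{I})\mid \exists e\,(d,e,\mu^\mathcal{I})\in R^\mathcal{I},(e,\nu^\mathcal{I})\in C^\mathcal{I}\}$. $\mathcal{I}$ satisfies $(R\sqsubseteq S,\mu)$ if for all $\nu\in N_M$, $(d,e,\nu^\mathcal{I})\in R^\mathcal{I}$ implies $(d,e,(\mu\times\nu)^\mathcal{I})\in S^\mathcal{I}$; it satisfies $(C\sqsubseteq D,\mu)$ (including $C=\mathsf{ran}(R)$) if for all $\nu\in N_M$, $(d,\nu^\mathcal{I})\in C^\mathcal{I}$ implies $(d,(\mu\times\nu)^\mathcal{I})\in D^\mathcal{I}$. $\mathcal{I}$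 is a model of $\mathcal{T}$ if it satisfies every annotated axiom of $\mathcal{T}$, and $\mathcal{T}\models(\alpha,\mu)$ if every model of $\mathcal{T}$ satisfies $(\alpha,\mu)$. The input size is measured by the sizes of $\mathcal{T}$ and $m$. *)

(* Defs.v *)
From Stdlib Require List.
From HB Require Import structures.
From mathcomp Require Import all_boot all_order all_algebra.

Set Implicit Arguments.
Unset Strict Implicit.
Unset Printing Implicit Defensive.

(** * Syntax *)

(* The three countably infinite sets of names are fixed to be the binary words,
   so that a name is its own encoding and its size is its length.  The sets are
   disjoint in that the syntax never confuses the three kinds of names. *)
Definition name := seq bool.
Definition concept_name := name.
Definition role_name := name.
Definition prov_var := name.

Inductive lconcept :=
| LName of concept_name
| LEx of role_name & lconcept
| LAnd of lconcept & lconcept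
| LTop.

Inductive rconcept :=
| RName of concept_name
| REx of role_name.

Inductive axiom :=
| GCI of lconcept & rconcept
| RoleIncl of role_name & role_name
| RangeRestr of role_name & concept_name.

(* A finite product of variables, written as a word: concatenation is the
   product and [::] is 1, so associativity and the unit law are built in. *)
Definition monomial := seq prov_var.

(* Equality of monomials modulo associativity, commutativity, idempotency. *)
Inductive mon_eq : monomial -> monomial -> Prop :=
| mon_eq_refl mu : mon_eq mu mu
| mon_eq_sym mu nu : mon_eq mu nu -> mon_eq nu mu
| mon_eq_trans mu nu xi : mon_eq mu nu -> mon_eq nu xi -> mon_eq mu xi
| mon_eq_mul mu mu' nu nu' :
    mon_eq mu mu' -> mon_eq nu nu' -> mon_eq (mu ++ nu) (mu' ++ nu')
| mon_eq_comm mu nu : mon_eq (mu ++ nu) (nu ++ mu)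
| mon_eq_idem mu : mon_eq (mu ++ mu) mu.

(* An annotation in TBoxes: None is 1. *)
Definition annotation := option prov_var.
Definition mon_of_annotation (v : annotation) : monomial :=
  if v is Some x then [:: x] else [::].

(* A finite set of annotated axioms, given by a list of its elements. *)
Definition tbox := seq (axiom * annotation).

(** * Semantics *)

(* The two domains are disjoint by typing, and imdom is nonempty because it
   contains the value of the empty monomial. *)
Record interp := Interp {
  idom : Type;
  imdom : Type;
  idom_nonempty : inhabited idom;
  iconcept : concept_name -> idom -> imdom -> Prop;
  irole : role_name -> idom -> idom -> imdom -> Prop;
  imon : monomial -> imdom;
  imon_eqP : forall mu nu : monomial, imon mu = imon nu <-> mon_eq mu nu
}.

Section Extensions.
Variable I : interp.

Fixpoint lext (C : lconcept) (d : idom I) (x : imdom I) : Prop :=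
  match C with
  | LName A => iconcept A d x
  | LEx R C' => exists (e : idom I) (mu nu : monomial),
      [/\ x = imon I (mu ++ nu), irole R d e (imon I mu) & lext C' e (imon I nu)]
  | LAnd C1 C2 => exists mu nu : monomial,
      [/\ x = imon I (mu ++ nu), lext C1 d (imon I mu) & lext C2 d (imon I nu)]
  | LTop => x = imon I [::]
  end.

Definition rext (D : rconcept) (d : idom I) (x : imdom I) : Prop :=
  match D with
  | RName A => iconcept A d x
  | REx R => exists mu : monomial,
      x = imon I mu /\ exists e : idom I, irole R d e (imon I mu)
  end.

Definition ranext (R : role_name) (e : idom I) (x : imdom I) : Prop :=
  exists mu : monomial,
    x = imon I mu /\ exists d : idom I, irole R d e (imon I mu).

Definition satisfies (alpha : axiom) (mu : monomial) : Prop :=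
  match alpha with
  | GCI C D => forall (nu : monomial) (d : idom I),
      lext C d (imon I nu) -> rext D d (imon I (mu ++ nu))
  | RoleIncl R1 R2 => forall (nu : monomial) (d e : idom I),
      irole R1 d e (imon I nu) -> irole R2 d e (imon I (mu ++ nu))
  | RangeRestr R A => forall (nu : monomial) (d : idom I),
      ranext R d (imon I nu) -> iconcept A d (imon I (mu ++ nu))
  end.

Definition is_model (T : tbox) : Prop :=
  forall alpha v, List.In (alpha, v) T ->
    satisfies alpha (mon_of_annotation v).

End Extensions.

Definition entails (T : tbox) (alpha : axiom) (mu : monomial) : Prop :=
  forall I : interp, is_model I T -> satisfies I alpha mu.

(** * Nondeterministic polynomial time *)

Inductive move := MoveLeft | Stay | MoveRight.

(* A zipper: the cells left of the head (nearest first), the scanned cell, and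
   the cells right of the head (nearest first); all other cells are blank. *)
Record tape (G : Type) := Tape {
  tleft : seq G;
  thead : G;
  tright : seq G
}.

Definition tape_of_word (G : Type) (blank : G) (w : seq G) : tape G :=
  Tape [::] (head blank w) (behead w).

Definition tape_act (G : Type) (blank : G) (t : tape G) (a : G * move) : tape G :=
  match a.2 with
  | Stay => Tape (tleft t) a.1 (tright t)
  | MoveLeft =>
      Tape (behead (tleft t)) (head blank (tleft t)) (a.1 :: tright t)
  | MoveRight =>
      Tape (a.1 :: tleft t) (head blank (tright t)) (behead (tright t))
  end.

(* Nondeterministic Turing machines with tm_work.+1 two-way infinite tapes over
   the alphabet option (Sigma + tm_aux), where None is the blank; tm_trans q s
   is the set of possible reactions in state q when scanning the symbols s.  As
   states, symbols and moves range over finite types, it is a finite table. *)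
Record ntm (Sigma : finType) := Ntm {
  tm_state : finType;
  tm_aux : finType;
  tm_work : nat;
  tm_start : tm_state;
  tm_accept : pred tm_state;
  tm_trans :
    tm_state -> {ffun 'I_tm_work.+1 -> option (Sigma + tm_aux)} ->
    tm_state -> {ffun 'I_tm_work.+1 -> option (Sigma + tm_aux) * move} -> bool
}.

Section Runs.
Variables (Sigma : finType) (M : ntm Sigma).

Definition tm_symbol : Type := option (Sigma + tm_aux M).

Record config := Config {
  cstate : tm_state M;
  ctapes : {ffun 'I_(tm_work M).+1 -> tape tm_symbol}
}.

(* The input is on tape 0, with the head on its first symbol. *)
Definition init_config (w : seq Sigma) : config :=
  Config (tm_start M)
    [ffun i => tape_of_word None
       (if i == ord0 then [seq Some (inl a) | a <- w] else [::])].

Definition tm_step (c c' : config) : Prop :=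
  exists act : {ffun 'I_(tm_work M).+1 -> tm_symbol * move},
    tm_trans (cstate c) [ffun i => thead (ctapes c i)] (cstate c') act /\
    ctapes c' = [ffun i => tape_act None (ctapes c i) (act i)].

Fixpoint tm_run (n : nat) (c c' : config) : Prop :=
  if n is n'.+1 then exists2 c1, tm_step c c1 & tm_run n' c1 c' else c = c'.

Definition accepts_in (n : nat) (w : seq Sigma) : Prop :=
  exists2 c, tm_run n (init_config w) c & tm_accept (cstate c).

End Runs.

(* Time is measured as for nondeterministic programs in Garey and Johnson: M
   recognizes the words having an accepting run, of whatever length, and the
   time needed for such a word is the length of its shortest accepting run. *)
Definition in_NP (Sigma : finType) (L : seq Sigma -> Prop) : Prop :=
  exists (M : ntm Sigma) (p : {poly nat}),
    (forall w, L w <-> exists n, accepts_in M n w) /\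
    (forall w, L w -> exists2 n, n <= p.[size w]%R & accepts_in M n w).

(** * Encoding of the instances *)

Inductive symbol :=
| SBit of bool | SEnd
| SName | SEx | SAnd | STop
| SGCI | SRoleIncl | SRangeRestr
| SOne | SVar
| SQuery.

Definition symbol_code (s : symbol) : nat :=
  match s with
  | SBit false => 0 | SBit true => 1 | SEnd => 2
  | SName => 3 | SEx => 4 | SAnd => 5 | STop => 6
  | SGCI => 7 | SRoleIncl => 8 | SRangeRestr => 9
  | SOne => 10 | SVar => 11 | SQuery => 12
  end.

Definition symbol_enum : seq symbol :=
  [:: SBit false; SBit true; SEnd; SName; SEx; SAnd; STop;
      SGCI; SRoleIncl; SRangeRestr; SOne; SVar; SQuery].

Lemma symbol_codeK : pcancel symbol_code (onth symbol_enum).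
Proof. by case=> // -[]. Qed.

HB.instance Definition _ := Countable.copy symbol (pcan_type symbol_codeK).

Lemma symbol_enumP : Finite.axiom symbol_enum.
Proof. by case=> // -[]. Qed.

HB.instance Definition _ := isFinite.Build symbol symbol_enumP.

Definition enc_name (a : name) : seq symbol := rcons [seq SBit b | b <- a] SEnd.

Fixpoint enc_lconcept (C : lconcept) : seq symbol :=
  match C with
  | LName A => SName :: enc_name A
  | LEx R C' => SEx :: enc_name R ++ enc_lconcept C'
  | LAnd C1 C2 => SAnd :: enc_lconcept C1 ++ enc_lconcept C2
  | LTop => [:: STop]
  end.

Definition enc_rconcept (D : rconcept) : seq symbol :=
  match D with
  | RName A => SName :: enc_name A
  | REx R => SEx :: enc_name R
  end.

Definition enc_axiom (alpha : axiom) : seq symbol :=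
  match alpha with
  | GCI C D => SGCI :: enc_lconcept C ++ enc_rconcept D
  | RoleIncl R1 R2 => SRoleIncl :: enc_name R1 ++ enc_name R2
  | RangeRestr R A => SRangeRestr :: enc_name R ++ enc_name A
  end.

Definition enc_annotation (v : annotation) : seq symbol :=
  if v is Some x then SVar :: enc_name x else [:: SOne].

Definition enc_tbox (T : tbox) : seq symbol :=
  flatten [seq enc_axiom av.1 ++ enc_annotation av.2 | av <- T].

Definition enc_instance
    (T : tbox) (A0 B0 : concept_name) (m : monomial) : seq symbol :=
  enc_tbox T ++ SQuery :: enc_name A0 ++ enc_name B0 ++
  flatten [seq enc_name x | x <- m].

Definition entailment_problem (w : seq symbol) : Prop :=
  exists (T : tbox) (A0 B0 : concept_name) (m : monomial),
    w = enc_instance T A0 B0 m /\ entails T (GCI (LName A0) (RName B0)) m.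

(* Main.v *)
Require Import Defs.
From mathcomp Require Import all_boot all_order all_algebra.
From mathcomp Require Import boolp zify.
Set Implicit Arguments.
Unset Strict Implicit.
Unset Printing Implicit Defensive.

(** Entailment is captured by a small calculus deriving facts [c |- b : mu],
   where the context [c] is either the root, an element known to satisfy [A0]
   with a fresh annotation, or a role [R], an element known to have an incoming
   [R]-edge.  Its derivations give a canonical model, so that the entailment
   holds iff [B0] is derivable at the root with exactly the annotation [m] and
   the fresh one.

   Derivation trees may be exponential.  But if [f] has a tree with set of
   annotations [U], then it has a polynomial DAG using exactly [U]: fix for every
   fact that is derivable within [U] some derivation, and cover [U] by following
   the paths of the tree to one leaf for each element of [U], all other branches
   being replaced by the fixed derivations; between two branching points of
   these paths no fact has to be repeated.

   The resulting certificates are derivations of Horn clauses over words in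
   which only polynomially many words, of polynomial size, occur.  A
   nondeterministic machine finds such a derivation by keeping the derived atoms
   on a tape, guessing clause instances and checking their premises. *)

(** * Stack programs and their compilation to Turing machines *)

(** The obstacle is exactness: a derivation of [B0] may collect too few variables or too many, so
    staying within the wanted set and reaching each of its elements must be reconciled. Idempotency
    turns annotations into sets combined by union. Hence a subderivation may be exchanged for any
    other derivation of the same fact within [U], provided every element of [U] is still contributed
    somewhere.

    An element created by an existential is described by its role alone: it knows its incoming edge
    but not its predecessor, so there are only finitely many contexts. Whether its facts inherit the
    annotation of that edge is absorbed by idempotency when they are read back at the predecessor,
    where the edge contributes this annotation anyway.

    Membership in NP asks for one short accepting run, not for termination of all runs. The machine
    may thus guess freely, the parsing of the input can itself be left to Horn clauses, and
    soundness becomes an invariant of derived atoms in which no size occurs. *)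

Section StackPrograms.
Variables (Sigma X : finType) (k : nat).
Local Notation sym := (Sigma + X)%type.
Local Notation idx := 'I_k.+1.
Local Notation mem := {ffun idx -> seq sym}.

(** There is no conditional: a [Pop] or [Empty] that does not apply blocks the run, and all choices
    are made by [Branch] and [Star]. *)
Inductive prog : Type :=
| Skip
| Pop of idx & sym
| Push of idx & sym
| Empty of idx
| Seq of prog & prog
| Branch (T : finType) of T -> prog
| Star of prog.

Definition upd (m : mem) (i : idx) (s : seq sym) : mem :=
  [ffun j => if j == i then s else m j].

Inductive starn (P : nat -> mem -> mem -> Prop) : nat -> mem -> mem -> Prop :=
| Star0 m : starn P 1 m m
| StarS n1 n2 m m1 m2 :
    P n1 m m1 -> starn P n2 m1 m2 -> starn P (n1 + n2).+1 m m2.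

(** The index counts small steps exactly, so the passage to [sstep] loses no constant. *)
Fixpoint den (p : prog) (n : nat) (m m' : mem) : Prop :=
  match p with
  | Skip => n = 1 /\ m' = m
  | Pop i a => n = 1 /\ exists2 s, m i = a :: s & m' = upd m i s
  | Push i a => n = 1 /\ m' = upd m i (a :: m i)
  | Empty i => n = 1 /\ m i = [::] /\ m' = m
  | Seq p q => exists n1 n2 m1,
      [/\ n = (n1 + n2).+1, den p n1 m m1 & den q n2 m1 m']
  | Branch _ f => exists t n1, n = n1.+1 /\ den (f t) n1 m m'
  | Star p => starn (den p) n m m'
  end.

Lemma den_seqI p q n1 n2 m m1 m' :
  den p n1 m m1 -> den q n2 m1 m' -> den (Seq p q) (n1 + n2).+1 m m'.
Proof. by move=> d1 d2; exists n1, n2, m1. Qed.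

Lemma den_seqE p q n m m' :
  den (Seq p q) n m m' -> exists n1 n2 m1, den p n1 m m1 /\ den q n2 m1 m'.
Proof. by move=> [n1 [n2 [m1 [_ d1 d2]]]]; exists n1, n2, m1. Qed.

Lemma den_popE i a n m m' :
  den (Pop i a) n m m' -> exists2 s, m i = a :: s & m' = upd m i s.
Proof. by case. Qed.

Lemma den_pushE i a n m m' : den (Push i a) n m m' -> m' = upd m i (a :: m i).
Proof. by case. Qed.

Lemma den_emptyE i n m m' : den (Empty i) n m m' -> m i = [::] /\ m' = m.
Proof. by case. Qed.

Lemma den_skipI (m : mem) : den Skip 1 m m.
Proof. by []. Qed.

Lemma den_emptyI i (m : mem) : m i = [::] -> den (Empty i) 1 m m.
Proof. by []. Qed.

Lemma den_popI i a s (m : mem) : m i = a :: s -> den (Pop i a) 1 m (upd m i s).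
Proof. by split=> //; exists s. Qed.

Lemma den_pushI i a (m : mem) : den (Push i a) 1 m (upd m i (a :: m i)).
Proof. by []. Qed.

Fixpoint dens (c : seq prog) (m m' : mem) : Prop :=
  if c is p :: c' then exists n m1, den p n m m1 /\ dens c' m1 m' else m = m'.

Definition sstep (c : seq prog) (m : mem) (c' : seq prog) (m' : mem) : Prop :=
  if c is p :: r then
    match p with
    | Skip => c' = r /\ m' = m
    | Pop i a => c' = r /\ exists2 s, m i = a :: s & m' = upd m i s
    | Push i a => c' = r /\ m' = upd m i (a :: m i)
    | Empty i => c' = r /\ (m i = [::] /\ m' = m)
    | Seq p q => c' = [:: p, q & r] /\ m' = m
    | Branch _ f => (exists t, c' = f t :: r) /\ m' = m
    | Star q => (c' = r \/ c' = [:: q, Star q & r]) /\ m' = m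
    end
  else False.

Inductive ssteps : nat -> seq prog -> mem -> seq prog -> mem -> Prop :=
| SS0 c m : ssteps 0 c m c m
| SSS n c m c1 m1 c2 m2 :
    sstep c m c1 m1 -> ssteps n c1 m1 c2 m2 -> ssteps n.+1 c m c2 m2.

Lemma ssteps_trans n1 n2 c1 m1 c2 m2 c3 m3 :
  ssteps n1 c1 m1 c2 m2 -> ssteps n2 c2 m2 c3 m3 ->
  ssteps (n1 + n2) c1 m1 c3 m3.
Proof.
elim=> // n c m c1' m1' c2' m2' st _ IH /IH; rewrite addSn.
exact: SSS st.
Qed.

Lemma den_ssteps p n m m' c : den p n m m' -> ssteps n (p :: c) m c m'.
Proof.
elim: p n m m' c => [|i a|i a|i|p IHp q IHq|T f IHf|p IHp] n m m' c /=.
- by move=> [-> ->]; apply: SSS (SS0 _ _).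
- by move=> [-> [s ms ->]]; apply: SSS (SS0 _ _); split=> //; exists s.
- by move=> [-> ->]; apply: SSS (SS0 _ _).
- by move=> [-> [mi ->]]; apply: SSS (SS0 _ _).
- move=> [n1 [n2 [m1 [-> /IHp d1 /IHq d2]]]].
  by apply: SSS (ssteps_trans (d1 _) (d2 _)).
- by move=> [t [n1 [-> /IHf d]]]; apply: SSS (d _); split=> //; exists t.
- elim=> {n m m'} [m|n1 n2 m m1 m2 /IHp d _ IH].
    by apply: SSS (SS0 _ _); split=> //; left.
  by apply: SSS (ssteps_trans (d _) IH); split=> //; right.
Qed.

Lemma sstep_dens c m c' m' m'' :
  sstep c m c' m' -> dens c' m' m'' -> dens c m m''.
Proof.
case: c => [|[|i a|i a|i|p q|T f|p] c] //=.
- by move=> [-> ->] d; exists 1, m.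
- by move=> [-> [s ms ->]] d; exists 1, (upd m i s); split=> //; split=> //; exists s.
- by move=> [-> ->] d; exists 1, (upd m i (a :: m i)).
- by move=> [-> [mi ->]] d; exists 1, m.
- move=> [-> ->] [n1 [m1 [d1 [n2 [m2 [d2 d]]]]]].
  by exists (n1 + n2).+1, m2; split=> //; exists n1, n2, m1.
- by move=> [[t ->] ->] [n [m1 [d1 d]]]; exists n.+1, m1; split=> //; exists t, n.
- move=> [[]-> ->] => [d|]; first by exists 1, m; split=> //; constructor.
  move=> [n1 [m1 [d1 [n2 [m2 [d2 d]]]]]].
  by exists (n1 + n2).+1, m2; split=> //; apply: StarS d1 d2.
Qed.

(** All continuation stacks that can arise while [p] runs in front of [c]. They are finitely many
    although loops are unbounded, because the body of a [Star] returns to the same continuation;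
    this lets them serve as machine states. *)
Fixpoint conts (p : prog) (c : seq prog) : seq (seq prog) :=
  (p :: c) ::
  match p with
  | Seq p q => conts p (q :: c) ++ conts q c
  | Branch T f => flatten [seq conts (f t) c | t <- enum T]
  | Star q => conts q (Star q :: c)
  | _ => [::]
  end.

Lemma conts_head p c : List.In (p :: c) (conts p c).
Proof. by case: p => *; left. Qed.

Lemma In_flatten_enum (T : finType) A (F : T -> seq A) x :
  List.In x (flatten [seq F t | t <- enum T]) <-> exists t, List.In x (F t).
Proof.
suff E s : List.In x (flatten [seq F t | t <- s]) <->
    exists2 t, t \in s & List.In x (F t).
  rewrite E; split=> [[t _]|[t]]; first by exists t.
  by exists t => //; rewrite mem_enum.
elim: s => [|t s IH] /=; first by split=> // -[].
rewrite List.in_app_iff IH; split.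
  case=> [xt|[u us xu]]; first by exists t => //; rewrite mem_head.
  by exists u => //; rewrite inE us orbT.
case=> u; rewrite inE => /orP[/eqP->|us] xu; first by left.
by right; exists u.
Qed.

Lemma conts_closed p c x y m m' :
  List.In x (conts p c) -> sstep x m y m' -> List.In y (conts p c) \/ y = c.
Proof.
elim: p c => [|i a|i a|i|p IHp q IHq|T f IHf|p IHp] c /=;
  try by [case=> // <- [-> _]; right].
- rewrite !List.in_app_iff; case=> [<- [-> _]|[xp|xq] st].
  + by left; right; left; apply: conts_head.
  + have [yp|->] := IHp _ xp st; first by left; right; left.
    by left; right; right; apply: conts_head.
  + have [yq|->] := IHq _ xq st; last by right.
    by left; right; right.
- case=> [<- [[t ->] _]|/In_flatten_enum[t xt] st].
    by left; right; apply/In_flatten_enum; exists t; apply: conts_head.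
  have [yt|->] := IHf _ _ xt st; last by right.
  by left; right; apply/In_flatten_enum; exists t.
- case=> [<- [[]-> _]|xp st]; first by right.
    by left; right; apply: conts_head.
  have [yp|->] := IHp _ xp st; first by left; right.
  by left; left.
Qed.

(** * Machines whose states are program points *)

Section Compilation.
Variable p0 : prog.

Definition program_points := [::] :: conts p0 [::].
Local Notation point := 'I_(size program_points).
Definition cont_at (q : point) := nth [::] program_points q.

Lemma In_nth (A : Type) (x0 x : A) s :
  List.In x s -> exists2 n, n < size s & nth x0 s n = x.
Proof.
elim: s => //= y s IH [->|/IH[n lt_n <-]]; first by exists 0.
by exists n.+1.
Qed.

Lemma point_of c : List.In c program_points -> exists q : point, cont_at q = c.
Proof. by move=> /(In_nth [::])[n lt_n <-]; exists (Ordinal lt_n). Qed.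

Lemma cont_at_in q : List.In (cont_at q) program_points.
Proof.
rewrite /cont_at; elim: program_points (nat_of_ord q) (ltn_ord q) => //= x s IH.
by case=> [|n] /= lt_n; [left | right; apply: IH].
Qed.

Local Notation scan := {ffun idx -> option sym}.
Local Notation action := {ffun idx -> option sym * move}.

Definition act_only (s : scan) (i : idx) (a : option sym * move) : action :=
  [ffun j => if j == i then a else (s j, Stay)].

Definition act_none (s : scan) : action := [ffun j => (s j, Stay)].

(* A push takes two steps of the machine: the head first moves left, and the
   symbol to be written is remembered in the second component of the state. *)
Definition point_trans (c : seq prog) (s : scan)
    (c' : seq prog) (pend : option (idx * sym)) (act : action) : Prop :=
  if c is p :: r then
    match p with
    | Skip => [/\ c' = r, pend = None & act = act_none s]
    | Pop i a =>
        [/\ c' = r, pend = None, s i = Some a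
          & act = act_only s i (Some a, MoveRight)]
    | Push i a =>
        [/\ c' = r, pend = Some (i, a) & act = act_only s i (s i, MoveLeft)]
    | Empty i => [/\ c' = r, pend = None, s i = None & act = act_none s]
    | Seq p q => [/\ c' = [:: p, q & r], pend = None & act = act_none s]
    | Branch _ f =>
        [/\ exists t, c' = f t :: r, pend = None & act = act_none s]
    | Star q =>
        [/\ c' = r \/ c' = [:: q, Star q & r], pend = None & act = act_none s]
    end
  else False.

Definition prog_trans (q : point * option (idx * sym)) (s : scan)
    (q' : point * option (idx * sym)) (act : action) : Prop :=
  if q.2 is Some (i, a) then
    q' = (q.1, None) /\ act = act_only s i (Some a, Stay)
  else point_trans (cont_at q.1) s (cont_at q'.1) q'.2 act.

Lemma start_point : {q : point | cont_at q = [:: p0]}.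
Proof.
by apply: cid; apply: point_of; right; apply: conts_head.
Qed.

Definition prog_ntm : ntm Sigma := @Ntm Sigma
  (point * option (idx * sym))%type X k (sval start_point, None)
  (fun q => `[< cont_at q.1 = [::] /\ q.2 = None >])
  (fun q s q' act => `[< prog_trans q s q' act >]).

(* The cells left of the head and those right of the first blank are garbage. *)
Fixpoint stack_of (l : seq (option sym)) : seq sym :=
  if l is Some a :: l' then a :: stack_of l' else [::].

Definition tape_stack (t : tape (option sym)) : seq sym :=
  stack_of (Defs.thead t :: tright t).

Local Notation tapes := {ffun idx -> tape (option sym)}.

(** A pending symbol counts as already pushed: the first step of a push changes the memory and the
    second one leaves it unchanged. *)
Definition tapes_mem (pend : option (idx * sym)) (tp : tapes) : mem :=
  [ffun j =>
    if pend is Some (i, a) then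
      if j == i then a :: stack_of (tright (tp j)) else tape_stack (tp j)
    else tape_stack (tp j)].

Definition tapes_act (tp : tapes) (act : action) : tapes :=
  [ffun j => tape_act None (tp j) (act j)].

Definition scan_of (tp : tapes) : scan := [ffun j => Defs.thead (tp j)].

Lemma tape_act_stay (t : tape (option sym)) :
  tape_act None t (Defs.thead t, Stay) = t.
Proof. by case: t. Qed.

Lemma tape_stack_right (t : tape (option sym)) a :
  tape_stack (tape_act None t (a, MoveRight)) = stack_of (tright t).
Proof. by case: t => l h []. Qed.

Lemma tapes_act_none tp : tapes_act tp (act_none (scan_of tp)) = tp.
Proof. by apply/ffunP=> j; rewrite !ffunE tape_act_stay. Qed.

Lemma tapes_mem_pop tp i a :
  tapes_mem None (tapes_act tp (act_only (scan_of tp) i (a, MoveRight))) =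
  upd (tapes_mem None tp) i (stack_of (tright (tp i))).
Proof.
apply/ffunP=> j; rewrite !ffunE; case: eqP => [->|_].
  by rewrite tape_stack_right.
by rewrite tape_act_stay.
Qed.

Lemma tapes_mem_push tp i a :
  tapes_mem (Some (i, a))
    (tapes_act tp (act_only (scan_of tp) i (scan_of tp i, MoveLeft))) =
  upd (tapes_mem None tp) i (a :: tapes_mem None tp i).
Proof.
by apply/ffunP=> j; rewrite !ffunE; case: eqP => [->|_].
Qed.

Lemma tapes_mem_write tp i a :
  tapes_mem None (tapes_act tp (act_only (scan_of tp) i (Some a, Stay))) =
  tapes_mem (Some (i, a)) tp.
Proof.
by apply/ffunP=> j; rewrite !ffunE; case: eqP.
Qed.

Lemma thead_stack (tp : tapes) i a :
  scan_of tp i = Some a ->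
  tapes_mem None tp i = a :: stack_of (tright (tp i)).
Proof. by rewrite !ffunE /tape_stack /= => ->. Qed.

Lemma thead_stack_nil (tp : tapes) i :
  scan_of tp i = None <-> tapes_mem None tp i = [::].
Proof. by rewrite !ffunE /tape_stack /=; case: (Defs.thead _). Qed.

Lemma stack_thead (tp : tapes) i a s :
  tapes_mem None tp i = a :: s ->
  scan_of tp i = Some a /\ stack_of (tright (tp i)) = s.
Proof. by rewrite !ffunE /tape_stack /=; case: (Defs.thead _) => //= b [-> ->]. Qed.

Definition config_mem (c : config prog_ntm) : mem :=
  tapes_mem (cstate c).2 (ctapes c).

Definition config_cont (c : config prog_ntm) : seq prog := cont_at (cstate c).1.

(** Stated backwards, from the rest of the run to the whole, so that induction on a run ending in
    the empty continuation directly yields a denotation. *)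
Lemma tm_step_sound c c' m :
  tm_step c c' -> dens (config_cont c') (config_mem c') m ->
  dens (config_cont c) (config_mem c) m.
Proof.
case: c => -[q pend] tp; case: c' => -[q' pend'] tp'.
case=> act /= [/asboolP tr /= ->{tp'}].
rewrite /config_cont /config_mem /= -/(tapes_act tp act).
case: pend tr => [[i a]|] /=.
  by move=> [[-> ->] ->]; rewrite tapes_mem_write.
rewrite -/(scan_of tp) /prog_trans /= => tr; apply: sstep_dens; move: tr.
case: (cont_at q) => [|[|i a|i a|i|p r|T f|p] c] //= [].
- by move=> -> -> ->; rewrite tapes_act_none.
- move=> -> -> si ->; rewrite tapes_mem_pop; split=> //.
  by exists (stack_of (tright (tp i))) => //; apply: thead_stack.
- by move=> -> -> ->; rewrite tapes_mem_push.
- by move=> -> -> /thead_stack_nil si ->; rewrite tapes_act_none.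
- by move=> -> -> ->; rewrite tapes_act_none.
- by move=> ex -> ->; rewrite tapes_act_none.
- by move=> ex -> ->; rewrite tapes_act_none.
Qed.

Lemma tm_run_sound n c c' :
  tm_run n c c' -> config_cont c' = [::] -> (cstate c').2 = None ->
  dens (config_cont c) (config_mem c) (config_mem c').
Proof.
elim: n c => [|n IH] c /=; first by move=> -> ->.
by move=> [c1 /tm_step_sound st /IH run] Ec En; apply/st/run.
Qed.

Lemma tm_run_cat n1 n2 (c1 c2 c3 : config prog_ntm) :
  tm_run n1 c1 c2 -> tm_run n2 c2 c3 -> tm_run (n1 + n2) c1 c3.
Proof.
elim: n1 c1 => [|n1 IH] c1 /=; first by move=> ->.
by move=> [c st /IH run] /run; exists c.
Qed.

Lemma sstep_complete (q : point) tp c' m' :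
  sstep (cont_at q) (tapes_mem None tp) c' m' ->
  exists n (q' : point) (tp' : tapes),
    [/\ n <= 2, cont_at q' = c', tapes_mem None tp' = m'
      & tm_run n (@Config _ prog_ntm (q, None) tp)
                 (@Config _ prog_ntm (q', None) tp')].
Proof.
move=> st.
have [q' Eq'] : exists q' : point, cont_at q' = c'.
  apply: point_of; have [Eq|inq] := cont_at_in q.
    by rewrite -Eq in st.
  by have [inc|->] := conts_closed inq st; [right | left].
move: st; rewrite -Eq' => st.
have one act pend' tp1 : point_trans (cont_at q) (scan_of tp) (cont_at q') pend' act ->
    tapes_act tp act = tp1 ->
    tm_step (@Config _ prog_ntm (q, None) tp) (@Config _ prog_ntm (q', pend') tp1).
  by move=> tr <-; exists act; split=> //; apply/asboolP.
have quick : point_trans (cont_at q) (scan_of tp) (cont_at q') None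
      (act_none (scan_of tp)) -> tapes_mem None tp = m' ->
  exists n (r : point) (tp' : tapes),
    [/\ n <= 2, cont_at r = cont_at q', tapes_mem None tp' = m'
      & tm_run n (@Config _ prog_ntm (q, None) tp)
                 (@Config _ prog_ntm (r, None) tp')].
  move=> tr Em; exists 1, q', tp; split=> //=.
  exists (@Config _ prog_ntm (q', None) tp) => //.
  exact: one tr (tapes_act_none tp).
case: (cont_at q) quick one st => [|[|i a|i a|i|p r|T f|p] c] //= quick one [].
- by move=> Ec Em; apply: quick.
- move=> Ec [s /stack_thead[si ss] ->].
  exists 1, q', (tapes_act tp (act_only (scan_of tp) i (Some a, MoveRight))).
  split=> //; first by rewrite tapes_mem_pop ss.
  by eexists; last reflexivity; apply: one.
- move=> Ec ->.
  set tp1 := tapes_act tp (act_only (scan_of tp) i (scan_of tp i, MoveLeft)).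
  exists 2, q', (tapes_act tp1 (act_only (scan_of tp1) i (Some a, Stay))).
  split=> //; first by rewrite tapes_mem_write tapes_mem_push.
  exists (@Config _ prog_ntm (q', Some (i, a)) tp1); first exact: one.
  eexists; last reflexivity.
  by eexists; split; first by apply/asboolP.
- move=> Ec [/thead_stack_nil Es Em]; exact: quick.
- by move=> Ec Em; apply: quick.
- by move=> Ec Em; apply: quick.
- by move=> Ec Em; apply: quick.
Qed.

Lemma ssteps_complete n c m c' m' :
  ssteps n c m c' m' ->
  forall (q : point) tp, cont_at q = c -> tapes_mem None tp = m ->
  exists n' (q' : point) (tp' : tapes),
    [/\ n' <= 2 * n, cont_at q' = c', tapes_mem None tp' = m'
      & tm_run n' (@Config _ prog_ntm (q, None) tp)
                  (@Config _ prog_ntm (q', None) tp')].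
Proof.
elim=> {n c m c' m'} [c m q tp Eq Em|n c m c1 m1 c2 m2 st _ IH q tp Eq Em].
  by exists 0, q, tp.
rewrite -Eq -Em in st.
have [n1 [q1 [tp1 [le1 Eq1 Em1 run1]]]] := sstep_complete st.
have [n2 [q2 [tp2 [le2 Eq2 Em2 run2]]]] := IH _ _ Eq1 Em1.
exists (n1 + n2), q2, tp2; split=> //; last exact: tm_run_cat run1 run2.
by rewrite mulnS leq_add.
Qed.

Definition init_mem (w : seq Sigma) : mem :=
  [ffun i => if i == ord0 then [seq inl a | a <- w] else [::]].

Lemma config_mem_init w : config_mem (init_config prog_ntm w) = init_mem w.
Proof.
apply/ffunP=> i; rewrite !ffunE; case: eqP => _ //.
by rewrite /tape_stack; elim: w => //= a w <-; case: w.
Qed.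

Lemma prog_ntm_sound n w :
  accepts_in prog_ntm n w -> exists n' m, den p0 n' (init_mem w) m.
Proof.
case=> c run /asboolP[Ec En].
have := tm_run_sound run Ec En.
rewrite config_mem_init /config_cont /= (svalP start_point) /=.
by move=> [n' [m [d _]]]; exists n', m.
Qed.

Lemma prog_ntm_complete n w m :
  den p0 n (init_mem w) m -> exists2 n', n' <= 2 * n & accepts_in prog_ntm n' w.
Proof.
move=> d; have st := ssteps_complete (den_ssteps [::] d).
have [n' [q' [tp' [le Eq _ run]]]] := st _ _ (svalP start_point) (config_mem_init w).
exists n' => //.
by exists (@Config _ prog_ntm (q', None) tp') => //; apply/asboolP.
Qed.

End Compilation.

Theorem in_NP_prog (p0 : prog) (L : seq Sigma -> Prop) (p : {poly nat}) :
  (forall n w m, den p0 n (init_mem w) m -> L w) ->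
  (forall w, L w -> exists n m, n <= p.[size w]%R /\ den p0 n (init_mem w) m) ->
  in_NP L.
Proof.
(* The bound is doubled because a push takes two machine steps. *)
move=> sound complete; exists (prog_ntm p0), (p + p)%R.
have bounded w : L w ->
    exists2 n, n <= (p + p).[size w]%R & accepts_in (prog_ntm p0) n w.
  move=> /complete[n [m [le_n /prog_ntm_complete[n' le_n' acc]]]].
  exists n' => //; apply: leq_trans le_n' _.
  by rewrite mul2n -addnn hornerD leq_add.
split=> // w; split=> [/bounded[n _ acc]|[n /prog_ntm_sound[n' [m]]]].
  by exists n.
exact: sound.
Qed.

End StackPrograms.

Arguments den : simpl never.

(** * Horn clauses over words *)

Section Transfer.
Variables (Sigma X : finType) (k : nat).
Local Notation sym := (Sigma + X)%type.
Local Notation idx := 'I_k.+1.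
Local Notation mem := {ffun idx -> seq sym}.
Local Notation prog := (prog Sigma X k).

Definition push_all (dst : seq idx) (a : sym) : prog :=
  foldr (fun i p => Seq (Push i a) p) (@Skip _ _ _) dst.

Definition transfer1 (src dst : seq idx) (a : sym) : prog :=
  foldr (fun i p => Seq (Pop i a) p) (push_all dst a) src.

(** Each round guesses one symbol, pops it from every source and pushes it on every target. Several
    sources are thereby compared, several targets receive reversed copies, and the number of rounds
    is guessed. *)
Definition transfer (src dst : seq idx) : prog :=
  Star (@Branch _ _ _ sym (transfer1 src dst)).

Definition transferred (src dst : seq idx) (u : seq sym) (m m' : mem) : Prop :=
  forall i, if i \in src then m i = u ++ m' i
            else if i \in dst then m' i = rev u ++ m i else m' i = m i.

Lemma push_all_sound dst a n m m' :
  uniq dst -> den (push_all dst a) n m m' -> transferred [::] dst [:: a] m m'.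
Proof.
elim: dst n m => [|i dst IH] n m /=; first by move=> _ [_ ->].
move=> /andP[idst uniq_dst] [n1 [n2 [m1 [_ [_ ->] /IH tr]]]] j.
have := tr uniq_dst j; rewrite in_nil !inE !ffunE /=.
by case: eqP => //= ->; rewrite (negbTE idst).
Qed.

Lemma transfer1_sound src dst a n m m' :
  uniq (src ++ dst) -> den (transfer1 src dst a) n m m' ->
  transferred src dst [:: a] m m'.
Proof.
elim: src n m => [|i src IH] n m /=; first exact: push_all_sound.
move=> /andP[idst uniq_dst] [n1 [n2 [m1 [_ [_ [s ms ->]] /IH tr]]]] j.
have := tr uniq_dst j; rewrite !inE !ffunE /=.
case: eqP => //= ->; move: idst; rewrite mem_cat negb_or => /andP[].
by move=> /negbTE-> /negbTE-> ->.
Qed.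

Lemma transfer_sound src dst n m m' :
  uniq (src ++ dst) -> den (transfer src dst) n m m' ->
  exists u, transferred src dst u m m'.
Proof.
move=> un; elim=> {n m m'} [m|n1 n2 m m1 m2 [a [n [_ d]]] _ [u tr]].
  by exists [::] => i; case: ifP => //; case: ifP.
exists (a :: u) => i; have := tr i; have := transfer1_sound un d i.
case: ifP => _; first by move=> -> ->.
case: ifP => _; last by move=> -> ->.
by move=> -> ->; rewrite [rev (a :: u)]rev_cons cat_rcons.
Qed.

Lemma push_all_complete dst a m m' :
  uniq dst -> transferred [::] dst [:: a] m m' ->
  den (push_all dst a) (2 * size dst).+1 m m'.
Proof.
elim: dst m => [|i dst IH] m /=.
  by move=> _ tr; split=> //; apply/ffunP=> i; apply: tr.
move=> /andP[idst un] tr.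
exists 1, (2 * size dst).+1, (upd m i (a :: m i)); split=> //; first by rewrite mulnS.
apply: IH => // j; have := tr j; rewrite !inE !ffunE /=.
by case: eqP => // ->; rewrite (negbTE idst).
Qed.

Lemma transfer1_complete src dst a m m' :
  uniq (src ++ dst) -> transferred src dst [:: a] m m' ->
  den (transfer1 src dst a) (2 * (size src + size dst)).+1 m m'.
Proof.
elim: src m => [|i src IH] m /=; first exact: push_all_complete.
move=> /andP[idst un] tr.
exists 1, (2 * (size src + size dst)).+1, (upd m i (m' i)); split=> //.
- by rewrite addSn mulnS.
- by split=> //; exists (m' i) => //; have := tr i; rewrite mem_head.
apply: IH => // j; have := tr j; rewrite !inE !ffunE /=.
case: eqP => //= ->; move: idst; rewrite mem_cat negb_or => /andP[].
by move=> /negbTE-> /negbTE->.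
Qed.

(** With at most four stacks a round costs at most 11 steps: 9 for the pops and pushes, one for the
    branch and one for the loop. Leaving the loop costs the final 1. *)
Lemma transfer_complete src dst u m m' :
  uniq (src ++ dst) -> size src + size dst <= 4 ->
  transferred src dst u m m' ->
  exists2 n, n <= 11 * size u + 1 & den (transfer src dst) n m m'.
Proof.
move=> un le4; elim: u m => [|a u IH] m tr.
  exists 1 => //=; suff -> : m' = m by constructor.
  apply/ffunP=> i; have := tr i.
  by case: ifP => // _; case: ifP.
pose m1 : mem := [ffun i => if i \in src then behead (m i)
                 else if i \in dst then a :: m i else m i].
have [|n le_n d] := IH m1.
  move=> i; have := tr i; rewrite !ffunE.
  case: ifP => [_ -> //|_]; case: ifP => [_ ->|//].
  by rewrite rev_cons cat_rcons.
exists ((2 * (size src + size dst)).+2 + n).+1.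
  move: le4 le_n; rewrite [size (a :: u)]/=.
  by move: (size src) (size dst) (size u) => x y z; lia.
apply: StarS d; exists a, (2 * (size src + size dst)).+1; split=> //.
apply: transfer1_complete => // i; have := tr i; rewrite !ffunE.
case: ifP => [_ -> //|_]; by case: ifP.
Qed.

End Transfer.

(** * Bounded derivations from Horn clauses *)

Section HornClauses.
Variables (Sigma : finType) (nv : nat).

Definition atom := seq (seq Sigma).
Definition pattern := seq (Sigma + 'I_nv).
Definition clause := (seq (seq pattern) * seq pattern)%type.

Definition inst_word (s : 'I_nv -> seq Sigma) (p : pattern) : seq Sigma :=
  flatten [seq match x with inl a => [:: a] | inr i => s i end | x <- p].

Definition inst (s : 'I_nv -> seq Sigma) (p : seq pattern) : atom :=
  [seq inst_word s x | x <- p].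

Definition atom_size (a : atom) := sumn [seq (size u).+1 | u <- a].

(** Conclusions are confined to [A] and the values of variables to size [B]. The tree itself may be
    arbitrarily large, since repeated atoms are shared in the passage to a [chain]. *)
Inductive derivable (E : seq clause) (A : seq atom) (B : nat) (w : seq Sigma) :
  atom -> Prop :=
| DInput : [:: w] \in A -> derivable E A B w [:: w]
| DClause c s :
    c \in E -> (forall i, size (s i) <= B) -> inst s c.2 \in A ->
    (forall p, p \in c.1 -> derivable E A B w (inst s p)) ->
    derivable E A B w (inst s c.2).

Inductive chain (E : seq clause) (B : nat) (w : seq Sigma) : seq atom -> Prop :=
| ChainInput : chain E B w [:: [:: w]]
| ChainStep c s L :
    c \in E -> (forall i, size (s i) <= B) ->
    {subset [seq inst s p | p <- c.1] <= L} -> chain E B w L ->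
    chain E B w (inst s c.2 :: L).

Lemma derivable_chain E A B w a :
  [:: w] \in A -> derivable E A B w a ->
  exists L, [/\ chain E B w L, a \in L, {subset L <= A} & size L <= size A].
Proof.
move=> wA da.
(* An arbitrary given chain is extended, so that the chains for the premises of a clause can be
   built one on top of the other. Keeping the chain free of repetitions inside [A] bounds its
   length. *)
suff ext L : chain E B w L -> uniq L -> {subset L <= A} ->
    exists L', [/\ chain E B w L', uniq L', {subset L' <= A},
                 {subset L <= L'} & a \in L'].
  have [//|u|L [ch un sub _ aL]] := ext _ (ChainInput E B w).
    by rewrite inE => /eqP->.
  by exists L; split=> //; apply: uniq_leq_size.
elim: da L => {a} [inA|c s cE sB inA _ IH] L ch un sub.
  exists L; split=> //.
  elim: ch {un sub} => [|c s L' _ _ _ _ IH]; first exact: mem_head.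
  by rewrite inE IH orbT.
have [L' [ch' un' sub' LL' prems]] : exists L',
    [/\ chain E B w L', uniq L', {subset L' <= A}, {subset L <= L'} &
      {subset [seq inst s p | p <- c.1] <= L'}].
  elim: c.1 IH => [|p ps IHps] IH; first by exists L; split=> // b.
  have [|L1 [ch1 un1 sub1 LL1 in1]] := IHps.
    by move=> q qps; apply: IH; rewrite inE qps orbT.
  have [L2 [ch2 un2 sub2 L12 in2]] := IH p (mem_head _ _) L1 ch1 un1 sub1.
  exists L2; split=> //; first by move=> b /LL1 /L12.
  by move=> b /=; rewrite inE => /orP[/eqP->|/in1 /L12].
have [aL'|aL'] := boolP (inst s c.2 \in L'); first by exists L'.
exists (inst s c.2 :: L'); split=> /=.
- exact: ChainStep.
- by rewrite aL'.
- by move=> b; rewrite inE => /orP[/eqP->|/sub'].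
- by move=> b /LL' bL'; rewrite inE bL' orbT.
- exact: mem_head.
Qed.

(** * Stack layout and elementary search programs *)

Local Notation aux := (option bool).
Local Notation sym := (Sigma + aux)%type.
Local Notation psym := (sym + 'I_nv)%type.
Local Notation idx := 'I_nv.+3.
Local Notation mem := {ffun idx -> seq sym}.
Local Notation prog := (prog Sigma aux nv.+2).
Local Notation transfer := (@transfer Sigma aux nv.+2).
Local Notation init_mem := (@init_mem Sigma aux nv.+2).

Definition sOpen : sym := inr (Some true).
Definition sClose : sym := inr (Some false).
Definition sSep : sym := inr None.

(* The pool of derived atoms, its part already scanned (reversed), a scratch
   stack, and a stack for the value of each variable. *)
Definition iPool : idx := ord0.
Definition iDone : idx := lift ord0 ord0.
Definition iTemp : idx := lift ord0 (lift ord0 ord0).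
Definition iVar (v : 'I_nv) : idx := lift ord0 (lift ord0 (lift ord0 v)).

Lemma iVar_eq i j : (iVar i == iVar j) = (i == j).
Proof. by []. Qed.

Lemma idxP (Q : idx -> Prop) :
  Q iPool -> Q iDone -> Q iTemp -> (forall v, Q (iVar v)) -> forall i, Q i.
Proof.
move=> QP QD QT QV i.
case: (unliftP ord0 i) => [j ->|-> //].
case: (unliftP ord0 j) => [l ->|-> //].
by case: (unliftP ord0 l) => [v ->|->]; [apply: QV | apply: QT].
Qed.

Definition mk (P D T : seq sym) (V : 'I_nv -> seq sym) : mem :=
  [ffun i => match unlift ord0 i with
    | None => P
    | Some j => match unlift ord0 j with
      | None => D
      | Some l => if unlift ord0 l is Some v then V v else T
      end
    end].

Lemma mkP P D T V : mk P D T V iPool = P.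
Proof. by rewrite ffunE unlift_none. Qed.
Lemma mkD P D T V : mk P D T V iDone = D.
Proof. by rewrite ffunE liftK unlift_none. Qed.
Lemma mkT P D T V : mk P D T V iTemp = T.
Proof. by rewrite ffunE !liftK unlift_none. Qed.
Lemma mkV P D T V v : mk P D T V (iVar v) = V v.
Proof. by rewrite ffunE !liftK. Qed.
Definition mkE := (mkP, mkD, mkT, mkV).

Lemma mem_mk (m : mem) P D T V :
  m iPool = P -> m iDone = D -> m iTemp = T -> (forall v, m (iVar v) = V v) ->
  m = mk P D T V.
Proof.
move=> EP ED ET EV; apply/ffunP; elim/idxP => [||| v]; by rewrite mkE.
Qed.

Lemma upd_mkP P D T V s : upd (mk P D T V) iPool s = mk s D T V.
Proof. by apply: mem_mk => [|||v]; rewrite ffunE /= ?mkE. Qed.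

Lemma upd_mkD P D T V s : upd (mk P D T V) iDone s = mk P s T V.
Proof. by apply: mem_mk => [|||v]; rewrite ffunE /= ?mkE. Qed.

Lemma pool_done_sound n P D T V m' :
  den (transfer [:: iPool] [:: iDone]) n (mk P D T V) m' ->
  exists u P', P = u ++ P' /\ m' = mk P' (rev u ++ D) T V.
Proof.
move=> /transfer_sound[] // u tr; exists u, (m' iPool); split.
  by have := tr iPool; rewrite mkE.
apply: mem_mk => // [||v].
- by have := tr iDone; rewrite mkE.
- by have := tr iTemp; rewrite mkE.
- by have := tr (iVar v); rewrite mkE.
Qed.

Lemma done_pool_sound n P D T V m' :
  den (transfer [:: iDone] [:: iPool]) n (mk P D T V) m' ->
  exists u D', D = u ++ D' /\ m' = mk (rev u ++ P) D' T V.
Proof.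
move=> /transfer_sound[] // u tr; exists u, (m' iDone); split.
  by have := tr iDone; rewrite mkE.
apply: mem_mk => // [||v].
- by have := tr iPool; rewrite mkE.
- by have := tr iTemp; rewrite mkE.
- by have := tr (iVar v); rewrite mkE.
Qed.

Lemma pool_done_complete u P D T V :
  exists2 n, n <= 11 * size u + 1 &
    den (transfer [:: iPool] [:: iDone]) n (mk (u ++ P) D T V)
      (mk P (rev u ++ D) T V).
Proof.
by apply: transfer_complete => // i; elim/idxP: i => [|||v]; rewrite !mkE.
Qed.

Lemma done_pool_complete u P D T V :
  exists2 n, n <= 11 * size u + 1 &
    den (transfer [:: iDone] [:: iPool]) n (mk P (u ++ D) T V)
      (mk (rev u ++ P) D T V).
Proof.
by apply: transfer_complete => // i; elim/idxP: i => [|||v]; rewrite !mkE.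
Qed.

Definition psym_val (V : 'I_nv -> seq sym) (x : psym) : seq sym :=
  match x with inl a => [:: a] | inr i => V i end.

Definition psyms_val V (s : seq psym) := flatten [seq psym_val V x | x <- s].

(** For a variable, its value is compared with the pool by popping both; [Empty] ensures that the
    whole value was matched. The reversed copy kept in [iTemp] then restores the variable. *)
Definition match_sym (x : psym) : prog :=
  match x with
  | inl a => Seq (Pop iPool a) (Push iDone a)
  | inr i =>
      Seq (transfer [:: iVar i; iPool] [:: iDone; iTemp])
        (Seq (Empty _ _ (iVar i))
           (Seq (transfer [:: iTemp] [:: iVar i]) (Empty _ _ iTemp)))
  end.

Lemma match_sym_sound x n P D V m' :
  den (match_sym x) n (mk P D [::] V) m' ->
  exists2 P', P = psym_val V x ++ P' &
    m' = mk P' (rev (psym_val V x) ++ D) [::] V.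
Proof.
case: x => [a|i] /=.
  move=> /den_seqE[? [? [? [/den_popE[P' + ->] /den_pushE->]]]]; rewrite mkE => ->.
  by exists P' => //; rewrite upd_mkP upd_mkD mkE.
move=> /den_seqE[? [? [m1 [/transfer_sound tr1]]]].
move=> /den_seqE[? [? [? [/den_emptyE[Ei ->]]]]].
move=> /den_seqE[? [? [m2 [/transfer_sound tr2 /den_emptyE[ET ->]]]]].
have [//|u1 {}tr1] := tr1; have [//|u2 {}tr2] := tr2.
have EV : V i = u1.
  by have := tr1 (iVar i); rewrite mkE !inE iVar_eq eqxx /= Ei cats0.
have ET1 : u2 = rev u1.
  have E2 : m1 iTemp = u2 ++ m2 iTemp := tr2 iTemp.
  have E1 : m1 iTemp = rev u1 ++ mk P D [::] V iTemp := tr1 iTemp.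
  by move: E2; rewrite E1 ET mkE !cats0.
exists (m1 iPool).
  by have := tr1 iPool; rewrite mkE EV.
apply: mem_mk => // [||v].
- by have := tr2 iPool.
- have := tr2 iDone => /= ->.
  by have := tr1 iDone; rewrite mkE EV.
- have := tr2 (iVar v); have := tr1 (iVar v); rewrite !mkE !inE !iVar_eq /=.
  case: eqP => [->|_]; last by move=> -> ->.
  by move=> _ ->; rewrite ET1 revK Ei cats0 EV.
Qed.

Definition seqs (l : seq prog) : prog :=
  foldr (fun p q => Seq p q) (Skip _ _ _) l.

Definition match_word (s : seq psym) : prog := seqs [seq match_sym x | x <- s].

Lemma match_word_sound s n P D V m' :
  den (match_word s) n (mk P D [::] V) m' ->
  exists2 P', P = psyms_val V s ++ P' &
    m' = mk P' (rev (psyms_val V s) ++ D) [::] V.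
Proof.
elim: s n P D => [|x s IH] n P D; first by move=> [_ ->]; exists P.
move=> /den_seqE[? [? [? [/match_sym_sound[P1 -> ->] /IH[P2 -> ->]]]]].
by exists P2; rewrite /psyms_val /= ?rev_cat -!catA.
Qed.

(** A substring test: skip a guessed prefix, match, rewind. The last [Empty] forces the rewinding to
    be complete, so the pool is left unchanged. *)
Definition check (s : seq psym) : prog :=
  seqs [:: transfer [:: iPool] [:: iDone]; match_word s;
           transfer [:: iDone] [:: iPool]; Empty _ _ iDone].

Lemma check_sound s n P V m' :
  den (check s) n (mk P [::] [::] V) m' ->
  m' = mk P [::] [::] V /\ exists u v, P = u ++ psyms_val V s ++ v.
Proof.
move=> /den_seqE[? [? [? [/pool_done_sound[u [P1 [-> ->]]]]]]].
move=> /den_seqE[? [? [? [/match_word_sound[P2 -> ->]]]]].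
move=> /den_seqE[? [? [? [/done_pool_sound[v [D [E ->]]]]]]].
move=> /den_seqE[? [? [? [/den_emptyE[ED ->] [_ ->]]]]].
rewrite mkD in ED; rewrite ED !cats0 in E *.
split; last by exists u, P2.
by rewrite -E rev_cat !revK -catA.
Qed.

Definition emit_sym (x : psym) : prog :=
  match x with
  | inl a => Push iPool a
  | inr i =>
      seqs [:: transfer [:: iVar i] [:: iTemp]; Empty _ _ (iVar i);
               transfer [:: iTemp] [:: iVar i; iPool]; Empty _ _ iTemp]
  end.

Lemma emit_sym_sound x n P D V m' :
  den (emit_sym x) n (mk P D [::] V) m' ->
  m' = mk (psym_val V x ++ P) D [::] V.
Proof.
case: x => [a|i] /=; first by move=> /den_pushE->; rewrite upd_mkP mkE.
move=> /den_seqE[? [? [m1 [/transfer_sound tr1]]]].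
move=> /den_seqE[? [? [? [/den_emptyE[Ei ->]]]]].
move=> /den_seqE[? [? [m2 [/transfer_sound tr2]]]].
move=> /den_seqE[? [? [? [/den_emptyE[ET ->] [_ ->]]]]].
have [//|u1 {}tr1] := tr1; have [//|u2 {}tr2] := tr2.
have EV : V i = u1.
  by have := tr1 (iVar i); rewrite mkE !inE iVar_eq eqxx /= Ei cats0.
have ET1 : u2 = rev u1.
  have E2 : m1 iTemp = u2 ++ m2 iTemp := tr2 iTemp.
  have E1 : m1 iTemp = rev u1 ++ mk P D [::] V iTemp := tr1 iTemp.
  by move: E2; rewrite E1 ET mkE !cats0.
apply: mem_mk => // [||v].
- have := tr2 iPool => /= ->; have := tr1 iPool; rewrite mkE /= => ->.
  by rewrite ET1 revK EV.
- have := tr2 iDone => /= ->.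
  by have := tr1 iDone; rewrite mkE.
- have := tr2 (iVar v); have := tr1 (iVar v); rewrite !mkE !inE !iVar_eq /=.
  rewrite orbF; case: eqP => [->|_]; last by move=> -> ->.
  by move=> _ ->; rewrite ET1 revK Ei cats0 EV.
Qed.

Definition emit_word (s : seq psym) : prog :=
  seqs [seq emit_sym x | x <- rev s].

Lemma seqs_catE l1 l2 n m m' :
  den (seqs (l1 ++ l2)) n m m' ->
  exists n1 n2 m1, den (seqs l1) n1 m m1 /\ den (seqs l2) n2 m1 m'.
Proof.
elim: l1 n m => [|p l1 IH] n m d; first by exists 1, n, m.
have [n1 [_ [m1 [d1 /IH[n2 [n3 [m2 [d2 d3]]]]]]]] := den_seqE d.
by exists (n1 + n2).+1, n3, m2; split=> //; apply: den_seqI d1 d2.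
Qed.

Lemma emit_word_sound s n P D V m' :
  den (emit_word s) n (mk P D [::] V) m' ->
  m' = mk (psyms_val V s ++ P) D [::] V.
Proof.
elim: s n m' => [|x s IH] n m'; first by move=> [_ ->].
rewrite /emit_word rev_cons map_rcons -cats1.
move=> /seqs_catE[_ [_ [m1 [/IH-> /den_seqE[? [? [? [+ [_ ->]]]]]]]]].
by move=> /emit_sym_sound->; rewrite /psyms_val /= catA.
Qed.

(** Only letters of [Sigma] are guessed, so the value of a variable never contains a bracket or
    separator of the pool. *)
Definition guess (i : 'I_nv) : prog :=
  seqs [:: transfer [:: iVar i] [::]; Empty _ _ (iVar i);
           Star (@Branch _ _ _ Sigma (fun a => Push (iVar i) (inl a)))].

Lemma guess_sound i n P D T V m' :
  den (guess i) n (mk P D T V) m' ->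
  exists u, m' = mk P D T (fun v => if v == i then map inl u else V v).
Proof.
move=> /den_seqE[? [? [m1 [/transfer_sound tr1]]]].
move=> /den_seqE[? [? [? [/den_emptyE[Ei ->]]]]].
move=> /den_seqE[n1 [_ [m2 [st [_ ->]]]]].
have [//|u1 {}tr1] := tr1.
have {tr1 Ei} E1 : m1 = mk P D T (fun v => if v == i then map inl [::] else V v).
  apply: mem_mk.
  - by have := tr1 iPool; rewrite mkE.
  - by have := tr1 iDone; rewrite mkE.
  - by have := tr1 iTemp; rewrite mkE.
  - move=> v; have := tr1 (iVar v); rewrite mkE inE iVar_eq.
    by case: eqP => [->|_].
elim: st [::] E1 => {n1 m1 m2} [m1 u E1|n1 n2 m1 m2 m3 + _ IH u E1].
  by exists u.
move=> [a [n3 [_ /den_pushE E2]]]; apply: (IH (a :: u)).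
rewrite E2 E1 mkE eqxx; apply: mem_mk => [|||v].
- by rewrite ffunE /= mkE.
- by rewrite ffunE /= mkE.
- by rewrite ffunE /= mkE.
- by rewrite ffunE iVar_eq mkE; case: eqP.
Qed.

Definition guess_all : prog := seqs [seq guess i | i <- enum 'I_nv].

Lemma mk_eq P D T V V' : V =1 V' -> mk P D T V = mk P D T V'.
Proof. by move=> EV; apply: mem_mk => [|||v]; rewrite mkE. Qed.

Lemma guess_all_sound n P D T V m' :
  den guess_all n (mk P D T V) m' ->
  exists s : 'I_nv -> seq Sigma, m' = mk P D T (fun v => map inl (s v)).
Proof.
suff gen l n1 V1 : den (seqs [seq guess i | i <- l]) n1 (mk P D T V1) m' ->
    exists s : 'I_nv -> seq Sigma,
      m' = mk P D T (fun v => if v \in l then map inl (s v) else V1 v).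
  move=> /gen[s ->]; exists s; apply: mk_eq => v.
  by rewrite mem_enum.
elim: l n1 V1 => [|i l IH] n1 V1; first by move=> [_ ->]; exists (fun=> [::]).
move=> /den_seqE[? [? [? [/guess_sound[u ->] /IH[s ->]]]]].
exists (fun v => if v \in l then s v else u); apply: mk_eq => v.
by rewrite inE; case: ifP => _; rewrite ?orbT ?orbF //; case: eqP.
Qed.

(** * Running times of the elementary programs *)

Lemma match_sym_complete x P D V :
  exists2 n, n <= 22 * size (psym_val V x) + 7 &
    den (match_sym x) n (mk (psym_val V x ++ P) D [::] V)
      (mk P (rev (psym_val V x) ++ D) [::] V).
Proof.
case: x => [a|i] /=.
  exists 3; first by lia.
  have := den_seqI (den_popI (mkP (a :: P) D [::] V)) (den_pushI iDone a _).
  by rewrite upd_mkP mkD upd_mkD.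
pose V1 v := if v == i then [::] else V v.
have [//|//||n1 le1 d1] := @transfer_complete _ _ _ [:: iVar i; iPool] [:: iDone; iTemp]
    (V i) (mk (V i ++ P) D [::] V) (mk P (rev (V i) ++ D) (rev (V i)) V1).
  move=> j; elim/idxP: j => [|||v]; rewrite !mkE ?cats0 //.
  rewrite !inE iVar_eq /= /V1 orbF; case: eqP => [->|//].
  by rewrite cats0.
have [//|//||n2 le2 d2] := @transfer_complete _ _ _ [:: iTemp] [:: iVar i]
    (rev (V i)) (mk P (rev (V i) ++ D) (rev (V i)) V1)
    (mk P (rev (V i) ++ D) [::] V).
  move=> j; elim/idxP: j => [|||v]; rewrite !mkE ?cats0 //.
  rewrite !inE iVar_eq /= /V1; case: eqP => [->|//].
  by rewrite revK cats0.
exists (n1 + (1 + (n2 + 1).+1).+1).+1.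
  by move: le1 le2; rewrite size_rev; set z := size (V i); lia.
apply: den_seqI d1 _; apply: den_seqI;
  first by apply: den_emptyI; rewrite mkE /V1 eqxx.
by apply: den_seqI d2 _; apply: den_emptyI; rewrite mkE.
Qed.

Lemma match_word_complete s P D V :
  exists2 n, n <= 22 * size (psyms_val V s) + 8 * size s + 1 &
    den (match_word s) n (mk (psyms_val V s ++ P) D [::] V)
      (mk P (rev (psyms_val V s) ++ D) [::] V).
Proof.
elim: s D => [|x s IH] D; first by exists 1.
have [n1 le1 d1] := match_sym_complete x (psyms_val V s ++ P) D V.
have [n2 le2 d2] := IH (rev (psym_val V x) ++ D).
exists (n1 + n2).+1; first by rewrite /psyms_val /= size_cat -/(psyms_val V s); lia.
by rewrite /psyms_val /= rev_cat -!catA; apply: den_seqI d1 d2.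
Qed.

Lemma check_complete s u v V :
  exists2 n, n <= 33 * size (u ++ psyms_val V s ++ v) + 8 * size s + 10 &
    den (check s) n (mk (u ++ psyms_val V s ++ v) [::] [::] V)
      (mk (u ++ psyms_val V s ++ v) [::] [::] V).
Proof.
have [n1 le1 d1] := pool_done_complete u (psyms_val V s ++ v) [::] [::] V.
have [n2 le2 d2] := match_word_complete s v (rev u ++ [::]) V.
have [n3 le3 d3] := done_pool_complete (rev (psyms_val V s) ++ rev u) v [::] [::] V.
exists (n1 + (n2 + (n3 + (1 + 1).+1).+1).+1).+1.
  by move: le3; rewrite !size_cat !size_rev; lia.
move: d3; rewrite rev_cat !revK -!catA => d3.
apply: den_seqI d1 _; apply: den_seqI d2 _; apply: den_seqI d3 _.
exact: (den_seqI (den_emptyI (mkD _ _ _ _)) (den_skipI _)).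
Qed.

Lemma emit_sym_complete x P D V :
  exists2 n, n <= 22 * size (psym_val V x) + 9 &
    den (emit_sym x) n (mk P D [::] V) (mk (psym_val V x ++ P) D [::] V).
Proof.
case: x => [a|i] /=.
  exists 1; first by lia.
  by have := den_pushI iPool a (mk P D [::] V); rewrite upd_mkP mkP.
pose V1 v := if v == i then [::] else V v.
have [//|//||n1 le1 d1] := @transfer_complete _ _ _ [:: iVar i] [:: iTemp]
    (V i) (mk P D [::] V) (mk P D (rev (V i)) V1).
  move=> j; elim/idxP: j => [|||v]; rewrite !mkE ?cats0 //.
  rewrite !inE iVar_eq /= /V1; case: eqP => [->|//].
  by rewrite cats0.
have [//|//||n2 le2 d2] := @transfer_complete _ _ _ [:: iTemp] [:: iVar i; iPool]
    (rev (V i)) (mk P D (rev (V i)) V1)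
    (mk (V i ++ P) D [::] V).
  move=> j; elim/idxP: j => [|||v]; rewrite !mkE ?cats0 ?revK //.
  rewrite !inE iVar_eq /= /V1 orbF; case: eqP => [->|//].
  by rewrite cats0.
exists (n1 + (1 + (n2 + (1 + 1).+1).+1).+1).+1.
  by move: le1 le2; rewrite size_rev; set z := size (V i); lia.
apply: den_seqI d1 _; apply: den_seqI;
  first by apply: den_emptyI; rewrite mkE /V1 eqxx.
apply: den_seqI d2 _.
exact: (den_seqI (den_emptyI (mkT _ _ _ _)) (den_skipI _)).
Qed.

Lemma seqs_catI l1 l2 n1 n2 m m1 m' :
  den (seqs l1) n1 m m1 -> den (seqs l2) n2 m1 m' ->
  exists2 n, n <= n1 + n2 & den (seqs (l1 ++ l2)) n m m'.
Proof.
elim: l1 n1 m => [|p l1 IH] n1 m; first by move=> [-> ->] d; exists n2.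
move=> [n3 [n4 [m2 [-> d1 d2]]]] /(IH _ _ d2)[n le_n d].
by exists (n3 + n).+1; [lia | apply: den_seqI d1 d].
Qed.

Lemma emit_word_complete s P D V :
  exists2 n, n <= 22 * size (psyms_val V s) + 12 * size s + 1 &
    den (emit_word s) n (mk P D [::] V) (mk (psyms_val V s ++ P) D [::] V).
Proof.
elim: s => [|x s [n1 le1 d1]]; first by exists 1.
have [n2 le2 d2] := emit_sym_complete x (psyms_val V s ++ P) D V.
have d2' : den (seqs [:: emit_sym x]) (n2 + 1).+1 (mk (psyms_val V s ++ P) D [::] V)
    (mk (psym_val V x ++ psyms_val V s ++ P) D [::] V).
  exact: den_seqI d2 (den_skipI _).
have [n le_n d] := seqs_catI d1 d2'.
exists n; last by rewrite /emit_word rev_cons map_rcons -cats1 /psyms_val /= -catA.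
by rewrite /psyms_val /= size_cat -/(psyms_val V s); lia.
Qed.

Lemma guess_complete i u P D T V :
  exists2 n, n <= 11 * size (V i) + 3 * size u + 8 &
    den (guess i) n (mk P D T V)
      (mk P D T (fun v => if v == i then map inl u else V v)).
Proof.
pose V1 u v := if v == i then map inl u else V v.
have [//|//||n1 le1 d1] := @transfer_complete _ _ _ [:: iVar i] [::]
    (V i) (mk P D T V) (mk P D T (V1 [::])).
  move=> j; elim/idxP: j => [|||v]; rewrite !mkE ?cats0 //.
  rewrite !inE iVar_eq /= /V1; case: eqP => [->|//].
  by rewrite cats0.
have d2 : den (Star (@Branch _ _ _ Sigma (fun a => Push (iVar i) (inl a))))
    (3 * size u + 1) (mk P D T (V1 [::])) (mk P D T (V1 u)).
  (* A pushed word is built from its last letter on, hence the accumulator. *)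
  suff gen u1 u2 : den (Star (@Branch _ _ _ Sigma (fun a => Push (iVar i) (inl a))))
    (3 * size u1 + 1) (mk P D T (V1 u2)) (mk P D T (V1 (catrev u1 u2))).
    by have := gen (rev u) [::]; rewrite size_rev -/(rev _) revK.
  elim: u1 u2 => [|a u1 IH] u2; first by constructor.
  have -> : 3 * size (a :: u1) + 1 = (2 + (3 * size u1 + 1)).+1 by rewrite /=; lia.
  apply: StarS (IH (a :: u2)); exists a, 1; split=> //; split=> //.
  apply/ffunP; elim/idxP => [|||v]; rewrite [RHS]ffunE !mkE //.
  by rewrite iVar_eq /V1 eqxx; case: eqP.
exists (n1 + (1 + (3 * size u + 1 + 1).+1).+1).+1.
  by move: le1; set z := size (V i); lia.
apply: den_seqI d1 _; apply: den_seqI;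
  first by apply: den_emptyI; rewrite mkE /V1 eqxx.
exact: den_seqI d2 (den_skipI _).
Qed.

Lemma guess_all_complete (s : 'I_nv -> seq Sigma) B P D T V :
  (forall v, size (s v) <= B) -> (forall v, size (V v) <= B) ->
  exists2 n, n <= nv * (14 * B + 9) + 1 &
    den guess_all n (mk P D T V) (mk P D T (fun v => map inl (s v))).
Proof.
move=> sB.
suff gen l V1 : (forall v, size (V1 v) <= B) ->
    exists2 n, n <= size l * (14 * B + 9) + 1 &
      den (seqs [seq guess i | i <- l]) n (mk P D T V1)
        (mk P D T (fun v => if v \in l then map inl (s v) else V1 v)).
  move=> /gen -/(_ (enum 'I_nv))[n]; rewrite size_enum_ord => le_n d.
  exists n => //; apply: eq_ind _ (den _ _ _) d _ (mk_eq _ _ _ _) => v.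
  by rewrite mem_enum.
elim: l V1 => [|i l IH] V1 VB; first by exists 1.
have [n1 le1 d1] := guess_complete i (s i) P D T V1.
have [|n2 le2 d2] := IH (fun v => if v == i then map inl (s i) else V1 v).
  by move=> v; case: eqP => // _; rewrite size_map.
exists (n1 + n2).+1.
  by have := VB i; have := sB i; move: le1 le2; rewrite /= mulSn; lia.
apply: den_seqI d1 (eq_ind _ (den _ _ _) d2 _ (mk_eq _ _ _ _)) => v.
by rewrite inE; case: ifP => _; rewrite ?orbT ?orbF //; case: eqP => [->|].
Qed.

(** * Encoding of the pool of atoms *)

Definition enc_atom (a : atom) : seq sym :=
  sOpen :: flatten [seq rcons (map inl u) sSep | u <- a] ++ [:: sClose].

Definition enc_pattern (p : pattern) : seq psym :=
  [seq match x with inl a => inl (inl a) | inr i => inr i end | x <- p].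

Definition enc_patterns (p : seq pattern) : seq psym :=
  inl sOpen :: flatten [seq rcons (enc_pattern x) (inl sSep) | x <- p] ++
  [:: inl sClose].

Definition enc_pool (L : seq atom) : seq sym := flatten (map enc_atom L).

Lemma psyms_val_cat V s1 s2 :
  psyms_val V (s1 ++ s2) = psyms_val V s1 ++ psyms_val V s2.
Proof. by rewrite /psyms_val map_cat flatten_cat. Qed.

Lemma psyms_val_pattern (s : 'I_nv -> seq Sigma) p :
  psyms_val (fun v => map inl (s v)) (enc_pattern p) = map inl (inst_word s p).
Proof.
by elim: p => //= x p IH; rewrite /inst_word /= map_cat -IH; case: x.
Qed.

Lemma psyms_val_enc (s : 'I_nv -> seq Sigma) p :
  psyms_val (fun v => map inl (s v)) (enc_patterns p) = enc_atom (inst s p).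
Proof.
rewrite /enc_patterns -cat1s !psyms_val_cat /enc_atom /=; congr cons; congr cat.
elim: p => //= x p IH; rewrite !psyms_val_cat -cats1 psyms_val_cat IH.
by rewrite psyms_val_pattern -cats1.
Qed.

Lemma size_enc_atom a : size (enc_atom a) = atom_size a + 2.
Proof.
rewrite /enc_atom /= size_cat /= size_flatten /atom_size /shape -map_comp.
rewrite (@eq_map _ _ _ (fun u => (size u).+1)); first by lia.
by move=> u /=; rewrite size_rcons size_map.
Qed.

Lemma enc_pool_cons a L : enc_pool (a :: L) = enc_atom a ++ enc_pool L.
Proof. by []. Qed.

Lemma size_enc_pool L B :
  (forall a, a \in L -> atom_size a <= B) ->
  size (enc_pool L) <= size L * (B + 2).
Proof.
elim: L => [|a L IH] aB //; rewrite enc_pool_cons size_cat size_enc_atom mulSn.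
by rewrite leq_add ?leq_add2r ?aB ?mem_head // IH // => b bL; rewrite aB // inE bL orbT.
Qed.

Lemma split_at (T : eqType) (c : T) (u v u' v' : seq T) :
  c \notin u -> c \notin u' -> u ++ c :: v = u' ++ c :: v' -> u = u' /\ v = v'.
Proof.
elim: u u' => [|x u IH] [|y u'] //=.
- by move=> _ _ [->].
- by rewrite inE negb_or => _ /andP[/eqP cy _] [].
- by rewrite inE negb_or => /andP[/eqP cx _] _ [/esym].
rewrite !inE !negb_or => /andP[_ cu] /andP[_ cu'] [-> /IH].
by case/(_ cu cu') => -> ->.
Qed.

Lemma enc_atom_inj : injective enc_atom.
Proof.
have sepP (u : seq Sigma) : sSep \notin ([seq inl x | x <- u] : seq sym).
  by apply/mapP=> -[].
move=> a b [] /eqP; rewrite !cats1 eqseq_rcons => /andP[/eqP + _].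
elim: a b => [|u a IH] [|v b] //=; try by case: (map _ _).
rewrite -!cats1 -!catA /= => E; have [] := split_at (sepP u) (sepP v) E.
move=> /inj_map -> => [/IH -> //|].
by move=> x y [].
Qed.

Definition atom_body (a : atom) : seq sym :=
  flatten [seq rcons (map inl u) sSep | u <- a].

Lemma atom_body_inr a (b : bool) : inr (Some b) \notin atom_body a.
Proof.
apply/flatten_mapP => -[u _]; rewrite mem_rcons inE /=.
by apply/negP; apply/mapP=> -[].
Qed.

Lemma split_first (T : eqType) (c : T) (u : seq T) :
  c \in u -> exists u1 u2, c \notin u1 /\ u = u1 ++ c :: u2.
Proof.
elim: u => //= x u IH; rewrite inE; case: eqP => [-> _|cx /= /IH].
  by exists [::], u.
case=> u1 [u2 [cu1 ->]]; exists (x :: u1), u2.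
by rewrite inE negb_or cu1; split=> //; case: eqP.
Qed.

(** This makes the substring test of [check] correct: brackets occur only at the ends of encoded
    atoms, so an occurrence of an encoded atom cannot straddle two atoms of the pool. The induction
    drops the first atom once the occurrence begins beyond its opening bracket. *)
Lemma enc_pool_mem L u a v : enc_pool L = u ++ enc_atom a ++ v -> a \in L.
Proof.
elim: L u => [|b L IH] u; first by case: u.
have encE c w : enc_atom c ++ w = sOpen :: atom_body c ++ sClose :: w.
  by rewrite /enc_atom /= -catA.
rewrite enc_pool_cons !encE; case: u => [|x u] /= [].
  move=> /(split_at (atom_body_inr b false) (atom_body_inr a false))[E _].
  suff -> : a = b by rewrite mem_head.
  by apply: enc_atom_inj; rewrite /enc_atom -!/(atom_body _) E.
move=> _ E; rewrite inE; apply/orP; right.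
have : sClose \in u.
  have := atom_body_inr b true; apply: contraR => uC.
  have CO : sClose \notin u ++ sOpen :: atom_body a.
    by rewrite mem_cat negb_or uC inE atom_body_inr.
  move: E; rewrite -cat_cons catA => /(split_at (atom_body_inr b false) CO)[-> _].
  by rewrite mem_cat mem_head orbT.
case/split_first=> u1 [u2 [Cu1 Eu]]; move: E; rewrite Eu -catA.
move=> /(split_at (atom_body_inr b false) Cu1)[_ E].
by apply: (IH u2); rewrite encE.
Qed.

(** * The search engine for Horn derivations *)

Section Engine.
Variables (E : seq clause) (goal : atom).

Definition clause_prog (c : clause) : prog :=
  seqs [:: guess_all; seqs [seq check (enc_patterns p) | p <- c.1];
           emit_word (enc_patterns c.2)].

(** The input is put aside on [iDone] so that the separator and the closing bracket can be pushed
    beneath it. *)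
Definition init_prog : prog :=
  seqs [:: transfer [:: iPool] [:: iDone]; Empty _ _ iPool;
           Push iPool sClose; Push iPool sSep;
           transfer [:: iDone] [:: iPool]; Empty _ _ iDone;
           Push iPool sOpen].

Definition body_prog : prog :=
  @Branch _ _ _ 'I_(size E)
    (fun i => clause_prog (nth ([::], [::]) E (nat_of_ord i))).

Definition goal_patterns : seq pattern := [seq map inl u | u <- goal].

Definition horn_prog : prog :=
  seqs [:: init_prog; Star body_prog; check (enc_patterns goal_patterns)].

Lemma psyms_val_goal V :
  psyms_val V (enc_patterns goal_patterns) = enc_atom goal.
Proof.
rewrite /enc_patterns -cat1s !psyms_val_cat /enc_atom /goal_patterns /=.
congr cons; congr cat; elim: goal => //= u g IH.
rewrite !psyms_val_cat -!cats1 psyms_val_cat IH; congr ((_ ++ _) ++ _).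
by elim: u => //= x u; rewrite /psyms_val /= => ->.
Qed.

Lemma init_mem_mk w :
  init_mem w = mk (map inl w) [::] [::] (fun=> [::]) :> mem.
Proof. by apply: mem_mk => [|||v]; rewrite ffunE. Qed.

Lemma init_prog_sound n w m :
  den init_prog n (init_mem w) m ->
  m = mk (enc_pool [:: [:: w]]) [::] [::] (fun=> [::]).
Proof.
rewrite init_mem_mk.
move=> /den_seqE[? [? [? [/pool_done_sound[u [P1 [Ew ->]]]]]]].
move=> /den_seqE[? [? [? [/den_emptyE[+ ->]]]]]; rewrite mkP => EP.
move=> /den_seqE[? [? [? [/den_pushE->]]]]; rewrite upd_mkP mkP.
move=> /den_seqE[? [? [? [/den_pushE->]]]]; rewrite upd_mkP mkP.
move=> /den_seqE[? [? [? [/done_pool_sound[v [D [Ev ->]]]]]]].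
move=> /den_seqE[? [? [? [/den_emptyE[+ ->]]]]]; rewrite mkD => ED.
move=> /den_seqE[? [? [? [/den_pushE-> [_ ->]]]]]; rewrite upd_mkP mkP.
move: Ev Ew; rewrite ED EP !cats0 => <- Ew; rewrite revK.
by rewrite /enc_pool /enc_atom /= Ew -cats1 -!catA.
Qed.

Lemma checks_sound ps n P (s : 'I_nv -> seq Sigma) m' :
  den (seqs [seq check (enc_patterns p) | p <- ps]) n
    (mk P [::] [::] (fun v => map inl (s v))) m' ->
  m' = mk P [::] [::] (fun v => map inl (s v)) /\
  forall p, p \in ps -> exists u v, P = u ++ enc_atom (inst s p) ++ v.
Proof.
elim: ps n => [|p ps IH] n; first by move=> [_ ->].
move=> /den_seqE[? [? [? [/check_sound[-> Ep] /IH[-> Eps]]]]]; split=> // q.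
by rewrite inE => /orP[/eqP->|/Eps//]; rewrite -psyms_val_enc.
Qed.

Lemma clause_prog_sound c n L V m' :
  den (clause_prog c) n (mk (enc_pool L) [::] [::] V) m' ->
  exists s : 'I_nv -> seq Sigma,
    m' = mk (enc_pool (inst s c.2 :: L)) [::] [::] (fun v => map inl (s v)) /\
    forall p, p \in c.1 -> inst s p \in L.
Proof.
move=> /den_seqE[? [? [? [/guess_all_sound[s ->]]]]].
move=> /den_seqE[? [? [? [/checks_sound[-> prems]]]]].
move=> /den_seqE[? [? [? [/emit_word_sound-> [_ ->]]]]].
exists s; split; first by rewrite psyms_val_enc.
by move=> p /prems[u [v /enc_pool_mem]].
Qed.

(** Any property closed under the clauses holds of every atom that enters the pool, whatever the
    guesses and however long the run. *)
Lemma horn_prog_sound (Valid : atom -> Prop) w n m :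
  Valid [:: w] ->
  (forall c s, c \in E -> (forall p, p \in c.1 -> Valid (inst s p)) ->
    Valid (inst s c.2)) ->
  den horn_prog n (init_mem w) m -> Valid goal.
Proof.
move=> Vw Vstep /den_seqE[? [? [m1 [/init_prog_sound Em1]]]].
move=> /den_seqE[n1 [? [m2 [st]]]].
move=> /den_seqE[? [? [? [ch _]]]].
have [L [V [Em2 VL]]] : exists L V,
    m2 = mk (enc_pool L) [::] [::] V /\ forall a, a \in L -> Valid a.
  have VL1 a : a \in [:: [:: w]] -> Valid a by rewrite inE => /eqP->.
  elim: st [:: [:: w]] (fun=> [::]) Em1 VL1 => {n1 m1 m2 ch}.
    by move=> m1 L V Em VL; exists L, V.
  move=> n1 n2 m1 m2 m3 [i [n3 [_ d]]] _ IH L V Em VL; rewrite Em in d.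
  have [s [Em2 prems]] := clause_prog_sound d.
  apply: IH Em2 _ => a; rewrite inE => /orP[/eqP->|/VL//].
  apply: Vstep => [|p /prems/VL//].
  exact: mem_nth.
rewrite Em2 in ch; have [_ [u [v]]] := check_sound ch.
by rewrite psyms_val_goal => /enc_pool_mem/VL.
Qed.

Lemma init_prog_complete w :
  exists2 n, n <= 22 * size w + 20 &
    den init_prog n (init_mem w)
      (mk (enc_pool [:: [:: w]]) [::] [::] (fun=> [::])).
Proof.
pose w' : seq sym := [seq inl i | i <- w]; pose V (v : 'I_nv) : seq sym := [::].
have [n1 le1 d1] := pool_done_complete w' [::] [::] [::] V.
have [n2 le2 d2] :=
  done_pool_complete (rev w') [:: sSep; sClose] [::] [::] V.
rewrite !cats0 in d1 d2; rewrite revK in d2.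
exists (n1 + (1 + (1 + (1 + (n2 + (1 + (1 + 1).+1).+1).+1).+1).+1).+1).+1.
  by move: le1 le2; rewrite size_rev size_map; lia.
rewrite init_mem_mk; apply: den_seqI d1 _.
apply: (den_seqI (den_emptyI (mkP _ _ _ _))).
apply: (den_seqI (den_pushI _ _ _)); rewrite upd_mkP mkP.
apply: (den_seqI (den_pushI _ _ _)); rewrite upd_mkP mkP.
apply: (den_seqI d2); apply: (den_seqI (den_emptyI (mkD _ _ _ _))).
have -> : enc_pool [:: [:: w]] = sOpen :: w' ++ [:: sSep; sClose].
  by rewrite /enc_pool /enc_atom /= -cats1 -!catA.
apply: (den_seqI (den_pushI _ _ _)); rewrite upd_mkP mkP.
exact: den_skipI.
Qed.

Lemma enc_pool_occ L a :
  a \in L -> exists u v, enc_pool L = u ++ enc_atom a ++ v.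
Proof.
case/splitPr=> L1 L2; exists (enc_pool L1), (enc_pool L2).
by rewrite /enc_pool map_cat flatten_cat.
Qed.

Lemma checks_complete ps : exists K, forall S L (s : 'I_nv -> seq Sigma),
  size (enc_pool L) <= S -> (forall p, p \in ps -> inst s p \in L) ->
  exists2 n, n <= K * S.+1 &
    den (seqs [seq check (enc_patterns p) | p <- ps]) n
      (mk (enc_pool L) [::] [::] (fun v => map inl (s v)))
      (mk (enc_pool L) [::] [::] (fun v => map inl (s v))).
Proof.
elim: ps => [|p ps [K IH]]; first by exists 1 => S L s _ _; exists 1.
exists (33 + 8 * size (enc_patterns p) + 11 + K) => S L s LS prems.
have [|n2 le2 d2] := IH S L s LS.
  by move=> q qps; apply: prems; rewrite inE qps orbT.
have [u [v EL]] := enc_pool_occ (prems p (mem_head _ _)).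
rewrite -psyms_val_enc in EL.
have [n1 le1 d1] := check_complete (enc_patterns p) u v (fun v => map inl (s v)).
rewrite -EL in le1 d1; exists (n1 + n2).+1; last exact: den_seqI d1 d2.
move: le1 le2 LS; set k := size (enc_patterns p); set l := size (enc_pool L).
by move=> ? ? ?; nia.
Qed.

(** The constant depends on the clause alone: guessing, checking and emitting are all linear in the
    bound [S] on the new pool and the variable values. *)
Lemma clause_prog_complete c : exists K, forall S L (s : 'I_nv -> seq Sigma) V,
  size (enc_pool (inst s c.2 :: L)) <= S ->
  (forall v, size (s v) <= S) -> (forall v, size (V v) <= S) ->
  (forall p, p \in c.1 -> inst s p \in L) ->
  exists2 n, n <= K * S.+1 &
    den (clause_prog c) n (mk (enc_pool L) [::] [::] V)
      (mk (enc_pool (inst s c.2 :: L)) [::] [::] (fun v => map inl (s v))).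
Proof.
have [K checks] := checks_complete c.1.
set k := size (enc_patterns c.2).
exists (23 * nv + 1 + K + (22 + 12 * k + 1) + 4) => S L s V.
rewrite enc_pool_cons size_cat => LS sS VS prems.
have [n1 le1 d1] := guess_all_complete (enc_pool L) [::] [::] sS VS.
have [n2 le2 d2] := checks S L s (leq_trans (leq_addl _ _) LS) prems.
have [n3 le3 d3] := emit_word_complete (enc_patterns c.2) (enc_pool L) [::]
  (fun v => map inl (s v)).
rewrite psyms_val_enc in le3 d3.
exists (n1 + (n2 + (n3 + 1).+1).+1).+1.
  move: le1 le2 le3 LS; rewrite -/k; set l := size (enc_pool L).
  by set a := size (enc_atom _) => ? ? ? ?; nia.
apply: den_seqI d1 _; apply: den_seqI d2 _.
exact: den_seqI d3 (den_skipI _).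
Qed.

Lemma clauses_complete : exists K, forall c S L (s : 'I_nv -> seq Sigma) V,
  c \in E -> size (enc_pool (inst s c.2 :: L)) <= S ->
  (forall v, size (s v) <= S) -> (forall v, size (V v) <= S) ->
  (forall p, p \in c.1 -> inst s p \in L) ->
  exists2 n, n <= K * S.+1 &
    den (clause_prog c) n (mk (enc_pool L) [::] [::] V)
      (mk (enc_pool (inst s c.2 :: L)) [::] [::] (fun v => map inl (s v))).
Proof.
elim: E => [|c E' [K IH]]; first by exists 0.
have [K' cK'] := clause_prog_complete c; exists (K + K') => d S L s V.
rewrite inE => /predU1P[-> LS sS VS prems|dE LS sS VS prems].
  have [n le_n dn] := cK' S L s V LS sS VS prems; exists n => //.
  by rewrite mulnDl (leq_trans le_n) ?leq_addl.
have [n le_n dn] := IH d S L s V dE LS sS VS prems; exists n => //.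
by rewrite mulnDl (leq_trans le_n) ?leq_addr.
Qed.

(** A chain grows at its head, which is the last round of the loop. *)
Lemma starn_rcons (P : nat -> mem -> mem -> Prop) n1 n2 m m1 m2 :
  starn P n1 m m1 -> P n2 m1 m2 -> starn P (n1 + n2).+1 m m2.
Proof.
move=> st; elim: st n2 m2 => {n1 m m1} [m n2 m2 Pm|n1 n3 m m1 m3 Pm _ IH n2 m2 Pm2].
  by rewrite addnC; apply: StarS Pm (Star0 _ _).
have -> : ((n1 + n3).+1 + n2).+1 = (n1 + (n3 + n2).+1).+1 by lia.
exact: StarS Pm (IH _ _ Pm2).
Qed.

Lemma horn_prog_complete : exists K, forall B S w L,
  chain E B w L -> goal \in L -> B <= S -> size (enc_pool L) <= S ->
  exists n m, n <= size L * (K * S.+1) + K * S.+1 /\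
    den horn_prog n (init_mem w) m.
Proof.
have [K cK] := clauses_complete.
(* The 3 is the loop overhead per round, 55 = 22 + 33 are the slopes of initialization and final
   check, and 40 exceeds the remaining additive constants. *)
exists (K + 3 + 55 + 8 * size (enc_patterns goal_patterns) + 40).
set k := size (enc_patterns _) => B S w L ch gL BS LS.
have [n1 le1 d1] := init_prog_complete w.
have [n2 [V [le2 VS d2]]] : exists n2 (V : 'I_nv -> seq sym),
    [/\ n2 <= size L * (K * S.+1 + 3), forall v, size (V v) <= S
    & den (Star body_prog) n2 (mk (enc_pool [:: [:: w]]) [::] [::] (fun=> [::]))
        (mk (enc_pool L) [::] [::] V)].
  elim: ch {gL} LS => [|c s L' cE sB prems _ IH] LS.
    by exists 1, (fun=> [::]); split=> //; [rewrite /=; lia | apply: Star0].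
  have [|n [V [le_n VS d]]] := IH.
    by apply: leq_trans LS; rewrite enc_pool_cons size_cat leq_addl.
  have sS v : size (s v) <= S := leq_trans (sB v) BS.
  have [|n' le_n' d'] := cK c S L' s V cE LS sS VS.
    by move=> p pc; apply: prems; apply: map_f.
  exists (n + n'.+1).+1, (fun v => map inl (s v)); split=> [|v|].
  - by rewrite /= mulSn; lia.
  - by rewrite size_map.
  apply: starn_rcons d _.
  have lt_i : index c E < size E by rewrite index_mem.
  by exists (Ordinal lt_i), n'; split=> //=; rewrite nth_index.
have [u [v EL]] := enc_pool_occ gL.
have [n3 le3 d3] := check_complete (enc_patterns goal_patterns) u v V.
rewrite psyms_val_goal -EL in le3 d3.
exists (n1 + (n2 + (n3 + 1).+1).+1).+1, (mk (enc_pool L) [::] [::] V); split.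
  have wS : size w <= S.
    apply: leq_trans LS; elim: ch {gL d2 le2 EL d3 le3}.
      by rewrite enc_pool_cons size_cat size_enc_atom /atom_size /=; lia.
    by move=> c s L' _ _ _ _; rewrite enc_pool_cons size_cat; lia.
  move: le1 le2 le3 LS; rewrite -/k; set l := size L; set q := size (enc_pool L).
  by move=> ? ? ? ?; nia.
by apply: den_seqI d1 _; apply: den_seqI d2 _; apply: den_seqI d3 (den_skipI _).
Qed.

End Engine.

(** Soundness goes through the invariant [Valid] alone; all polynomial bounds are confined to the
    last hypothesis, which is about words in [L]. *)
Theorem in_NP_horn (E : seq clause) (goal : atom) (L : seq Sigma -> Prop)
    (Valid : seq Sigma -> atom -> Prop) (p : {poly nat}) :
  (forall w, Valid w [:: w]) ->
  (forall w c s, c \in E -> (forall q, q \in c.1 -> Valid w (inst s q)) ->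
    Valid w (inst s c.2)) ->
  (forall w, Valid w goal -> L w) ->
  (forall w, L w -> exists A,
    [/\ size A <= p.[size w]%R, [:: w] \in A,
        forall a, a \in A -> atom_size a <= p.[size w]%R &
        derivable E A p.[size w]%R w goal]) ->
  in_NP L.
Proof.
move=> Vw Vstep Vgoal complete.
have [K hK] := horn_prog_complete E goal.
(* The pool holds at most [p] atoms, each encoded by at most [p + 2] symbols; the last summand makes
   [S] bound the variable values as well. *)
pose S : {poly nat} := (p * (p + 2%:R) + p)%R.
apply: (@in_NP_prog _ _ _ (horn_prog E goal) L
  (p * (K%:R * (S + 1)) + K%:R * (S + 1))%R) => [n w m d|w Lw].
  apply: Vgoal; apply: horn_prog_sound d => //; first exact: Vstep.
have [A [AB wA aB der]] := complete w Lw; set B := (p.[size w])%R in AB aB der *.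
have [Ls [ch gL LsA LA]] := derivable_chain wA der.
have [//||n [m [le_n d]]] := hK B (B * (B + 2) + B) w Ls ch gL.
- exact: leq_addl.
- apply: leq_trans (size_enc_pool (fun a aL => aB a (LsA a aL))) _.
  apply: leq_trans (leq_addr _ _); rewrite leq_mul2r; apply/orP; right.
  exact: leq_trans LA AB.
exists n, m; split=> //; apply: leq_trans le_n _.
have natE j : (j%:R : {poly nat})%R = (j%:P)%R by rewrite -polyC_natr natrE.
have -> : (p * (K%:R * (S + 1)) + K%:R * (S + 1))%R.[size w]%R =
    B * (K * (B * (B + 2) + B).+1) + K * (B * (B + 2) + B).+1.
  rewrite -[X in (S + X)%R]/(1%:R)%R /S !natE !(hornerD, hornerM, hornerC).
  by rewrite -[(_ + B).+1]addn1.
by rewrite leq_add2r leq_mul // (leq_trans LA AB).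
Qed.

End HornClauses.

(** * Compression of derivation trees *)

Section Compression.
Variables (fact tok : eqType).
Variable leaf : seq tok -> fact -> Prop.
Variable step : fact -> fact -> fact -> seq tok -> fact -> Prop.

Inductive tree : fact -> seq tok -> Prop :=
| TLeaf v g : leaf v g -> tree g v
| TStep p1 p2 p3 v g w1 w2 w3 :
    step p1 p2 p3 v g -> tree p1 w1 -> tree p2 w2 -> tree p3 w3 ->
    tree g (w1 ++ w2 ++ w3 ++ v).

Variables (F : seq fact) (U : seq tok).

Hypothesis step_closed : forall p1 p2 p3 v g,
  step p1 p2 p3 v g -> g \in F -> [/\ p1 \in F, p2 \in F & p3 \in F].

(** Derivations as DAGs: a line may be used as a premise repeatedly, and a fact may have several
    lines with different tokens. By [undup] no annotation is longer than a list of distinct elements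
    of [U]. *)
Inductive lines : seq (fact * seq tok) -> Prop :=
| LNil : lines [::]
| LLeaf v g L : leaf v g -> g \in F -> {subset v <= U} -> lines L ->
    lines ((g, undup v) :: L)
| LStep p1 p2 p3 v g w1 w2 w3 L :
    step p1 p2 p3 v g -> g \in F -> {subset v <= U} ->
    (p1, w1) \in L -> (p2, w2) \in L -> (p3, w3) \in L -> lines L ->
    lines ((g, undup (w1 ++ w2 ++ w3 ++ v)) :: L).

Lemma lines_sub L g w : lines L -> (g, w) \in L -> uniq w /\ {subset w <= U}.
Proof.
move=> lL; elim: lL g w => {L} // [v h L _ _ vU _ IH|p1 p2 p3 v h w1 w2 w3 L _ _ vU].
  move=> g w; rewrite inE => /orP[/eqP[_ ->]|/IH//]; rewrite undup_uniq.
  by split=> // x; rewrite mem_undup => /vU.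
move=> in1 in2 in3 _ IH g w; rewrite inE => /orP[/eqP[_ ->]|/IH//].
rewrite undup_uniq; split=> // x; rewrite mem_undup !mem_cat.
have [_ s1] := IH _ _ in1; have [_ s2] := IH _ _ in2; have [_ s3] := IH _ _ in3.
by case/or4P=> [/s1|/s2|/s3|/vU].
Qed.

Definition covered (L : seq (fact * seq tok)) (X : seq tok) (g : fact) :=
  exists2 w, (g, w) \in L & {subset X <= w}.

Lemma covered_mono L L' X g :
  {subset L <= L'} -> covered L X g -> covered L' X g.
Proof. by move=> LL' [w /LL' inL' Xw]; exists w. Qed.

(** Weaker than closure under the rules: the conclusion must have some line covering [X], not the
    line with the tokens just computed. One line per fact can therefore be enough. *)
Definition closed L X :=
  (forall v g, leaf v g -> g \in F -> {subset v <= U} -> {subset X <= v} ->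
     covered L X g) /\
  (forall p1 p2 p3 v g w1 w2 w3,
     step p1 p2 p3 v g -> g \in F -> {subset v <= U} ->
     (p1, w1) \in L -> (p2, w2) \in L -> (p3, w3) \in L ->
     {subset X <= w1 ++ w2 ++ w3 ++ v} -> covered L X g).

(** Every line added covers a fact of [F] that was not covered before, so [missing] decreases and at
    most [size F] lines are added, whatever [L] is. *)
Lemma saturate L X : lines L ->
  exists L', [/\ lines L', {subset L <= L'}, size L' <= size L + size F
    & closed L' X].
Proof.
pose missing L0 := count (fun g => ~~ `[< covered L0 X g >]) F.
have step1 L1 g w : {subset X <= w} -> g \in F -> ~ covered L1 X g ->
    missing ((g, w) :: L1) < missing L1.
  move=> Xw gF ncov; have cov : covered ((g, w) :: L1) X g.
    by exists w; rewrite ?mem_head.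
  have mono h : covered L1 X h -> covered ((g, w) :: L1) X h.
    by apply: covered_mono => y yL; rewrite inE yL orbT.
  rewrite /missing; case/splitPr: gF => F1 F2; rewrite !count_cat /=.
  have -> : `[< covered ((g, w) :: L1) X g >] by apply/asboolP.
  have -> : `[< covered L1 X g >] = false by apply/asboolPn.
  rewrite /= add0n add1n addnS ltnS leq_add //; apply: sub_count => h /=;
  by apply: contra => /asboolP /mono c; apply/asboolP.
suff ext n L1 : missing L1 <= n -> lines L1 ->
    exists L', [/\ lines L', {subset L1 <= L'}, size L' <= size L1 + n
      & closed L' X].
  by apply: ext; apply: count_size.
elim: n L1 => [|n IH] L1 le_n l1.
  exists L1; split=> //; first by rewrite addn0.
  have cov g : g \in F -> covered L1 X g.
    move=> gF; apply: contrapT => ncov; have Xg x : x \in X -> x \in X by [].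
    by have := step1 L1 g X Xg gF ncov; rewrite ltnNge (leq_trans le_n).
  by split=> [v g _ gF _ _|p1 p2 p3 v g w1 w2 w3 _ gF _ _ _ _ _]; apply: cov.
have [cl|ncl] := pselect (closed L1 X).
  by exists L1; split=> //; rewrite leq_addr.
have [g [w [gF Xw ncov lw]]] : exists g w,
    [/\ g \in F, {subset X <= w}, ~ covered L1 X g & lines ((g, w) :: L1)].
  apply: contrapT => no; apply: ncl; split.
    move=> v g lf gF vU Xv; apply: contrapT => ncov; apply: no.
    exists g, (undup v); split=> //; last exact: LLeaf.
    by move=> x /Xv; rewrite mem_undup.
  move=> p1 p2 p3 v g w1 w2 w3 st gF vU i1 i2 i3 Xv.
  apply: contrapT => ncov; apply: no.
  exists g, (undup (w1 ++ w2 ++ w3 ++ v)); split=> //; last exact: LStep st _ _ _ _ _ _.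
  by move=> x /Xv; rewrite mem_undup.
have [|L' [l' sub sz cl]] := IH ((g, w) :: L1) _ lw.
  by rewrite -ltnS (leq_trans (step1 _ _ _ Xw gF ncov)).
exists L'; split=> //; first by move=> y yL; apply: sub; rewrite inE yL orbT.
by move: sz; rewrite /= addSnnS.
Qed.

(** Covering the empty set means having a line at all, so one saturation fixes a derivation for each
    fact that is derivable within [U]. *)
Lemma closed_tree L f w : closed L [::] -> tree f w -> f \in F ->
  {subset w <= U} -> exists w', (f, w') \in L.
Proof.
move=> [clf cls] t; elim: t => {f w} [v g lf|p1 p2 p3 v g w1 w2 w3 st _ IH1 _ IH2 _ IH3].
  by move=> gF vU; have [//|w' ? _] := clf _ _ lf gF vU; exists w'.
move=> gF wU; have [p1F p2F p3F] := step_closed st gF.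
have [|w1' i1] := IH1 p1F; first by move=> x xw; apply: wU; rewrite mem_cat xw.
have [|w2' i2] := IH2 p2F; first by move=> x xw; apply: wU; rewrite !mem_cat xw orbT.
have [|w3' i3] := IH3 p3F; first by move=> x xw; apply: wU; rewrite !mem_cat xw !orbT.
have vU : {subset v <= U} by move=> x xw; apply: wU; rewrite !mem_cat xw !orbT.
by have [//|w' ? _] := cls _ _ _ _ _ _ _ _ st gF vU i1 i2 i3; exists w'.
Qed.

Lemma split_cover (X w1 w2 w3 v : seq tok) : uniq X ->
  {subset X <= w1 ++ w2 ++ w3 ++ v} ->
  exists X1 X2 X3, [/\ [/\ uniq X1, uniq X2 & uniq X3],
    [/\ {subset X1 <= w1}, {subset X2 <= w2} & {subset X3 <= w3}],
    size X1 + size X2 + size X3 <= size X,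
    [/\ {subset X1 <= X}, {subset X2 <= X} & {subset X3 <= X}] &
    {subset X <= X1 ++ X2 ++ X3 ++ v}].
Proof.
elim: X => [|x X IH] /=; first by move=> _ _; exists [::], [::], [::].
move=> /andP[xX uX] sub.
have [|X1 [X2 [X3 [[u1 u2 u3] [s1 s2 s3] sz [t1 t2 t3] cov]]]] := IH uX.
  by move=> y yX; apply: sub; rewrite inE yX orbT.
have subc (Y Z : seq tok) : {subset Y <= Z} -> {subset Y <= x :: Z}.
  by move=> YZ y /YZ; rewrite inE orbC => ->.
have cons_sub (Y Z : seq tok) : x \in Z -> {subset Y <= Z} -> {subset x :: Y <= Z}.
  by move=> xZ YZ y; rewrite inE => /orP[/eqP->|/YZ].
have ucons (Y : seq tok) : {subset Y <= X} -> uniq Y -> uniq (x :: Y).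
  by move=> YX /= ->; rewrite andbT; apply: contra xX => /YX.
have := sub x (mem_head _ _); rewrite !mem_cat => /or4P[xw|xw|xw|xw].
- exists (x :: X1), X2, X3; split.
  + by split=> //; apply: ucons.
  + by split=> //; apply: cons_sub.
  + by rewrite /= !addSn.
  + by split; [apply: cons_sub (mem_head _ _) _|..]; apply: subc.
  + by apply: cons_sub (mem_head _ _) _ => y /cov yc; rewrite inE yc orbT.
- exists X1, (x :: X2), X3; split.
  + by split=> //; apply: ucons.
  + by split=> //; apply: cons_sub.
  + by rewrite /= addnS addSn.
  + by split; [|apply: cons_sub (mem_head _ _) _|]; apply: subc.
  + apply: cons_sub; first by rewrite !mem_cat mem_head orbT.
    by move=> y /cov; rewrite !mem_cat inE => /or4P[]->; rewrite ?orbT.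
- exists X1, X2, (x :: X3); split.
  + by split=> //; apply: ucons.
  + by split=> //; apply: cons_sub.
  + by rewrite /= addnS.
  + by split; [| |apply: cons_sub (mem_head _ _) _]; apply: subc.
  + apply: cons_sub; first by rewrite !mem_cat mem_head !orbT.
    by move=> y /cov; rewrite !mem_cat inE => /or4P[]->; rewrite ?orbT.
- exists X1, X2, X3; split=> //.
  + by rewrite (leq_trans sz).
  + by split; apply: subc.
  + by apply: cons_sub => //; rewrite !mem_cat xw !orbT.
Qed.

(** Each square is at most [k - 1] times its base, so the squares sum up to at most [(k - 1) * k].
    The gained 1 pays for one saturation at a branching point. *)
Lemma sum_squares_lt a b c k :
  a < k -> b < k -> c < k -> a + b + c <= k -> a ^ 2 + b ^ 2 + c ^ 2 + 1 <= k ^ 2.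
Proof.
case: k => // k; rewrite !ltnS -!mulnn => ak bk ck abc.
have ha : a * a <= k * a by rewrite leq_mul2r ak orbT.
have hb : b * b <= k * b by rewrite leq_mul2r bk orbT.
have hc : c * c <= k * c by rewrite leq_mul2r ck orbT.
have : k * (a + b + c) <= k * k.+1 by rewrite leq_mul2l abc orbT.
by rewrite !mulnDr mulSn; lia.
Qed.

Definition complete_lines (L : seq (fact * seq tok)) :=
  forall g w, tree g w -> g \in F ->
  {subset w <= U} -> exists w', (g, w') \in L.

(* If one child covers [X], closedness carries the cover up to the root at no
   cost; otherwise [X] is split among the children, and the quadratic bound
   survives since the parts are smaller than [X] and sum up to at most [X]. *)
Lemma cover_tree f w : tree f w -> f \in F -> {subset w <= U} ->
  forall X L, uniq X -> {subset X <= w} -> lines L -> complete_lines L ->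
  exists L', [/\ lines L', {subset L <= L'},
    size L' <= size L + size F * size X ^ 2, covered L' X f &
    X = [::] \/ closed L' X].
Proof.
elim=> {f w} [v g lf|p1 p2 p3 v g w1 w2 w3 st t1 IH1 t2 IH2 t3 IH3] gF wU X L.
  move=> uX Xv lL cL; have [L' [lL' LL' sz cl]] := saturate X lL.
  case: X uX Xv cl => [|x X] uX Xv cl.
    exists L; split=> //; [by rewrite muln0 addn0| |by left].
    by have [|w' i] := cL g v _ gF wU; [apply: TLeaf | exists w'].
  exists L'; split=> //; last by right.
    by rewrite (leq_trans sz) // leq_add2l -[leqLHS]muln1 leq_mul2l expn_gt0 orbT.
  by have [clf _] := cl; apply: clf lf _ _ _.
move=> uX Xw lL cL; have [p1F p2F p3F] := step_closed st gF.
have w1U : {subset w1 <= U} by move=> x xw; apply: wU; rewrite mem_cat xw.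
have w2U : {subset w2 <= U} by move=> x xw; apply: wU; rewrite !mem_cat xw orbT.
have w3U : {subset w3 <= U} by move=> x xw; apply: wU; rewrite !mem_cat xw !orbT.
have vU : {subset v <= U} by move=> x xw; apply: wU; rewrite !mem_cat xw !orbT.
(* For empty [X] the bound leaves no room for a new line; [complete_lines] already supplies one. *)
have [X0|X0] := eqVneq X [::].
  rewrite {}X0; exists L; split=> //; [by rewrite muln0 addn0| |by left].
  have [|w' i] := cL g _ _ gF wU; first exact: TStep st t1 t2 t3.
  by exists w'.
(* If one premise has a line covering [X], the step applies with arbitrary lines for the other two,
   and closedness then yields a covering line for the conclusion. *)
have up L' : {subset L <= L'} -> closed L' X ->
    covered L' X p1 \/ covered L' X p2 \/ covered L' X p3 -> covered L' X g.
  move=> LL' [_ cls] cov.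
  have [w1' i1] := cL _ _ t1 p1F w1U; have [w2' i2] := cL _ _ t2 p2F w2U.
  have [w3' i3] := cL _ _ t3 p3F w3U.
  case: cov => [|[]] [w' i' Xw'].
  - apply: cls st gF vU i' (LL' _ i2) (LL' _ i3) _ => x /Xw' xw.
    by rewrite mem_cat xw.
  - apply: cls st gF vU (LL' _ i1) i' (LL' _ i3) _ => x /Xw' xw.
    by rewrite !mem_cat xw orbT.
  - apply: cls st gF vU (LL' _ i1) (LL' _ i2) i' _ => x /Xw' xw.
    by rewrite !mem_cat xw !orbT.
have [c1|n1] := pselect {subset X <= w1}.
  have [L' [lL' LL' sz cov cl]] := IH1 p1F w1U X L uX c1 lL cL.
  exists L'; split=> //; case: cl => // [/eqP|cl]; first by rewrite (negbTE X0).
  by apply: up => //; left.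
have [c2|n2] := pselect {subset X <= w2}.
  have [L' [lL' LL' sz cov cl]] := IH2 p2F w2U X L uX c2 lL cL.
  exists L'; split=> //; case: cl => // [/eqP|cl]; first by rewrite (negbTE X0).
  by apply: up => //; right; left.
have [c3|n3] := pselect {subset X <= w3}.
  have [L' [lL' LL' sz cov cl]] := IH3 p3F w3U X L uX c3 lL cL.
  exists L'; split=> //; case: cl => // [/eqP|cl]; first by rewrite (negbTE X0).
  by apply: up => //; right; right.
have [X1 [X2 [X3 [[u1 u2 u3] [s1 s2 s3] szX [r1 r2 r3] cov]]]] := split_cover uX Xw.
(* A part as large as [X] would contain all of [X] and place it within a single premise, which has
   been excluded. *)
have small (Y wi : seq tok) : uniq Y -> {subset Y <= X} -> {subset Y <= wi} ->
    ~ {subset X <= wi} -> size Y < size X.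
  move=> uY YX Yw nX; rewrite ltn_neqAle uniq_leq_size // andbT.
  apply/eqP=> szY; apply: nX => x xX; apply: Yw.
  by have [_ ->] := uniq_min_size uY YX (eq_leq (esym szY)).
have lt1 := small _ _ u1 r1 s1 n1; have lt2 := small _ _ u2 r2 s2 n2.
have lt3 := small _ _ u3 r3 s3 n3.
have [L1 [lL1 LL1 sz1 [w1' i1 c1] _]] := IH1 p1F w1U X1 L u1 s1 lL cL.
have cL1 : complete_lines L1.
  by move=> h wh th hF hU; have [w' /LL1] := cL _ _ th hF hU; exists w'.
have [L2 [lL2 LL2 sz2 [w2' i2 c2] _]] := IH2 p2F w2U X2 L1 u2 s2 lL1 cL1.
have cL2 : complete_lines L2.
  by move=> h wh th hF hU; have [w' /LL2] := cL1 _ _ th hF hU; exists w'.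
have [L3 [lL3 LL3 sz3 [w3' i3 c3] _]] := IH3 p3F w3U X3 L2 u3 s3 lL2 cL2.
(* This saturation is what the [+ 1] of [sum_squares_lt] pays for; it lets the ancestors that keep
   the same [X] carry the cover upwards for free. *)
have [L4 [lL4 LL4 sz4 cl4]] := saturate X lL3.
exists L4; split=> //; last by right.
- by move=> y /LL1/LL2/LL3/LL4.
- have := leq_mul (leqnn (size F)) (sum_squares_lt lt1 lt2 lt3 szX).
  rewrite !mulnDr muln1; move: sz4 sz3 sz2 sz1.
  move: (size F * _) (size F * _) (size F * _) (size F * _).
  move: (size L) (size L1) (size L2) (size L3) (size L4) (size F).
  by clear; lia.
- have [_ cls] := cl4.
  apply: cls st gF vU (LL4 _ (LL3 _ (LL2 _ i1))) (LL4 _ (LL3 _ i2)) (LL4 _ i3) _.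
  move=> x /cov; rewrite !mem_cat => /or4P[/c1|/c2|/c3|] ->; by rewrite ?orbT.
Qed.

(** Covering all of [U] gives one inclusion, and no line leaving [U] gives the other; together the
    annotation is exact. *)
Theorem short_lines f w : tree f w -> f \in F -> U =i w -> uniq U ->
  exists L w', [/\ lines L, (f, w') \in L, w' =i w &
    size L <= size F + size F * size U ^ 2].
Proof.
move=> t fF Uw uU; have wU : {subset w <= U} by move=> x; rewrite Uw.
have [L0 [lL0 _ sz0 cl0]] := saturate [::] LNil.
have cL0 : complete_lines L0.
  by move=> g v tg gF gU; apply: closed_tree cl0 tg gF gU.
have Usub : {subset U <= w} by move=> x; rewrite Uw.
have [L [lL _ sz [w' iw' cov] _]] := cover_tree t fF wU uU Usub lL0 cL0.
exists L, w'; split=> //.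
  move=> x; rewrite -Uw; apply/idP/idP => [|/cov//].
  by have [_ sub] := lines_sub lL iw'; apply: sub.
by apply: leq_trans sz _; rewrite leq_add2r.
Qed.

End Compression.

(** * A calculus for annotated entailment *)

Lemma mon_eq_mem mu x : x \in mu -> mon_eq (x :: mu) mu.
Proof.
case/splitPr=> a b; rewrite -cat_rcons -cat_cons.
apply: mon_eq_mul (mon_eq_refl b); rewrite -cats1 -cat1s.
apply: mon_eq_trans (mon_eq_mul (mon_eq_refl _) (mon_eq_comm _ _)) _.
rewrite catA; apply: mon_eq_trans (mon_eq_mul (mon_eq_idem _) (mon_eq_refl _)) _.
exact: mon_eq_comm.
Qed.

Lemma mon_eq_subset mu nu : {subset nu <= mu} -> mon_eq (nu ++ mu) mu.
Proof.
elim: nu => [|x nu IH] sub; first exact: mon_eq_refl.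
have sub' : {subset nu <= mu} by move=> y ynu; apply: sub; rewrite inE ynu orbT.
apply: mon_eq_trans (IH sub'); apply: mon_eq_mem.
by rewrite mem_cat sub ?mem_head ?orbT.
Qed.

(** Of two words with the same letters each absorbs the other, and the two products differ by
    commutativity. Annotations are sets from here on. *)
Lemma mon_eq_eqi mu nu : mon_eq mu nu <-> mu =i nu.
Proof.
split=> [|E].
  elim=> {mu nu} [mu|mu nu _ IH|mu nu xi _ IH1 _ IH2|mu mu' nu nu' _ IH1 _ IH2|mu nu|mu] x //.
  - by rewrite IH1.
  - by rewrite !mem_cat IH1 IH2.
  - by rewrite !mem_cat orbC.
  - by rewrite mem_cat orbb.
have sub1 : {subset mu <= nu} by move=> x; rewrite E.
have sub2 : {subset nu <= mu} by move=> x; rewrite E.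
apply: mon_eq_trans (mon_eq_sym (mon_eq_subset sub2)) _.
exact: mon_eq_trans (mon_eq_comm _ _) (mon_eq_subset sub1).
Qed.

Lemma imonE I mu nu : imon I mu = imon I nu <-> mu =i nu.
Proof. by rewrite imon_eqP; apply: mon_eq_eqi. Qed.

(** * Unique readability of the encodings *)

Lemma enc_name_prefix a b s t :
  enc_name a ++ s = enc_name b ++ t -> a = b /\ s = t.
Proof.
by elim: a b => [|x a IH] [|y b] //= [] // -> /IH[-> ->].
Qed.

Lemma enc_lconcept_prefix C D s t :
  enc_lconcept C ++ s = enc_lconcept D ++ t -> C = D /\ s = t.
Proof.
elim: C D s t => [A|R C IH|C1 IH1 C2 IH2|] [B|S D|D1 D2|] s t //= [].
- by move/enc_name_prefix=> [-> ->].
- by rewrite -!catA => /enc_name_prefix[-> /IH[-> ->]].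
- by rewrite -!catA => /IH1[-> /IH2[-> ->]].
- by move=> ->.
Qed.

Lemma enc_rconcept_prefix C D s t :
  enc_rconcept C ++ s = enc_rconcept D ++ t -> C = D /\ s = t.
Proof. by case: C D => [A|R] [B|S] //= [] /enc_name_prefix[-> ->]. Qed.

Lemma enc_annotation_prefix u v s t :
  enc_annotation u ++ s = enc_annotation v ++ t -> u = v /\ s = t.
Proof.
by case: u v => [x|] [y|] //= []; [move=> /enc_name_prefix[-> ->] | move=> ->].
Qed.

Lemma enc_axiom_prefix a b s t :
  enc_axiom a ++ s = enc_axiom b ++ t -> a = b /\ s = t.
Proof.
case: a b => [C D|R S|R A] [C' D'|R' S'|R' A'] //= []; rewrite -!catA.
- by move=> /enc_lconcept_prefix[-> /enc_rconcept_prefix[-> ->]].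
- by move=> /enc_name_prefix[-> /enc_name_prefix[-> ->]].
- by move=> /enc_name_prefix[-> /enc_name_prefix[-> ->]].
Qed.

(** No axiom begins with [SQuery], so reading axioms from the left can never run past the end of the
    TBox. *)
Lemma enc_tbox_prefix T1 T s z :
  enc_tbox T1 ++ s = enc_tbox T ++ SQuery :: z ->
  exists2 T2, T = T1 ++ T2 & s = enc_tbox T2 ++ SQuery :: z.
Proof.
elim: T1 T => [|[a u] T1 IH] [|[b v] T] /=; rewrite /enc_tbox /=.
- by exists [::].
- by move=> ->; exists ((b, v) :: T).
- by case: a.
- rewrite -!catA => /enc_axiom_prefix[-> /enc_annotation_prefix[-> /IH[T2 -> ->]]].
  by exists T2.
Qed.

Lemma enc_tbox_cat T1 T2 : enc_tbox (T1 ++ T2) = enc_tbox T1 ++ enc_tbox T2.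
Proof. by rewrite /enc_tbox map_cat flatten_cat. Qed.

(** * Facts of the calculus: contexts, bodies and tokens *)

Definition ctx := option role_name.

Definition enc_ctx (c : ctx) : seq symbol := if c is Some R then enc_name R else [::].

Inductive body := BC of lconcept | BEx of role_name | BEdge of role_name.

(** Left and right sides of concept inclusions keep their encoding in the input, so their words are
    infixes of it. Edges get the tag [SRoleIncl], with which no concept begins. *)
Definition enc_body (b : body) : seq symbol :=
  match b with
  | BC C => enc_lconcept C
  | BEx R => SEx :: enc_name R
  | BEdge R => SRoleIncl :: enc_name R
  end.

Lemma enc_name_inj : injective enc_name.
Proof. by move=> a b E; have [] := @enc_name_prefix a b [::] [::]; rewrite ?cats0. Qed.

Lemma enc_ctx_inj : injective enc_ctx.
Proof.
by move=> [R|] [S|] //= => [/enc_name_inj->||] //; [case: R | case: S].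
Qed.

Lemma enc_body_inj : injective enc_body.
Proof.
have exP R S C : SEx :: enc_name R = SEx :: enc_name S ++ enc_lconcept C -> False.
  move=> [] E; have [] := @enc_name_prefix R S [::] (enc_lconcept C).
    by rewrite cats0.
  by case: C {E}.
case=> [C|R|R] [D|S|S] //=.
- by move=> E; have [] := @enc_lconcept_prefix C D [::] [::]; rewrite ?cats0 // => ->.
- by case: C => // R' C' /esym/exP.
- by case: C.
- by case: D => // R' C' /exP.
- by move=> [] /enc_name_inj->.
- by case: D.
- by move=> [] /enc_name_inj->.
Qed.

Definition lhs (a : axiom) : body :=
  match a with GCI C _ => BC C | RoleIncl R _ => BEdge R | RangeRestr R _ => BEdge R end.

Definition body_of_rconcept (D : rconcept) : body :=
  match D with RName A => BC (LName A) | REx R => BEx R end.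

Definition rhs (a : axiom) : body :=
  match a with
  | GCI _ D => body_of_rconcept D
  | RoleIncl _ Q => BEdge Q
  | RangeRestr _ A => BC (LName A)
  end.

Lemma enc_body_rconcept D : enc_body (body_of_rconcept D) = enc_rconcept D.
Proof. by case: D. Qed.

(* [None] stands for the annotation of the element from which a derivation in
   the root context starts; the other tokens are provenance variables. *)
Definition token := option prov_var.
Definition toks (mu : monomial) : seq token := map Some mu.

Definition subst (nu : monomial) (mu : seq token) : monomial :=
  flatten [seq if t is Some x then [:: x] else nu | t <- mu].

Lemma subst_cat nu mu1 mu2 : subst nu (mu1 ++ mu2) = subst nu mu1 ++ subst nu mu2.
Proof. by rewrite /subst map_cat flatten_cat. Qed.

Lemma subst_toks nu mu : subst nu (toks mu) = mu.
Proof. by rewrite /subst /toks -map_comp; elim: mu => //= x mu ->. Qed.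

Lemma mem_subst nu mu x :
  (x \in subst nu mu) = (Some x \in mu) || (None \in mu) && (x \in nu).
Proof.
elim: mu => //= t mu IH; rewrite /subst /= mem_cat IH !inE.
case: t => [y|] /=; first by rewrite inE /= orbA.
by case: (x \in nu); rewrite ?andbT ?andbF ?orbT ?orbF.
Qed.

Lemma eq_subst nu mu1 mu2 : mu1 =i mu2 -> subst nu mu1 =i subst nu mu2.
Proof. by move=> E x; rewrite !mem_subst !E. Qed.

(** * Soundness of the calculus in all models *)

Section Soundness.
Variables (T : tbox) (A0 : concept_name).

Definition start I (c : ctx) (d' d : idom I) (nu : monomial) : Prop :=
  if c is Some R then irole R d' d (imon I nu) else iconcept A0 d (imon I nu).

Definition holds I (d' d : idom I) (b : body) (mu : monomial) : Prop :=
  match b with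
  | BC C => lext C d (imon I mu)
  | BEx R => rext (REx R) d (imon I mu)
  | BEdge R => irole R d' d (imon I mu)
  end.

Definition is_edge (b : body) : bool := if b is BEdge _ then true else false.

Definition seed (flag : bool) (nu : monomial) := if flag then nu else [::].

(* In a role context, an element reached by an edge annotated with [nu] may or
   may not inherit [nu], which the flag records. *)
Definition sound (c : ctx) (b : body) (mu : seq token) : Prop :=
  (c -> None \notin mu) /\
  forall I, is_model I T -> forall (d' d : idom I) nu, start c d' d nu ->
  exists flag kappa, [/\ holds d' d b kappa,
    kappa =i subst nu mu ++ seed flag nu, (~~ c -> ~~ flag) & (is_edge b -> flag)].

Lemma sound_eq c b mu mu' : mu =i mu' -> sound c b mu -> sound c b mu'.
Proof.
move=> E [noseed snd]; split; first by rewrite -E.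
move=> I mI d' d nu st; have [flag [k [hk Ek f1 f2]]] := snd I mI d' d nu st.
exists flag, k; split=> // x; rewrite Ek !mem_cat.
by rewrite (eq_subst _ E).
Qed.

Lemma sound_top c : sound c (BC LTop) [::].
Proof. by split=> // I mI d' d nu _; exists false, [::]. Qed.

Lemma sound_seed : sound None (BC (LName A0)) [:: None].
Proof.
split=> // I mI d' d nu st; exists false, nu; split=> // x.
by rewrite /subst /= !cats0.
Qed.

Lemma sound_edge R : sound (Some R) (BEdge R) [::].
Proof. by split=> // I mI d' d nu st; exists true, nu; split. Qed.

Lemma sound_axiom c a v mu :
  List.In (a, v) T -> sound c (lhs a) mu ->
  sound c (rhs a) (mu ++ toks (mon_of_annotation v)).
Proof.
move=> aT [noseed snd]; split.
  by move=> /noseed; rewrite mem_cat negb_or => ->; case: v {aT}.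
move=> I mI d' d nu st; have [flag [k [hk Ek f1 f2]]] := snd I mI d' d nu st.
have Ek' : mon_of_annotation v ++ k =i
    subst nu (mu ++ toks (mon_of_annotation v)) ++ seed flag nu.
  move=> x; rewrite mem_cat Ek subst_cat subst_toks !mem_cat.
  by rewrite orbC orbAC.
have := mI a v aT.
case: a {snd aT} hk f2 => [C [A|R]|R S|R A] /= hk f2 sat;
  exists flag, (mon_of_annotation v ++ k); split=> //=.
- exact: sat.
- exact: (sat _ _ hk).
- exact: sat.
- by apply: sat; exists k; split=> //; exists d'.
Qed.

Lemma sound_and c C1 C2 mu1 mu2 :
  sound c (BC C1) mu1 -> sound c (BC C2) mu2 ->
  sound c (BC (LAnd C1 C2)) (mu1 ++ mu2).
Proof.
move=> [ns1 snd1] [ns2 snd2]; split.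
  by move=> hc; rewrite mem_cat negb_or ns1 ?ns2.
move=> I mI d' d nu st.
have [fl1 [k1 [hk1 Ek1 f1 _]]] := snd1 I mI d' d nu st.
have [fl2 [k2 [hk2 Ek2 f2 _]]] := snd2 I mI d' d nu st.
exists (fl1 || fl2), (k1 ++ k2); split=> //=.
- by exists k1, k2.
- move=> x; rewrite mem_cat Ek1 Ek2 subst_cat !mem_cat.
  by case: (fl1); case: (fl2); rewrite /= ?in_nil; do !case: (x \in _).
- by move=> hc; rewrite (negbTE (f1 hc)) (negbTE (f2 hc)).
Qed.

(** The edge always carries the annotation [k] of the successor, so the flag of the filler [C] is
    absorbed by idempotency. Annotations derived in a role context contain no seed, so they do not
    depend on where they are evaluated. *)
Lemma sound_ex c R S C mu1 mu2 mu3 :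
  sound c (BEx R) mu1 -> sound (Some R) (BEdge S) mu2 ->
  sound (Some R) (BC C) mu3 ->
  sound c (BC (LEx S C)) (mu1 ++ mu2 ++ mu3).
Proof.
move=> [ns1 snd1] [/(_ isT) ns2 snd2] [/(_ isT) ns3 snd3]; split.
  by move=> hc; rewrite !mem_cat !negb_or ns1 ?ns2.
move=> I mI d' d nu st.
have [fl1 [k1 [hk1 Ek1 f1 _]]] := snd1 I mI d' d nu st.
case: hk1 => k [/imonE Ek [e st2]].
have [fl2 [k2 [hk2 Ek2 _ f2]]] := snd2 I mI d e k st2.
have [fl3 [k3 [hk3 Ek3 _ _]]] := snd3 I mI d e k st2.
exists fl1, (k2 ++ k3); split=> //=.
  by exists e, k2, k3.
move=> x; rewrite mem_cat Ek2 Ek3 !subst_cat !mem_cat f2 //= -Ek Ek1 mem_cat.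
have E mu : None \notin mu -> (x \in subst k mu) = (x \in subst nu mu).
  by move=> ns; rewrite !mem_subst (negbTE ns).
rewrite !E //; case: (fl3) => /=; rewrite ?in_nil -?Ek ?Ek1 ?mem_cat;
by do !case: (x \in _).
Qed.

Lemma sound_entails B0 m :
  sound None (BC (LName B0)) (None :: toks m) ->
  entails T (GCI (LName A0) (RName B0)) m.
Proof.
move=> [_ snd] I mI nu d st.
have [flag [k [hk Ek /(_ isT) f1 _]]] := snd I mI d d nu st.
have -> : imon I (m ++ nu) = imon I k; last exact: hk.
apply/imonE => x; rewrite Ek (negbTE f1) cats0 /subst /= -/(subst nu (toks m)).
by rewrite subst_toks !mem_cat orbC.
Qed.

End Soundness.

(** * The rules and their canonical model *)

Section Calculus.
Variables (T : tbox) (A0 : concept_name).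

Definition fact := (seq symbol * seq symbol)%type.
Definition enc_fact (c : ctx) (b : body) : fact := (enc_ctx c, enc_body b).

(* A premise that is derivable without annotation, used to give all rules the
   same number of premises. *)
Definition triv : fact := ([::], [::]).

Inductive rule0 : seq token -> fact -> Prop :=
| RuleTriv : rule0 [::] triv
| RuleTop c : rule0 [::] (enc_fact c (BC LTop))
| RuleSeed : rule0 [:: None] (enc_fact None (BC (LName A0)))
| RuleEdge R : rule0 [::] (enc_fact (Some R) (BEdge R)).

(** In [RuleEx] the role [R] does not occur in the conclusion; the side condition ties it to an
    axiom of [T], hence to the input, so that reading the rule upwards leads to finitely many
    facts. *)
Inductive rule3 : fact -> fact -> fact -> seq token -> fact -> Prop :=
| RuleAxiom c a v : List.In (a, v) T ->
    rule3 (enc_fact c (lhs a)) triv triv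
      (toks (mon_of_annotation v)) (enc_fact c (rhs a))
| RuleAnd c C1 C2 :
    rule3 (enc_fact c (BC C1)) (enc_fact c (BC C2)) triv
      [::] (enc_fact c (BC (LAnd C1 C2)))
| RuleEx c R S C D v : List.In (GCI D (REx R), v) T ->
    rule3 (enc_fact c (BEx R)) (enc_fact (Some R) (BEdge S))
      (enc_fact (Some R) (BC C)) [::] (enc_fact c (BC (LEx S C))).

Definition der (c : ctx) (b : body) : seq token -> Prop :=
  tree rule0 rule3 (enc_fact c b).

Lemma tree_noseed f mu :
  tree rule0 rule3 f mu -> (f.1 != [::]) || (f == triv) -> None \notin mu.
Proof.
elim=> {f mu} [v g [|//||]|p1 p2 p3 v g w1 w2 w3 st _ IH1 _ IH2 _ IH3] //.
rewrite !mem_cat !negb_or; case: st IH1 IH2 IH3 => [c a u _|c C1 C2|c R S C D u _].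
- move=> IH1 IH2 IH3; rewrite eq_sym; case: c IH1 => [R|] IH1;
    last by case: a {IH1} => [? []| |].
  by move=> _; rewrite IH1 ?IH2 ?IH3 ?eqxx //=; case: (R); case: u.
- move=> IH1 IH2 IH3; case: c IH1 IH2 => //= R IH1 IH2 _.
  by rewrite IH1 ?IH2 ?IH3 ?eqxx //=; case: (R).
- move=> IH1 IH2 IH3; case: c IH1 => //= R' IH1 _.
  by rewrite IH1 ?IH2 ?IH3 //=; [case: (R)|case: (R)|case: (R')].
Qed.

Lemma der_noseed R b mu : der (Some R) b mu -> None \notin mu.
Proof. by move/tree_noseed; apply; case: R. Qed.

Lemma tree_triv : tree rule0 rule3 triv [::].
Proof. by apply: TLeaf; apply: RuleTriv. Qed.

Definition tbox_vars : monomial := flatten [seq mon_of_annotation av.2 | av <- T].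

Lemma tree_vars f mu x : tree rule0 rule3 f mu -> Some x \in mu -> x \in tbox_vars.
Proof.
elim=> {f mu} [v g [] //|p1 p2 p3 v g w1 w2 w3 st _ IH1 _ IH2 _ IH3].
rewrite !mem_cat => /or4P[/IH1|/IH2|/IH3|] //.
case: st => // c a u; rewrite /tbox_vars mem_map; last by move=> ? ? [].
elim: T => //= -[b u'] T' IH [[_ ->]|/IH inT'] xu; rewrite mem_cat ?xu //.
by rewrite inT' ?orbT.
Qed.

(* The second component is the annotation with which the context was entered. *)
Definition celem := (ctx * monomial)%type.

Definition reach (c : ctx) (nu : monomial) (b : body) (kappa : monomial) : Prop :=
  exists mu flag, [/\ der c b mu, kappa =i subst nu mu ++ seed flag nu
    & (~~ c -> ~~ flag)].

Definition cmon (mu : monomial) : name -> bool := fun x => x \in mu.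

Definition cconcept (A : concept_name) (d : celem) (x : name -> bool) : Prop :=
  exists2 kappa, x = cmon kappa & reach d.1 d.2 (BC (LName A)) kappa.

(** All successors required for [R] with the same annotation are one element. Its name fixes the
    annotation of its entry, to which the derivation of the [S]-edge adds that of the role
    inclusions used. *)
Definition crole (S : role_name) (d e : celem) (x : name -> bool) : Prop :=
  exists R D v mu, [/\ e.1 = Some R, List.In (GCI D (REx R), v) T,
    reach d.1 d.2 (BEx R) e.2, der (Some R) (BEdge S) mu
    & x = cmon (e.2 ++ subst e.2 mu)].

Lemma cmon_eqP mu nu : cmon mu = cmon nu <-> mon_eq mu nu.
Proof.
rewrite mon_eq_eqi; split=> [E x|E]; last by apply: funext => x; apply: E.
exact: (congr1 (fun f => f x) E).
Qed.

Definition canonical : interp :=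
  @Interp celem (name -> bool) (inhabits (None, [::])) cconcept crole cmon cmon_eqP.

Lemma reach_eq c nu b k k' : k =i k' -> reach c nu b k -> reach c nu b k'.
Proof.
move=> E [mu [flag [dm Ek f]]]; exists mu, flag; split=> // x.
by rewrite -E Ek.
Qed.

(** Truth of left-hand sides reflects into derivations. In the existential case, [der_noseed] allows
    [e.2] to be replaced by [d.2] in the substitutions, and the flag of the filler is absorbed by
    the edge. *)
Lemma canonical_lext C (d : celem) kappa :
  @lext canonical C d (cmon kappa) -> reach d.1 d.2 (BC C) kappa.
Proof.
elim: C d kappa => [A|S C IH|C1 IH1 C2 IH2|] d kappa /=.
- move=> [k /(imonE canonical) Ek r]; apply: reach_eq r => x.
  by rewrite Ek.
- move=> [e [k1 [k2 [/(imonE canonical) Ek + /IH]]]].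
  move=> [R [D [v [mu2 [eR DT [mu1 [fl1 [d1 E1 f1]]] d2 /(imonE canonical) Ek1]]]]].
  rewrite eR => -[mu3 [fl3 [d3 E3 _]]].
  exists (mu1 ++ mu2 ++ mu3 ++ [::]), fl1; split=> //.
    by apply: (TStep _ d1 d2 d3); apply: RuleEx DT.
  move=> x; rewrite Ek mem_cat Ek1 E3 cats0 !subst_cat !mem_cat E1 mem_cat.
  have E mu : None \notin mu -> (x \in subst e.2 mu) = (x \in subst d.2 mu).
    by move=> ns; rewrite !mem_subst (negbTE ns).
  rewrite (E _ (der_noseed d2)) (E _ (der_noseed d3)).
  by case: (fl3); rewrite /= ?in_nil ?E1 ?mem_cat; do !case: (x \in _).
- move=> [k1 [k2 [/(imonE canonical) Ek /IH1[mu1 [fl1 [d1 E1 f1]]]]]].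
  move=> /IH2[mu2 [fl2 [d2 E2 f2]]].
  exists (mu1 ++ mu2 ++ [::] ++ [::]), (fl1 || fl2); split.
  + by apply: (TStep _ d1 d2 tree_triv); apply: RuleAnd.
  + move=> x; rewrite Ek mem_cat E1 E2 !subst_cat !mem_cat.
    by case: (fl1); case: (fl2); rewrite /= ?in_nil; do !case: (x \in _).
  + by move=> hc; rewrite (negbTE (f1 hc)) (negbTE (f2 hc)).
- move=> /(imonE canonical) Ek; exists [::], false; split=> //.
  by apply: TLeaf; apply: RuleTop.
Qed.

Lemma reach_axiom c nu a v k : List.In (a, v) T -> reach c nu (lhs a) k ->
  reach c nu (rhs a) (mon_of_annotation v ++ k).
Proof.
move=> aT [mu [flag [dm Ek f]]].
exists (mu ++ [::] ++ [::] ++ toks (mon_of_annotation v)), flag; split=> //.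
  by apply: (TStep _ dm tree_triv tree_triv); apply: RuleAxiom.
move=> x; rewrite mem_cat Ek !subst_cat subst_toks !mem_cat.
by do !case: (x \in _).
Qed.

Lemma canonical_model : is_model canonical T.
Proof.
move=> a v aT; case: a aT => [C [A|R]|R S|R A] aT /=.
- move=> nu d /canonical_lext r; exists (mon_of_annotation v ++ nu) => //.
  exact: reach_axiom aT r.
- move=> nu d /canonical_lext r; exists (mon_of_annotation v ++ nu); split=> //.
  (* The successor is named after the annotation just obtained, so the edge itself is derived with
     no tokens of its own. *)
  exists (Some R, mon_of_annotation v ++ nu), R, C, v, [::]; split=> //.
  + exact: (reach_axiom aT r).
  + by apply: TLeaf; apply: RuleEdge.
  + by rewrite /subst /= cats0.
- move=> nu d e [R' [D [u [mu [eR DT r dm /(imonE canonical) Enu]]]]].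
  exists R', D, u, (mu ++ [::] ++ [::] ++ toks (mon_of_annotation v)).
  split=> //; first by apply: (TStep _ dm tree_triv tree_triv); exact: RuleAxiom aT.
  apply/(imonE canonical) => x.
  rewrite mem_cat Enu !subst_cat subst_toks !mem_cat.
  by do !case: (x \in _).
- move=> nu e [k [/(imonE canonical) Ek [d]]].
  move=> [R' [D [u [mu [eR DT r dm /(imonE canonical) Ek']]]]].
  exists (mon_of_annotation v ++ nu) => //; rewrite eR.
  (* The flag is set because the annotation of every incoming edge contains [e.2]. *)
  apply: (reach_axiom aT); exists mu, true; split=> // x.
  by rewrite Ek Ek' !mem_cat orbC.
Qed.

Lemma fresh_name (s : seq name) : exists x, x \notin s.
Proof.
exists (nseq (sumn (map size s)).+1 true).
suff : forall y, y \in s -> size y <= sumn (map size s).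
  by move=> le; apply/negP => /le; rewrite size_nseq ltnn.
elim: s => //= z s IH y; rewrite inE => /orP[/eqP->|/IH le_y].
  exact: leq_addr.
by rewrite (leq_trans le_y) ?leq_addl.
Qed.

(** The canonical model is queried at a root annotated by a variable [x] foreign to [m] and [T].
    Derivations use variables of [T] only, so [x] can come from the seed alone; hence the seed
    occurs and the other tokens are exactly [m]. *)
Theorem entails_der B0 m : entails T (GCI (LName A0) (RName B0)) m ->
  exists2 mu, der None (BC (LName B0)) mu & mu =i None :: toks m.
Proof.
have [x] := fresh_name (m ++ tbox_vars); rewrite mem_cat negb_or => /andP[xm xT].
move=> /(_ canonical canonical_model [:: x] (None, [:: x])) /=.
case.
  exists [:: x] => //; exists [:: None], false; split=> //.
  by apply: TLeaf; apply: RuleSeed.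
move=> k /(imonE canonical) Ek [mu [flag [dm Ek' /(_ isT) fl]]].
exists mu => //; rewrite (negbTE fl) cats0 /= in Ek'.
have mem_mu y : (y \in m ++ [:: x]) = (Some y \in mu) || (None \in mu) && (y == x).
  by rewrite Ek Ek' mem_subst inE.
have xmu : Some x \notin mu by apply: contra xT => /(tree_vars dm).
move=> [y|]; last first.
  by have := mem_mu x; rewrite mem_cat mem_head orbT (negbTE xmu) eqxx andbT /= inE => <-.
rewrite inE /= (mem_map (@Some_inj _)).
have [->|yx] := eqVneq y x; first by rewrite (negbTE xm) (negbTE xmu).
by have := mem_mu y; rewrite mem_cat inE (negbTE yx) !orbF andbF orbF.
Qed.

End Calculus.

(** * Entailment as a set of Horn clauses *)

(** No encoded name begins with [SQuery], which keeps token lists uniquely readable. *)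
Definition enc_tok (t : token) : seq symbol :=
  if t is Some x then enc_name x else [:: SQuery].
Definition enc_toks (mu : seq token) : seq symbol := flatten (map enc_tok mu).
Definition enc_names (m : seq name) : seq symbol := flatten (map enc_name m).

Lemma enc_toks_toks m : enc_toks (toks m) = enc_names m.
Proof. by rewrite /enc_toks /toks -map_comp. Qed.

Lemma enc_toks_cat mu nu : enc_toks (mu ++ nu) = enc_toks mu ++ enc_toks nu.
Proof. by rewrite /enc_toks map_cat flatten_cat. Qed.

Lemma enc_tok_prefix t u x y : enc_tok t ++ x = enc_tok u ++ y -> t = u /\ x = y.
Proof.
case: t u => [a|] [b|] /=.
- by move/enc_name_prefix=> [-> ->].
- by case: a => [|c a] [].
- by case: b => [|c b] [].
- by case=> ->.
Qed.

Lemma enc_toks_prefix mu nu x :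
  enc_toks mu ++ x = enc_toks nu -> exists2 xi, nu = mu ++ xi & x = enc_toks xi.
Proof.
elim: mu nu => [|t mu IH] [|u nu] /=.
- by move=> ->; exists [::].
- by move=> ->; exists (u :: nu).
- by case: t => [[]|].
- rewrite /enc_toks /= -catA => /enc_tok_prefix[-> /IH[xi -> ->]].
  by exists xi.
Qed.

Lemma enc_toks_inj : injective enc_toks.
Proof.
move=> mu nu E; have [|[|t xi] -> // E'] := @enc_toks_prefix mu nu [::].
- by rewrite cats0.
- by rewrite cats0.
- by case: t E' => [[]|].
Qed.

(** * The Horn clauses *)

Definition psymbol := (symbol + 'I_7)%type.
Definition sy (s : symbol) : psymbol := inl s.
Definition pv0 : psymbol := inr (@Ordinal 7 0 isT).
Definition pv1 : psymbol := inr (@Ordinal 7 1 isT).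
Definition pv2 : psymbol := inr (@Ordinal 7 2 isT).
Definition pv3 : psymbol := inr (@Ordinal 7 3 isT).
Definition pv4 : psymbol := inr (@Ordinal 7 4 isT).
Definition pv5 : psymbol := inr (@Ordinal 7 5 isT).
Definition pv6 : psymbol := inr (@Ordinal 7 6 isT).

(* Any distinct symbols would do as predicate symbols of the atoms. *)
Definition tName := SName.
Definition tConcept := STop.
Definition tRhs := SEnd.
Definition tAnnot := SVar.
Definition tRest := SQuery.
Definition tAxiom := SGCI.
Definition tFact := SAnd.
Definition tSub := SRoleIncl.
Definition tToks := SRangeRestr.
Definition tTok := SOne.
Definition tNames := SEx.
Definition tAccept := SBit true.

Definition patom (t : symbol) (x y z : seq psymbol) : seq (seq psymbol) :=
  [:: [:: sy t]; x; y; z].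
Definition gatom (t : symbol) (x y z : seq symbol) : seq (seq symbol) :=
  [:: [:: t]; x; y; z].

Definition pName x := patom tName x [::] [::].
Definition pConcept x := patom tConcept x [::] [::].
Definition pRhs x := patom tRhs x [::] [::].
Definition pAnnot x y := patom tAnnot x y [::].
Definition pRest x := patom tRest x [::] [::].
Definition pAxiom x y z := patom tAxiom x y z.
Definition pFact x y z := patom tFact x y z.
Definition pSub x y := patom tSub x y [::].
Definition pToks x := patom tToks x [::] [::].
Definition pTok x := patom tTok x [::] [::].
Definition pNames x := patom tNames x [::] [::].
Definition pAccept := patom tAccept [::] [::] [::].

(** [pRest] says what remains of the input after some axioms have been read. Each kind of axiom has
    two clauses, one to advance and one to record the axiom with its two sides in the form of
    [enc_body], so that a single clause can later apply all axioms. *)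
Definition parse_clauses : seq (clause symbol 7) := [::
  ([::], pName [:: sy SEnd]);
  ([:: pName [:: pv0]], pName [:: sy (SBit false); pv0]);
  ([:: pName [:: pv0]], pName [:: sy (SBit true); pv0]);
  ([:: pName [:: pv0]], pConcept [:: sy SName; pv0]);
  ([:: pName [:: pv0]; pConcept [:: pv1]], pConcept [:: sy SEx; pv0; pv1]);
  ([:: pConcept [:: pv0]; pConcept [:: pv1]], pConcept [:: sy SAnd; pv0; pv1]);
  ([::], pConcept [:: sy STop]);
  ([:: pName [:: pv0]], pRhs [:: sy SName; pv0]);
  ([:: pName [:: pv0]], pRhs [:: sy SEx; pv0]);
  ([::], pAnnot [:: sy SOne] [::]);
  ([:: pName [:: pv0]], pAnnot [:: sy SVar; pv0] [:: pv0]);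
  ([:: [:: [:: pv0]]], pRest [:: pv0]);
  ([:: pRest [:: sy SGCI; pv0; pv1; pv2; pv3]; pConcept [:: pv0]; pRhs [:: pv1];
       pAnnot [:: pv2] [:: pv4]], pRest [:: pv3]);
  ([:: pRest [:: sy SGCI; pv0; pv1; pv2; pv3]; pConcept [:: pv0]; pRhs [:: pv1];
       pAnnot [:: pv2] [:: pv4]], pAxiom [:: pv0] [:: pv1] [:: pv4]);
  ([:: pRest [:: sy SRoleIncl; pv0; pv1; pv2; pv3]; pName [:: pv0]; pName [:: pv1];
       pAnnot [:: pv2] [:: pv4]], pRest [:: pv3]);
  ([:: pRest [:: sy SRoleIncl; pv0; pv1; pv2; pv3]; pName [:: pv0]; pName [:: pv1];
       pAnnot [:: pv2] [:: pv4]],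
   pAxiom [:: sy SRoleIncl; pv0] [:: sy SRoleIncl; pv1] [:: pv4]);
  ([:: pRest [:: sy SRangeRestr; pv0; pv1; pv2; pv3]; pName [:: pv0]; pName [:: pv1];
       pAnnot [:: pv2] [:: pv4]], pRest [:: pv3]);
  ([:: pRest [:: sy SRangeRestr; pv0; pv1; pv2; pv3]; pName [:: pv0]; pName [:: pv1];
       pAnnot [:: pv2] [:: pv4]],
   pAxiom [:: sy SRoleIncl; pv0] [:: sy SName; pv1] [:: pv4]);
  ([::], pTok [:: sy SQuery]);
  ([:: pName [:: pv0]], pTok [:: pv0]);
  ([::], pToks [::]);
  ([:: pTok [:: pv0]; pToks [:: pv1]], pToks [:: pv0; pv1]);
  ([::], pNames [::]);
  ([:: pName [:: pv0]; pNames [:: pv1]], pNames [:: pv0; pv1]);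
  ([:: pToks [:: pv0]], pSub [::] [:: pv0]);
  ([:: pTok [:: pv0]; pToks [:: pv2]; pSub [:: pv1] [:: pv2; pv0; pv3]],
   pSub [:: pv0; pv1] [:: pv2; pv0; pv3])].

(** Premises [pName] and [pConcept] fix how a concatenation of variables is to be read. The clause
    with two [pSub] premises exchanges an annotation for a list with the same elements, which
    implements commutativity and idempotency. *)
Definition fact_clauses : seq (clause symbol 7) := [::
  ([::], pFact [::] [:: sy STop] [::]);
  ([:: pName [:: pv0]], pFact [:: pv0] [:: sy STop] [::]);
  ([:: pRest [:: sy SQuery; pv0; pv1]; pName [:: pv0]],
   pFact [::] [:: sy SName; pv0] [:: sy SQuery]);
  ([:: pName [:: pv0]], pFact [:: pv0] [:: sy SRoleIncl; pv0] [::]);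
  ([:: pFact [:: pv0] [:: pv1] [:: pv3]; pAxiom [:: pv1] [:: pv2] [:: pv4]],
   pFact [:: pv0] [:: pv2] [:: pv3; pv4]);
  ([:: pFact [:: pv0] [:: pv1] [:: pv3]; pFact [:: pv0] [:: pv2] [:: pv4];
       pConcept [:: pv1]; pConcept [:: pv2]],
   pFact [:: pv0] [:: sy SAnd; pv1; pv2] [:: pv3; pv4]);
  ([:: pFact [:: pv0] [:: sy SEx; pv1] [:: pv4];
       pFact [:: pv1] [:: sy SRoleIncl; pv2] [:: pv5];
       pFact [:: pv1] [:: pv3] [:: pv6];
       pName [:: pv1]; pName [:: pv2]; pConcept [:: pv3]],
   pFact [:: pv0] [:: sy SEx; pv2; pv3] [:: pv4; pv5; pv6]);
  ([:: pFact [:: pv0] [:: pv1] [:: pv2]; pSub [:: pv2] [:: pv3];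
       pSub [:: pv3] [:: pv2]],
   pFact [:: pv0] [:: pv1] [:: pv3]);
  ([:: pRest [:: sy SQuery; pv0; pv1; pv2]; pName [:: pv0]; pName [:: pv1];
       pNames [:: pv2]; pFact [::] [:: sy SName; pv1] [:: sy SQuery; pv2]],
   pAccept)].

Definition clauses := parse_clauses ++ fact_clauses.
Definition goal_atom := gatom tAccept [::] [::] [::].

(** * Soundness of the clauses *)

Section Validity.
Variable w : seq symbol.

(** Axioms and facts are meaningful only relative to a complete TBox, which is not known while the
    input is being parsed. Their validity is therefore conditional on a decomposition of [w] at
    [SQuery]; acceptance supplies one. *)
Definition valid_tag (t : symbol) (x y z : seq symbol) : Prop :=
  match t with
  | SName => exists a, x = enc_name a
  | STop => exists C, x = enc_lconcept C
  | SEnd => exists D, x = enc_rconcept D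
  | SVar => exists v, x = enc_annotation v /\ y = enc_names (mon_of_annotation v)
  | SQuery => exists T, w = enc_tbox T ++ x
  | SGCI => forall T s, w = enc_tbox T ++ SQuery :: s -> exists a v,
      [/\ List.In (a, v) T, x = enc_body (lhs a), y = enc_body (rhs a)
        & z = enc_names (mon_of_annotation v)]
  | SAnd => forall T A0 s, w = enc_tbox T ++ SQuery :: enc_name A0 ++ s ->
      exists c b mu,
        [/\ x = enc_ctx c, y = enc_body b, z = enc_toks mu & sound T A0 c b mu]
  | SRoleIncl => exists mu nu,
      [/\ x = enc_toks mu, y = enc_toks nu & {subset mu <= nu}]
  | SRangeRestr => exists mu, x = enc_toks mu
  | SOne => exists t, x = enc_tok t
  | SEx => exists m, x = enc_names m
  | SBit _ => entailment_problem w
  end.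

Definition valid_atom (a : seq (seq symbol)) : Prop :=
  match a with
  | [:: u] => u = w
  | [:: u; x; y; z] => if u is [:: t] then valid_tag t x y z else False
  | _ => False
  end.

Definition valid_clause (s : 'I_7 -> seq symbol) (c : clause symbol 7) : Prop :=
  foldr (fun q P => valid_atom (inst s q) -> P) (valid_atom (inst s c.2)) c.1.

Lemma valid_clauseP s c : valid_clause s c ->
  (forall q, q \in c.1 -> valid_atom (inst s q)) -> valid_atom (inst s c.2).
Proof.
rewrite /valid_clause; elim: c.1 => //= q ps IH vc vq.
apply: IH; first by apply: vc; apply: vq; apply: mem_head.
by move=> q' qps; apply: vq; rewrite inE qps orbT.
Qed.

(** An axiom read after some initial axioms belongs to every TBox that [w] decomposes into, by
    unique readability. *)
Lemma valid_rest a v x :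
  (exists T, w = enc_tbox T ++ enc_axiom a ++ enc_annotation v ++ x) ->
  (exists T, w = enc_tbox T ++ x) /\
  (forall T s, w = enc_tbox T ++ SQuery :: s -> List.In (a, v) T).
Proof.
case=> T Ew; split.
  exists (T ++ [:: (a, v)]); rewrite Ew enc_tbox_cat /enc_tbox /=.
  by rewrite cats0 -!catA.
move=> T' s; rewrite Ew => /enc_tbox_prefix[T2 ->].
case: T2 => [|[b u] T2]; first by case: (a).
rewrite /enc_tbox /= -!catA => /enc_axiom_prefix[-> /enc_annotation_prefix[-> _]].
by rewrite List.in_app_iff; right; left.
Qed.

Lemma valid_query T T' A B s s' :
  w = enc_tbox T ++ SQuery :: enc_name A ++ s ->
  w = enc_tbox T' ++ SQuery :: enc_name B ++ s' -> [/\ T = T', A = B & s = s'].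
Proof.
move=> -> /enc_tbox_prefix[[|[a v] T2] ->]; rewrite /enc_tbox /=.
  by rewrite !cats0 => -[] /enc_name_prefix[-> ->].
by case: a.
Qed.

Lemma parse_clauses_valid s c : List.In c parse_clauses -> valid_clause s c.
Proof.
rewrite /valid_clause.
repeat (case=> [<-|]); rewrite /= /inst_word /= ?cats0 //;
  move: (s (@Ordinal 7 0 isT)) (s (@Ordinal 7 1 isT)) (s (@Ordinal 7 2 isT))
        (s (@Ordinal 7 3 isT)) (s (@Ordinal 7 4 isT)) => x0 x1 x2 x3 x4.
- by exists [::].
- by case=> a ->; exists (false :: a).
- by case=> a ->; exists (true :: a).
- by case=> a ->; exists (LName a).
- by case=> a -> [C ->]; exists (LEx a C).
- by case=> C -> [D ->]; exists (LAnd C D).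
- by exists LTop.
- by case=> a ->; exists (RName a).
- by case=> a ->; exists (REx a).
- by exists None.
- by case=> a ->; exists (Some a); rewrite /enc_names /= cats0.
- by move=> ->; exists [::].
- move=> H [C ?] [D ?] [v [? ?]]; subst x0 x1 x2 x4.
  by have [] := @valid_rest (GCI C D) v x3; rewrite //= -?catA.
- move=> H [C ?] [D ?] [v [? ?]] T z Ew; subst x0 x1 x2 x4.
  have [|_ /(_ _ _ Ew) aT] := @valid_rest (GCI C D) v x3; first by rewrite /= -catA.
  by exists (GCI C D), v; split=> //=; rewrite enc_body_rconcept.
- move=> H [R ?] [Q ?] [v [? ?]]; subst x0 x1 x2 x4.
  by have [] := @valid_rest (RoleIncl R Q) v x3; rewrite //= -?catA.
- move=> H [R ?] [Q ?] [v [? ?]] T z Ew; subst x0 x1 x2 x4.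
  have [|_ /(_ _ _ Ew) aT] := @valid_rest (RoleIncl R Q) v x3; first by rewrite /= -catA.
  by exists (RoleIncl R Q), v.
- move=> H [R ?] [Q ?] [v [? ?]]; subst x0 x1 x2 x4.
  by have [] := @valid_rest (RangeRestr R Q) v x3; rewrite //= -?catA.
- move=> H [R ?] [Q ?] [v [? ?]] T z Ew; subst x0 x1 x2 x4.
  have [|_ /(_ _ _ Ew) aT] := @valid_rest (RangeRestr R Q) v x3; first by rewrite /= -catA.
  by exists (RangeRestr R Q), v.
- by exists None.
- by case=> a ->; exists (Some a).
- by exists [::].
- by case=> t -> [mu ->]; exists (t :: mu).
- by exists [::].
- by case=> a -> [m ->]; exists (a :: m).
- by case=> mu ->; exists [::], mu.
- move=> [t ?] [mu ?] [nu [xi [? E sub]]]; subst x0 x1 x2.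
  have [xi1 Exi E1] := enc_toks_prefix E.
  have [|xi2 E2 _] := @enc_toks_prefix [:: t] xi1 x3.
    by rewrite -E1 /enc_toks /= cats0.
  exists (t :: nu), xi; split=> // u.
  rewrite inE => /orP[/eqP->|/sub//].
  by rewrite Exi E2 !mem_cat mem_head orbT.
Qed.

Lemma fact_clauses_valid s c : List.In c fact_clauses -> valid_clause s c.
Proof.
rewrite /valid_clause.
repeat (case=> [<-|]); rewrite /= /inst_word /= ?cats0 //; clear c;
  move: (s (@Ordinal 7 0 isT)) (s (@Ordinal 7 1 isT)) (s (@Ordinal 7 2 isT))
        (s (@Ordinal 7 3 isT)) (s (@Ordinal 7 4 isT)) (s (@Ordinal 7 5 isT))
        (s (@Ordinal 7 6 isT)) => x0 x1 x2 x3 x4 x5 x6.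
- move=> T A0 z _; exists None, (BC LTop), [::]; split=> //; exact: sound_top.
- move=> [R ->] T A0 z _; exists (Some R), (BC LTop), [::]; split=> //.
  exact: sound_top.
- move=> [T' Ew'] [A ?] T A0 z Ew; subst x0.
  have [_ EA _] := valid_query Ew' Ew; rewrite EA.
  exists None, (BC (LName A0)), [:: None]; split=> //; exact: sound_seed.
- move=> [R ->] T A0 z _; exists (Some R), (BEdge R), [::]; split=> //.
  exact: sound_edge.
- move=> H1 H2 T A0 z Ew; have [c0 [b [mu [-> Eb -> snd]]]] := H1 T A0 z Ew.
  have [a [v [aT El -> ->]]] := H2 T _ Ew.
  move: El; rewrite Eb => /enc_body_inj El; rewrite {}El in snd.
  exists c0, (rhs a), (mu ++ toks (mon_of_annotation v)); split=> //.
    by rewrite enc_toks_cat enc_toks_toks.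
  exact: sound_axiom.
- move=> H1 H2 [C1 ?] [C2 ?] T A0 z Ew; subst x1 x2.
  have [c [b1 [mu1 [Ec Eb1 -> snd1]]]] := H1 T A0 z Ew.
  have [c' [b2 [mu2 [Ec' Eb2 -> snd2]]]] := H2 T A0 z Ew.
  rewrite {}Ec in Ec' *; have ? := enc_ctx_inj Ec'; subst c'.
  have ? := enc_body_inj (x1 := BC C1) Eb1; have ? := enc_body_inj (x1 := BC C2) Eb2.
  subst b1 b2; exists c, (BC (LAnd C1 C2)), (mu1 ++ mu2); split=> //.
    by rewrite enc_toks_cat.
  exact: sound_and.
- move=> H1 H2 H3 [R ?] [Q ?] [C ?] T A0 z Ew; subst x1 x2 x3.
  have [c [b1 [mu1 [-> Eb1 -> snd1]]]] := H1 T A0 z Ew.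
  have [c2 [b2 [mu2 [Ec2 Eb2 -> snd2]]]] := H2 T A0 z Ew.
  have [c3 [b3 [mu3 [Ec3 Eb3 -> snd3]]]] := H3 T A0 z Ew.
  have ? := enc_body_inj (x1 := BEx R) Eb1.
  have ? := enc_body_inj (x1 := BEdge Q) Eb2.
  have ? := enc_body_inj (x1 := BC C) Eb3.
  have ? := enc_ctx_inj (x1 := Some R) Ec2; have ? := enc_ctx_inj (x1 := Some R) Ec3.
  subst b1 b2 b3 c2 c3.
  exists c, (BC (LEx Q C)), (mu1 ++ mu2 ++ mu3); split=> //.
    by rewrite !enc_toks_cat.
  exact: sound_ex snd1 snd2 snd3.
- move=> H1 [mu [nu [E1 E2 sub1]]] [nu' [mu' [E2' E1' sub2]]] T A0 z Ew.
  have [c [b [mu1 [-> -> E1'' snd]]]] := H1 T A0 z Ew.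
  rewrite E1'' in E1 E1'; rewrite E2 in E2'.
  move: E1 E1' E2' => /enc_toks_inj ? /enc_toks_inj ? /enc_toks_inj ?; subst mu mu' nu'.
  exists c, b, nu; split=> //; apply: sound_eq snd => t.
  by apply/idP/idP => [/sub1|/sub2].
- move=> [T Ew] [A ?] [B ?] [m ?] H; subst x0 x1 x2.
  have [[R|] [b [mu [Ec Eb Emu snd]]]] := H T A _ Ew; first by case: (R) Ec.
  have ? := enc_body_inj (x1 := BC (LName B)) Eb.
  have ? : None :: toks m = mu.
    by apply: enc_toks_inj; rewrite -Emu -enc_toks_toks.
  subst b mu; exists T, A, B, m; split; last exact: sound_entails.
  by rewrite Ew.
Qed.

Lemma clauses_valid s c : c \in clauses ->
  (forall q, q \in c.1 -> valid_atom (inst s q)) -> valid_atom (inst s c.2).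
Proof.
move=> cE; apply: valid_clauseP.
have inL (c' : clause symbol 7) l : c' \in l -> List.In c' l.
  elim: l => //= d l IH; rewrite inE => /orP[/eqP->|/IH]; first by left.
  by right.
move: cE; rewrite mem_cat => /orP[]/inL.
  exact: parse_clauses_valid.
exact: fact_clauses_valid.
Qed.

End Validity.

(** * Words and facts occurring in derivations *)

Definition infixes (T : eqType) (u : seq T) : seq (seq T) :=
  [seq take j (drop i u) | i <- iota 0 (size u).+1, j <- iota 0 (size u).+1].

Lemma mem_infixes (T : eqType) (u y : seq T) :
  y \in infixes u <-> exists x z, u = x ++ y ++ z.
Proof.
split=> [/allpairsP[[i j] [_ _ ->]]|[x [z ->]]].
  by exists (take i u), (drop j (drop i u)); rewrite !cat_take_drop.
apply/allpairsP; exists (size x, size y); split.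
- by rewrite mem_iota /= !size_cat; lia.
- by rewrite mem_iota /= !size_cat; lia.
- by rewrite /= drop_size_cat // take_size_cat.
Qed.

(** The extra leading symbols serve concept names from range restrictions and the query ([SName]),
    edges ([SRoleIncl]), and the goal annotation, which starts with the seed ([SQuery]). *)
Definition query_words (w : seq symbol) : seq (seq symbol) :=
  infixes w ++
  [seq s :: u | s <- [:: SName; SRoleIncl; SQuery], u <- infixes w].

Definition all_atoms (W : seq (seq symbol)) : seq (seq (seq symbol)) :=
  [seq gatom tx.1 tx.2 yz.1 yz.2
     | tx <- [seq (t, x) | t <- symbol_enum, x <- W],
       yz <- [seq (y, z) | y <- W, z <- W]].

Lemma mem_all_atoms W t x y z :
  x \in W -> y \in W -> z \in W -> gatom t x y z \in all_atoms W.
Proof.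
move=> xW yW zW; apply/allpairsP; exists ((t, x), (y, z)); split=> //.
  apply: (allpairs_f (fun t x => (t, x))) => //.
  by case: t => // -[].
exact: (allpairs_f (fun y z => (y, z))).
Qed.

Lemma size_all_atoms W : size (all_atoms W) = 13 * size W * (size W * size W).
Proof. by rewrite /all_atoms !size_allpairs. Qed.

Lemma mem_query w u : u \in query_words w <->
  u \in infixes w \/ exists s v,
    [/\ s \in [:: SName; SRoleIncl; SQuery], v \in infixes w & u = s :: v].
Proof.
rewrite /query_words; move: (infixes w) => I; split.
  rewrite mem_cat => /orP[uI|/allpairsP[[s v] [sS vI ->]]]; first by left.
  by right; exists s, v.
rewrite mem_cat => -[->//|[s [v [sS vI ->]]]]; apply/orP; right.
exact: (allpairs_f cons).
Qed.

Lemma infix_query w x y z : w = x ++ y ++ z ->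
  [/\ y \in query_words w, SName :: y \in query_words w,
    SRoleIncl :: y \in query_words w & SQuery :: y \in query_words w].
Proof.
move=> Ew; have inf : y \in infixes w by apply/mem_infixes; exists x, z.
split; apply/mem_query; [by left| | |]; right.
- by exists SName, y.
- by exists SRoleIncl, y.
- by exists SQuery, y.
Qed.

Lemma infixes_closed (T : eqType) (u x y z : seq T) :
  x ++ y ++ z \in infixes u -> y \in infixes u.
Proof.
move/mem_infixes => [x' [z' ->]]; apply/mem_infixes.
by exists (x' ++ x), (z ++ z'); rewrite -!catA.
Qed.

Lemma query_closed w x y z :
  x ++ y ++ z \in query_words w -> y \in query_words w.
Proof.
move/mem_query => [/infixes_closed yI|]; first by apply/mem_query; left.
move=> [s [v [sS vI]]]; case: x => [|a x] /= => [|[_ Ev]]; last first.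
  by apply/mem_query; left; apply: (@infixes_closed _ _ x y z); rewrite Ev.
case: y => [|a y] /= => [_|[-> Ev]].
  by apply/mem_query; left; apply/mem_infixes; exists [::], w.
apply/mem_query; right; exists s, y; split=> //.
by apply: (@infixes_closed _ _ [::] y z); rewrite /= Ev.
Qed.

Lemma query_infixes w s v : s \notin [:: SName; SRoleIncl; SQuery] ->
  s :: v \in query_words w -> s :: v \in infixes w.
Proof.
move=> sS /mem_query[//|[s' [v' [s'S _ [Es _]]]]].
by rewrite Es s'S in sS.
Qed.

Lemma axiom_words w a v T x :
  w = enc_tbox T ++ enc_axiom a ++ enc_annotation v ++ x ->
  enc_body (lhs a) \in query_words w /\ enc_body (rhs a) \in query_words w.
Proof.
case: a => [C E|R Q|R A] Ew /=; rewrite ?enc_body_rconcept; split.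
- have [] // := @infix_query w (enc_tbox T ++ [:: SGCI]) (enc_lconcept C)
    (enc_rconcept E ++ enc_annotation v ++ x).
  by rewrite Ew /= -!catA.
- have [] // := @infix_query w (enc_tbox T ++ SGCI :: enc_lconcept C) (enc_rconcept E)
    (enc_annotation v ++ x).
  by rewrite Ew /= -!catA.
- have [] // := @infix_query w (enc_tbox T ++ [:: SRoleIncl]) (enc_name R)
    (enc_name Q ++ enc_annotation v ++ x).
  by rewrite Ew /= -!catA.
- have [] // := @infix_query w (enc_tbox T ++ SRoleIncl :: enc_name R) (enc_name Q)
    (enc_annotation v ++ x).
  by rewrite Ew /= -!catA.
- have [] // := @infix_query w (enc_tbox T ++ [:: SRangeRestr]) (enc_name R)
    (enc_name A ++ enc_annotation v ++ x).
  by rewrite Ew /= -!catA.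
- have [] // := @infix_query w (enc_tbox T ++ SRangeRestr :: enc_name R) (enc_name A)
    (enc_annotation v ++ x).
  by rewrite Ew /= -!catA.
Qed.

Lemma axiom_words_in w T x a v : w = enc_tbox T ++ x -> List.In (a, v) T ->
  enc_body (lhs a) \in query_words w /\ enc_body (rhs a) \in query_words w.
Proof.
move=> Ew /(@List.in_split _ _ _)[T1 [T2 ET]]; rewrite ET in Ew.
apply: (@axiom_words _ _ v T1 (enc_tbox T2 ++ x)).
by rewrite Ew (enc_tbox_cat T1) [in LHS]/enc_tbox /= -!catA.
Qed.

Definition query_facts (w : seq symbol) : seq fact :=
  [seq (c, b) | c <- query_words w, b <- query_words w].

Lemma mem_query_facts w c b :
  ((c, b) \in query_facts w) = (c \in query_words w) && (b \in query_words w).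
Proof.
rewrite /query_facts; move: (query_words w) => I.
apply/allpairsP/andP => [[[c' b'] [/= cI bI [-> ->]]] //|[cI bI]].
by exists (c, b).
Qed.

(** A subformula property. A conclusion headed by [SAnd] or [SEx] is a genuine infix of [w], hence
    so are its parts; the role chosen in [RuleEx] occurs in [w] by the side condition of that
    rule. *)
Lemma rule3_query w T x p1 p2 p3 v g : w = enc_tbox T ++ x ->
  rule3 T p1 p2 p3 v g -> g \in query_facts w ->
  [/\ p1 \in query_facts w, p2 \in query_facts w & p3 \in query_facts w].
Proof.
move=> Ew; have [nil_w _ _ _] := @infix_query w [::] [::] w erefl.
case=> [c a u aT|c C1 C2|c R Q C E u aT]; rewrite !mem_query_facts => /andP[-> gw].
- by have [-> _] := axiom_words_in Ew aT; rewrite nil_w.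
- have gI := @query_infixes w SAnd _ isT gw.
  have I1 := @infixes_closed _ _ [:: SAnd] (enc_lconcept C1) (enc_lconcept C2) gI.
  have I2 : enc_lconcept C2 \in infixes w.
    by apply: (@infixes_closed _ _ (SAnd :: enc_lconcept C1) _ [::]); rewrite cats0.
  by rewrite nil_w; split=> //; apply/mem_query; left.
- have gI := @query_infixes w SEx _ isT gw.
  have IQ := @infixes_closed _ _ [:: SEx] (enc_name Q) (enc_lconcept C) gI.
  have IC : enc_lconcept C \in infixes w.
    by apply: (@infixes_closed _ _ (SEx :: enc_name Q) _ [::]); rewrite cats0.
  have [_ /= rw] := axiom_words_in Ew aT.
  have IR := @query_infixes w SEx _ isT rw.
  have Rw : enc_name R \in query_words w.
    apply/mem_query; left.
    by apply: (@infixes_closed _ _ [:: SEx] _ [::]); rewrite cats0.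
  rewrite rw Rw; split=> //; apply/mem_query; last by left.
  by right; exists SRoleIncl, (enc_name Q).
Qed.

(** Padding premises contribute no tokens, so the annotation of a line agrees with that of the Horn
    clause, where the padding is absent. *)
Lemma lines_triv T A0 F U L w :
  lines (rule0 A0) (rule3 T) F U L -> (triv, w) \in L -> w = [::].
Proof.
elim=> {L} // [v g L r0 _ _ _ IH|p1 p2 p3 v g w1 w2 w3 L r3 _ _ _ _ _ _ IH].
  rewrite inE => /orP[/eqP[Eg ->]|/IH//].
  by case: r0 Eg.
rewrite inE => /orP[/eqP[Eg _]|/IH//]; case: r3 Eg => [c a u _||] //.
by case: a => [? []| |].
Qed.

(** * Completeness of the clauses over a bounded set of words *)

Section Completeness.
Variables (w : seq symbol) (W : seq (seq symbol)) (B : nat).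
Let Atoms := [:: w] :: all_atoms W.
Hypothesis W_infix : forall x y z, x ++ y ++ z \in W -> y \in W.
Hypothesis W_size : forall u, u \in W -> size u <= B.
Hypothesis W_query : {subset query_words w <= W}.

Local Notation D := (derivable clauses Atoms B w).

Lemma infix_w x y z : w = x ++ y ++ z ->
  [/\ y \in W, SName :: y \in W, SRoleIncl :: y \in W & SQuery :: y \in W].
Proof.
by move=> /infix_query[? ? ? ?]; split; apply: W_query.
Qed.

Lemma nil_W : [::] \in W.
Proof. by have [] := @infix_w [::] [::] w erefl. Qed.

Lemma W_catl x y : x ++ y \in W -> x \in W.
Proof. exact: (@W_infix [::] x y). Qed.

Lemma W_catr x y : x ++ y \in W -> y \in W.
Proof. by have := @W_infix x y [::]; rewrite cats0. Qed.

Lemma W_cons a y : a :: y \in W -> y \in W.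
Proof. exact: (@W_catr [:: a] y). Qed.

Definition sig (ws : seq (seq symbol)) (i : 'I_7) := nth [::] ws i.

(** [k] is the position of the clause in [clauses], and [ws] lists the values of its variables;
    variables beyond the list are empty. *)
Lemma D_rule k ws prems a :
  all (mem W) ws ->
  [seq inst (sig ws) q | q <- (nth ([::], [::]) clauses k).1] = prems ->
  inst (sig ws) (nth ([::], [::]) clauses k).2 = a -> k < size clauses ->
  a \in Atoms -> foldr (fun q P => D q /\ P) True prems -> D a.
Proof.
move=> wsW <- <- ltk aA ps; apply: DClause => //.
- exact: mem_nth.
- move=> i; rewrite /sig; have [lt_i|ge_i] := ltnP i (size ws).
    by apply: W_size; apply: (allP wsW); apply: mem_nth.
  by rewrite nth_default.
- elim: (_.1) ps => //= q qs IH [Dq /IH ps] p.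
  by rewrite inE => /orP[/eqP->|/ps].
Qed.

Lemma gatomP t x y z : x \in W -> y \in W -> z \in W -> gatom t x y z \in Atoms.
Proof. by move=> xW yW zW; rewrite inE mem_all_atoms ?orbT. Qed.

Ltac inst_eq :=
  by rewrite /= /inst /inst_word /= ?cats0 -?catA ?enc_body_rconcept.

Ltac rule k ws prems :=
  apply: (@D_rule k ws prems);
  [ rewrite /= ?andbT //
  | inst_eq
  | inst_eq
  | by []
  | apply: gatomP; rewrite ?nil_W //
  | rewrite /= ].

Definition gName x := gatom tName x [::] [::].
Definition gConcept x := gatom tConcept x [::] [::].
Definition gRhs x := gatom tRhs x [::] [::].
Definition gAnnot x y := gatom tAnnot x y [::].
Definition gRest x := gatom tRest x [::] [::].
Definition gAxiom x y z := gatom tAxiom x y z.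
Definition gFact x y z := gatom tFact x y z.
Definition gSub x y := gatom tSub x y [::].
Definition gToks x := gatom tToks x [::] [::].
Definition gTok x := gatom tTok x [::] [::].
Definition gNames x := gatom tNames x [::] [::].

Lemma D_name a : enc_name a \in W -> D (gName (enc_name a)).
Proof.
elim: a => [|b a IH] aW.
  by rule 0 (Nil (seq symbol)) (Nil (seq (seq symbol))).
have {}IH := IH (W_cons aW); have aW' := W_cons aW.
case: b aW => aW.
  by rule 2 [:: enc_name a] [:: gName (enc_name a)].
by rule 1 [:: enc_name a] [:: gName (enc_name a)].
Qed.

Lemma D_concept C : enc_lconcept C \in W -> D (gConcept (enc_lconcept C)).
Proof.
elim: C => [A|R C IH|C1 IH1 C2 IH2|] CW.
- have AW := W_cons CW.
  by rule 3 [:: enc_name A] [:: gName (enc_name A)]; split=> //; apply: D_name.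
- have RW := W_catl (W_cons CW); have CW' := W_catr (W_cons CW).
  rule 4 [:: enc_name R; enc_lconcept C] [:: gName (enc_name R); gConcept (enc_lconcept C)].
    by rewrite RW.
  by split; [apply: D_name | split=> //; apply: IH].
- have W1 := W_catl (W_cons CW); have W2 := W_catr (W_cons CW).
  rule 5 [:: enc_lconcept C1; enc_lconcept C2]
    [:: gConcept (enc_lconcept C1); gConcept (enc_lconcept C2)].
    by rewrite W1.
  by split; [apply: IH1 | split=> //; apply: IH2].
- by rule 6 (Nil (seq symbol)) (Nil (seq (seq symbol))).
Qed.

Lemma D_rhs E : enc_rconcept E \in W -> D (gRhs (enc_rconcept E)).
Proof.
case: E => [A|A] EW; have AW := W_cons EW.
  by rule 7 [:: enc_name A] [:: gName (enc_name A)]; split=> //; apply: D_name.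
by rule 8 [:: enc_name A] [:: gName (enc_name A)]; split=> //; apply: D_name.
Qed.

Lemma D_annot v : enc_annotation v \in W ->
  D (gAnnot (enc_annotation v) (enc_names (mon_of_annotation v))).
Proof.
case: v => [x|] vW; rewrite /enc_names /= ?cats0.
  have xW := W_cons vW.
  by rule 10 [:: enc_name x] [:: gName (enc_name x)]; split=> //; apply: D_name.
by rule 9 (Nil (seq symbol)) (Nil (seq (seq symbol))).
Qed.

Lemma D_rest_step a v x :
  enc_axiom a ++ enc_annotation v ++ x \in W ->
  enc_body (lhs a) \in W -> enc_body (rhs a) \in W ->
  D (gRest (enc_axiom a ++ enc_annotation v ++ x)) ->
  D (gRest x) /\
  D (gAxiom (enc_body (lhs a)) (enc_body (rhs a)) (enc_names (mon_of_annotation v))).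
Proof.
move=> aW lW rW Da.
have vW := W_catl (W_catr aW); have xW := W_catr (W_catr aW).
have nW : enc_names (mon_of_annotation v) \in W.
  case: v vW {aW Da} => [y|] vW; rewrite /enc_names /= ?cats0 ?nil_W //.
  exact: W_cons vW.
case: a aW lW rW Da => [C E|R Q|R A] aW lW rW Da.
- have CW := W_catl (W_cons (W_catl aW)); have EW := W_catr (W_cons (W_catl aW)).
  pose ws := [:: enc_lconcept C; enc_rconcept E; enc_annotation v; x;
                 enc_names (mon_of_annotation v)].
  pose prems := [:: gRest (enc_axiom (GCI C E) ++ enc_annotation v ++ x);
    gConcept (enc_lconcept C); gRhs (enc_rconcept E);
    gAnnot (enc_annotation v) (enc_names (mon_of_annotation v))].
  have wsW : all (mem W) ws by rewrite /= CW EW vW xW nW.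
  have ps : foldr (fun q P => D q /\ P) True prems.
    by split=> //; do !split; [apply: D_concept|apply: D_rhs|apply: D_annot].
  split.
    apply: (@D_rule 12 ws prems _ wsW _ _ isT _ ps);
      try by [inst_eq | rewrite /prems /ws; inst_eq].
    exact: gatomP xW nil_W nil_W.
  apply: (@D_rule 13 ws prems _ wsW _ _ isT _ ps);
      try by [inst_eq | rewrite /prems /ws; inst_eq].
  exact: gatomP.
- have RW := W_catl (W_cons (W_catl aW)); have QW := W_catr (W_cons (W_catl aW)).
  pose ws := [:: enc_name R; enc_name Q; enc_annotation v; x;
                 enc_names (mon_of_annotation v)].
  pose prems := [:: gRest (enc_axiom (RoleIncl R Q) ++ enc_annotation v ++ x);
    gName (enc_name R); gName (enc_name Q);
    gAnnot (enc_annotation v) (enc_names (mon_of_annotation v))].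
  have wsW : all (mem W) ws by rewrite /= RW QW vW xW nW.
  have ps : foldr (fun q P => D q /\ P) True prems.
    by split=> //; do !split; [apply: D_name|apply: D_name|apply: D_annot].
  split.
    apply: (@D_rule 14 ws prems _ wsW _ _ isT _ ps);
      try by [inst_eq | rewrite /prems /ws; inst_eq].
    exact: gatomP xW nil_W nil_W.
  apply: (@D_rule 15 ws prems _ wsW _ _ isT _ ps);
      try by [inst_eq | rewrite /prems /ws; inst_eq].
  exact: gatomP.
- have RW := W_catl (W_cons (W_catl aW)); have AW := W_catr (W_cons (W_catl aW)).
  pose ws := [:: enc_name R; enc_name A; enc_annotation v; x;
                 enc_names (mon_of_annotation v)].
  pose prems := [:: gRest (enc_axiom (RangeRestr R A) ++ enc_annotation v ++ x);
    gName (enc_name R); gName (enc_name A);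
    gAnnot (enc_annotation v) (enc_names (mon_of_annotation v))].
  have wsW : all (mem W) ws by rewrite /= RW AW vW xW nW.
  have ps : foldr (fun q P => D q /\ P) True prems.
    by split=> //; do !split; [apply: D_name|apply: D_name|apply: D_annot].
  split.
    apply: (@D_rule 16 ws prems _ wsW _ _ isT _ ps);
      try by [inst_eq | rewrite /prems /ws; inst_eq].
    exact: gatomP xW nil_W nil_W.
  apply: (@D_rule 17 ws prems _ wsW _ _ isT _ ps);
      try by [inst_eq | rewrite /prems /ws; inst_eq].
  exact: gatomP.
Qed.

Lemma D_rest T1 x : w = enc_tbox T1 ++ x -> D (gRest x).
Proof.
(* Parsing advances from the left, so the axiom read last is split off. *)
elim/last_ind: T1 x => [|T1 [a v] IH] x Ew.
  have wW : w \in W by have [] := @infix_w [::] w [::] (esym (cats0 w)).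
  rewrite -[x]/(enc_tbox [::] ++ x) -Ew.
  rule 11 [:: w] [:: [:: w]]; rewrite ?wW //; split=> //.
  by apply: DInput; rewrite mem_head.
have {}Ew : w = enc_tbox T1 ++ enc_axiom a ++ enc_annotation v ++ x.
  by rewrite Ew -cats1 enc_tbox_cat /enc_tbox /= cats0 -!catA.
have [lW rW] := axiom_words Ew.
apply: (proj1 (D_rest_step _ (W_query lW) (W_query rW) (IH _ Ew))).
have [] // := @infix_w (enc_tbox T1) (enc_axiom a ++ enc_annotation v ++ x) [::].
by rewrite cats0.
Qed.

Lemma D_axiom T x a v : w = enc_tbox T ++ x -> List.In (a, v) T ->
  D (gAxiom (enc_body (lhs a)) (enc_body (rhs a)) (enc_names (mon_of_annotation v))).
Proof.
move=> Ew /(@List.in_split _ _ _)[T1 [T2 ET]]; rewrite ET in Ew.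
have {}Ew : w = enc_tbox T1 ++ enc_axiom a ++ enc_annotation v ++ enc_tbox T2 ++ x.
  by rewrite Ew (enc_tbox_cat T1) [in LHS]/enc_tbox /= -!catA.
have [lW rW] := axiom_words Ew.
apply: (proj2 (D_rest_step _ (W_query lW) (W_query rW) (D_rest Ew))).
have [] // := @infix_w (enc_tbox T1)
  (enc_axiom a ++ enc_annotation v ++ enc_tbox T2 ++ x) [::].
by rewrite cats0.
Qed.

Lemma D_tok t : enc_tok t \in W -> D (gTok (enc_tok t)).
Proof.
case: t => [x|] tW; last by rule 18 (Nil (seq symbol)) (Nil (seq (seq symbol))).
by rule 19 [:: enc_name x] [:: gName (enc_name x)]; split=> //; apply: D_name.
Qed.

Lemma D_toks mu : enc_toks mu \in W -> D (gToks (enc_toks mu)).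
Proof.
elim: mu => [|t mu IH] muW.
  by rule 20 (Nil (seq symbol)) (Nil (seq (seq symbol))).
have tW := W_catl muW; have mW := W_catr muW.
rule 21 [:: enc_tok t; enc_toks mu] [:: gTok (enc_tok t); gToks (enc_toks mu)].
  by rewrite tW.
by split; [apply: D_tok | split=> //; apply: IH].
Qed.

Lemma D_names m : enc_names m \in W -> D (gNames (enc_names m)).
Proof.
elim: m => [|a m IH] mW.
  by rule 22 (Nil (seq symbol)) (Nil (seq (seq symbol))).
have aW := W_catl mW; have mW' := W_catr mW.
rule 23 [:: enc_name a; enc_names m] [:: gName (enc_name a); gNames (enc_names m)].
  by rewrite aW.
by split; [apply: D_name | split=> //; apply: IH].
Qed.

Lemma D_sub mu nu : {subset mu <= nu} -> enc_toks mu \in W -> enc_toks nu \in W ->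
  D (gSub (enc_toks mu) (enc_toks nu)).
Proof.
elim: mu => [|t mu IH] sub muW nuW.
  by rule 24 [:: enc_toks nu] [:: gToks (enc_toks nu)]; split=> //; apply: D_toks.
have {IH} Dmu : D (gSub (enc_toks mu) (enc_toks nu)).
  by apply: IH (W_catr muW) nuW => u umu; apply: sub; rewrite inE umu orbT.
have tW := W_catl muW; have mW := W_catr muW.
case/splitPr: (sub t (mem_head _ _)) nuW Dmu => n1 n2.
have -> : enc_toks (n1 ++ t :: n2) = enc_toks n1 ++ enc_tok t ++ enc_toks n2.
  by rewrite enc_toks_cat.
move=> nuW Dmu; have n1W := W_catl nuW; have n2W := W_catr (W_catr nuW).
rule 25 [:: enc_tok t; enc_toks mu; enc_toks n1; enc_toks n2]
  [:: gTok (enc_tok t); gToks (enc_toks n1);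
      gSub (enc_toks mu) (enc_toks n1 ++ enc_tok t ++ enc_toks n2)].
  by rewrite tW mW n1W.
by split; [apply: D_tok | split; [apply: D_toks | split]].
Qed.

Lemma D_eq c b mu nu : mu =i nu -> c \in W -> b \in W ->
  enc_toks mu \in W -> enc_toks nu \in W ->
  D (gFact c b (enc_toks mu)) -> D (gFact c b (enc_toks nu)).
Proof.
move=> E cW bW muW nuW Dmu.
rule 33 [:: c; b; enc_toks mu; enc_toks nu]
  [:: gFact c b (enc_toks mu); gSub (enc_toks mu) (enc_toks nu);
      gSub (enc_toks nu) (enc_toks mu)].
  by rewrite cW bW muW.
by split=> //; split; [|split=> //]; apply: D_sub => // t; rewrite E.
Qed.

(** * From lines to derived atoms *)

Section Lines.
Variables (T : tbox) (A0 : concept_name) (rest : seq symbol) (U : seq token).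
Variable monos : seq (seq token).
Hypothesis w_query : w = enc_tbox T ++ SQuery :: enc_name A0 ++ rest.
Hypothesis nil_monos : [::] \in monos.
Hypothesis monos_W : forall w1 w2 w3 v,
  w1 \in monos -> w2 \in monos -> w3 \in monos ->
  {subset v <= U} -> size v <= 1 -> enc_toks (w1 ++ w2 ++ w3 ++ v) \in W.

Lemma enc_fact_triv c b : enc_fact c b <> triv.
Proof. by case: c b => [R|] [[]| |]. Qed.

Lemma monos_W1 u : u \in monos -> enc_toks u \in W.
Proof.
move=> uM; have := monos_W uM nil_monos nil_monos (v := [::]).
by rewrite !cats0; apply.
Qed.

Lemma D_lines L : lines (rule0 A0) (rule3 T) (query_facts w) U L ->
  (forall g u, (g, u) \in L -> u \in monos) ->
  forall g u, (g, u) \in L -> g \in query_facts w /\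
    (g = triv \/ D (gFact g.1 g.2 (enc_toks u))).
Proof.
elim=> {L} [|v g L r0 gF vU _ IH|p1 p2 p3 v g w1 w2 w3 L r3 gF vU i1 i2 i3 lL IH] LM.
- by [].
- have LM' h u : (h, u) \in L -> u \in monos.
    by move=> hL; apply: (LM h); rewrite inE hL orbT.
  move=> h u; rewrite inE => /orP[/eqP[-> ->]|]; last exact: IH.
  split=> //; case: r0 gF {vU LM} => [|c||R]; first by left.
  + rewrite mem_query_facts => /andP[/W_query cW /W_query bW]; right.
    case: c cW => [R|] cW.
      rule 27 [:: enc_name R] [:: gName (enc_name R)]; split=> //; exact: D_name.
    by rule 26 (Nil (seq symbol)) (Nil (seq (seq symbol))).
  + rewrite mem_query_facts => /andP[/W_query cW /W_query bW]; right.
    have Rest := D_rest w_query.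
    have [QW _ _ _] := @infix_w (enc_tbox T) (SQuery :: enc_name A0 ++ rest) [::]
      (etrans w_query (congr1 _ (esym (cats0 _)))).
    have AW := W_catl (W_cons QW); have RW := W_catr (W_cons QW).
    rule 28 [:: enc_name A0; rest]
      [:: gRest (SQuery :: enc_name A0 ++ rest); gName (enc_name A0)].
    * by rewrite AW.
    * exact: (@W_catl [:: SQuery] _ QW).
    * by split=> //; split=> //; apply: D_name.
  + rewrite mem_query_facts => /andP[/W_query cW /W_query bW]; right.
    rule 29 [:: enc_name R] [:: gName (enc_name R)]; split=> //; exact: D_name.
- have LM' h u : (h, u) \in L -> u \in monos.
    by move=> hL; apply: (LM h); rewrite inE hL orbT.
  have {}IH := IH LM'.
  move=> h u; rewrite inE => /orP[/eqP[-> ->]|]; last exact: IH.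
  split=> //; right.
  have uM := LM _ _ (mem_head _ _).
  have [F1 D1] := IH _ _ i1; have [F2 D2] := IH _ _ i2; have [F3 D3] := IH _ _ i3.
  have M1 := LM' _ _ i1; have M2 := LM' _ _ i2; have M3 := LM' _ _ i3.
  have rawW : enc_toks (w1 ++ w2 ++ w3 ++ v) \in W.
    by apply: monos_W => //; case: (r3) => // c a [].
  move: gF; rewrite [g]surjective_pairing mem_query_facts => /andP[/W_query g1W /W_query g2W].
  (* The clauses produce the plain concatenation; removing repetitions is a separate use of the
     exchange clause. This is why [monos_W] asks for unreduced annotations. *)
  apply: (D_eq _ g1W g2W rawW (monos_W1 uM)) => [t|]; first by rewrite mem_undup.
  have W1 := monos_W1 M1; have W2 := monos_W1 M2; have W3 := monos_W1 M3.
  case: r3 F1 F2 F3 D1 D2 D3 i2 i3 rawW g1W g2W {h u uM vU i1 IH}.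
  + move=> c a u aT; rewrite mem_query_facts => /andP[_ /W_query lW] _ _.
    case=> [/enc_fact_triv//|Df] _ _ i2 i3.
    rewrite (lines_triv lL i2) (lines_triv lL i3) /= enc_toks_cat enc_toks_toks.
    move=> rawW cW rW; have uW := W_catr rawW.
    rule 30 [:: enc_ctx c; enc_body (lhs a); enc_body (rhs a); enc_toks w1;
                enc_names (mon_of_annotation u)]
      [:: gFact (enc_ctx c) (enc_body (lhs a)) (enc_toks w1);
          gAxiom (enc_body (lhs a)) (enc_body (rhs a)) (enc_names (mon_of_annotation u))].
      by rewrite cW lW rW W1.
    by split=> //; split=> //; apply: D_axiom w_query aT.
  + move=> c C1 C2; rewrite !mem_query_facts => /andP[_ /W_query C1W] /andP[_ /W_query C2W] _.
    case=> [/enc_fact_triv//|Df1] [/enc_fact_triv//|Df2] _ _ i3.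
    rewrite (lines_triv lL i3) /= cats0 enc_toks_cat => rawW cW rW.
    rule 31 [:: enc_ctx c; enc_lconcept C1; enc_lconcept C2; enc_toks w1; enc_toks w2]
      [:: gFact (enc_ctx c) (enc_lconcept C1) (enc_toks w1);
          gFact (enc_ctx c) (enc_lconcept C2) (enc_toks w2);
          gConcept (enc_lconcept C1); gConcept (enc_lconcept C2)].
      by rewrite cW C1W C2W W1.
    by do !split=> //; apply: D_concept.
  + move=> c R Q C E u aT; rewrite !mem_query_facts.
    move=> /andP[_ /W_query EW] /andP[/W_query RW /W_query QW] /andP[_ /W_query CW].
    case=> [/enc_fact_triv//|Df1] [/enc_fact_triv//|Df2] [/enc_fact_triv//|Df3] _ _.
    rewrite cats0 !enc_toks_cat => rawW cW rW; have QW' := W_cons QW.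
    rule 32 [:: enc_ctx c; enc_name R; enc_name Q; enc_lconcept C;
                enc_toks w1; enc_toks w2; enc_toks w3]
      [:: gFact (enc_ctx c) (SEx :: enc_name R) (enc_toks w1);
          gFact (enc_name R) (SRoleIncl :: enc_name Q) (enc_toks w2);
          gFact (enc_name R) (enc_lconcept C) (enc_toks w3);
          gName (enc_name R); gName (enc_name Q); gConcept (enc_lconcept C)].
      by rewrite cW RW QW' CW W1 W2.
    by do !split=> //; [apply: D_name|apply: D_name|apply: D_concept].
Qed.

Lemma D_goal L B0 m u : lines (rule0 A0) (rule3 T) (query_facts w) U L ->
  (forall g u, (g, u) \in L -> u \in monos) ->
  rest = enc_name B0 ++ enc_names m ->
  (enc_fact None (BC (LName B0)), u) \in L -> u =i None :: toks m ->
  D goal_atom.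
Proof.
move=> lL LM Er uL Eu; have [] := D_lines lL LM uL.
rewrite mem_query_facts => /andP[_ /W_query BW] [/enc_fact_triv//|Df].
have [QW _ _ _] := @infix_w (enc_tbox T) (SQuery :: enc_name A0 ++ rest) [::]
  (etrans w_query (congr1 _ (esym (cats0 _)))).
have AW := W_catl (W_cons QW); have RW := W_catr (W_cons QW).
rewrite Er in RW; have mW := W_catr RW.
have [_ _ _ mW'] : [/\ enc_names m \in W, SName :: enc_names m \in W,
    SRoleIncl :: enc_names m \in W & SQuery :: enc_names m \in W].
  apply: (@infix_w (enc_tbox T ++ SQuery :: enc_name A0 ++ enc_name B0) _ [::]).
  by rewrite w_query Er cats0 -!catA /= -!catA.
(* Acceptance needs the tokens in the order of the input, with the seed in front. *)
have {}Df : D (gFact [::] (SName :: enc_name B0) (SQuery :: enc_names m)).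
  rewrite -[SQuery :: _]/([:: SQuery] ++ enc_names m) -enc_toks_toks.
  apply: (@D_eq [::] (SName :: enc_name B0) u (None :: toks m)) => //.
  - exact: nil_W.
  - exact: monos_W1 (LM _ _ uL).
  - by rewrite /enc_toks /= -/(enc_toks (toks m)) enc_toks_toks.
rule 34 [:: enc_name A0; enc_name B0; enc_names m]
  [:: gRest (SQuery :: enc_name A0 ++ enc_name B0 ++ enc_names m);
      gName (enc_name A0); gName (enc_name B0); gNames (enc_names m);
      gFact [::] (SName :: enc_name B0) (SQuery :: enc_names m)].
  by rewrite AW (W_cons BW).
split; first by rewrite -Er; apply: D_rest w_query.
do !split=> //; [exact: D_name|exact: D_name (W_cons BW)|exact: D_names].
Qed.

End Lines.

End Completeness.

(** * Polynomial bounds *)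

Definition poly_bounded (f : nat -> nat) : Prop :=
  exists p : {poly nat}, forall n, f n <= p.[n]%R.

Lemma poly_bounded_const c : poly_bounded (fun=> c).
Proof. by exists (c%:P)%R => n; rewrite hornerC. Qed.

Lemma poly_bounded_id : poly_bounded id.
Proof. by exists 'X%R => n; rewrite hornerX. Qed.

Lemma poly_bounded_add f g :
  poly_bounded f -> poly_bounded g -> poly_bounded (fun n => f n + g n).
Proof.
by move=> [p fp] [q gq]; exists (p + q)%R => n; rewrite hornerD leq_add.
Qed.

Lemma poly_bounded_mul f g :
  poly_bounded f -> poly_bounded g -> poly_bounded (fun n => f n * g n).
Proof.
by move=> [p fp] [q gq]; exists (p * q)%R => n; rewrite hornerM leq_mul.
Qed.

Lemma poly_bounded_S f : poly_bounded f -> poly_bounded (fun n => (f n).+1).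
Proof.
move=> pf; have [p fp] := poly_bounded_add (poly_bounded_const 1) pf.
by exists p.
Qed.

(** An infix is given by two indices, and it occurs plain or with one of three leading symbols:
    hence the factor 4. The 4 in [bound_size] covers three annotations of at most [n * n] symbols
    and one further token. *)
Definition bound_query n := 4 * (n.+1 * n.+1).
Definition bound_facts n := bound_query n * bound_query n.
Definition bound_lines n := bound_facts n + bound_facts n * (n.+1 * n.+1).
Definition bound_raws n := (bound_lines n).+1 * (bound_lines n).+1 *
  ((bound_lines n).+1 * n.+2).
Definition bound_size n := 4 * (n.+1 * n.+1).
Definition bound_words n :=
  bound_query n + bound_raws n * ((bound_size n).+1 * (bound_size n).+1).
(** The first summand counts the atoms, the input atom included; the second bounds the size of one
    atom, with 2 for its tag. *)
Definition bound_atoms n :=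
  (13 * bound_words n * (bound_words n * bound_words n)).+1 +
  (3 * (bound_size n).+1 + 2).

Lemma bound_atoms_poly : poly_bounded bound_atoms.
Proof.
rewrite /bound_atoms /bound_words /bound_raws /bound_lines /bound_facts
  /bound_query /bound_size.
repeat first [exact: poly_bounded_id | exact: poly_bounded_const
  | apply: poly_bounded_add | apply: poly_bounded_mul | apply: poly_bounded_S].
Qed.

Lemma size_infixes (T : eqType) (u : seq T) :
  size (infixes u) = (size u).+1 * (size u).+1.
Proof. by rewrite /infixes size_allpairs size_iota. Qed.

Lemma size_infix (T : eqType) (u v : seq T) : v \in infixes u -> size v <= size u.
Proof. by case/mem_infixes => x [z ->]; rewrite !size_cat; lia. Qed.

Lemma size_query_words w : size (query_words w) = bound_query (size w).
Proof.
rewrite /query_words; move: (infixes w) (size_infixes w) => I sI.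
by rewrite size_cat size_allpairs sI /bound_query mulSn.
Qed.

Lemma size_query_word w u : u \in query_words w -> size u <= (size w).+1.
Proof.
by case/mem_query => [/size_infix/leqW|[s [v [_ /size_infix le_v ->]]]].
Qed.

Lemma size_flatten_le (T : eqType) S (f : T -> seq S) k (s : seq T) :
  (forall x, x \in s -> size (f x) <= k) ->
  size (flatten [seq f x | x <- s]) <= size s * k.
Proof.
elim: s => //= x s IH fk; rewrite size_cat mulSn leq_add ?fk ?mem_head //.
by apply: IH => y ys; rewrite fk // inE ys orbT.
Qed.

Lemma size_enc_toks k mu :
  (forall t, t \in mu -> size (enc_tok t) <= k) ->
  size (enc_toks mu) <= size mu * k.
Proof.
elim: mu => //= t mu IH mk; rewrite /enc_toks /= size_cat mulSn leq_add //.
  by apply: mk; rewrite mem_head.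
by apply: IH => u umu; apply: mk; rewrite inE umu orbT.
Qed.

(** * Assembling a polynomial certificate *)

Lemma entailment_derivable (p : {poly nat}) w :
  (forall n, bound_atoms n <= p.[n]%R) -> entailment_problem w ->
  exists A, [/\ size A <= p.[size w]%R, [:: w] \in A,
    forall a, a \in A -> atom_size a <= p.[size w]%R &
    derivable clauses A p.[size w]%R w goal_atom].
Proof.
move=> pb [T [A0 [B0 [m [Ew ent]]]]]; have {}pb := pb (size w).
have [mu dmu Emu] := entails_der ent; set n := size w in pb *.
rewrite /enc_instance in Ew; set rest := enc_name B0 ++ enc_names m.
have Ew' : w = enc_tbox T ++ SQuery :: enc_name A0 ++ rest by [].
pose U := undup (None :: toks m).
have closed p1 p2 p3 v g := @rule3_query w T _ p1 p2 p3 v g Ew'.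
have [|||L [u [lL uL Eu szL]]] :=
    @short_lines _ _ (rule0 A0) (rule3 T) (query_facts w) U closed _ _ dmu.
- rewrite mem_query_facts /=; apply/andP; split.
    by have [] := @infix_query w [::] [::] w erefl.
  have [|_ -> _ _ //] := @infix_query w (enc_tbox T ++ SQuery :: enc_name A0)
    (enc_name B0) (enc_names m).
  by rewrite Ew' -!catA.
- by move=> t; rewrite mem_undup Emu.
- exact: undup_uniq.
have szm : size m < n.
  rewrite /n Ew' size_cat /= size_cat /rest size_cat.
  have : size m <= size (enc_names m).
    elim: (m) => //= a m' IH; rewrite /enc_names /= size_cat size_rcons /=.
    by rewrite addSn ltnS (leq_trans IH) ?leq_addl.
  by lia.
have szU : size U <= n.
  by apply: leq_trans (size_undup _) _; rewrite /= size_map.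
have tokU t : t \in U -> size (enc_tok t) <= n.
  rewrite mem_undup inE => /orP[/eqP->|/mapP[x xm ->]] /=.
    by rewrite (leq_trans _ szm).
  rewrite /n Ew' size_cat /= size_cat /rest size_cat.
  case/splitPr: xm => m1 m2; rewrite /enc_names map_cat flatten_cat /=.
  by rewrite !size_cat; lia.
pose monos := [::] :: [seq l.2 | l <- L].
pose marks := [::] :: [seq [:: t] | t <- U].
(* These are the unreduced annotations of rule applications: three annotations of lines and at most
   one token from an axiom. Adding all infixes of their encodings keeps [W] closed under infixes. *)
pose raws := [seq w12 ++ w3v | w12 <- [seq w1 ++ w2 | w1 <- monos, w2 <- monos],
                w3v <- [seq w3 ++ v | w3 <- monos, v <- marks]].
pose W := query_words w ++ flatten [seq infixes (enc_toks r) | r <- raws].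
have memW x : x \in W <-> x \in query_words w \/
    exists2 r, r \in raws & x \in infixes (enc_toks r).
  rewrite mem_cat; split=> [/orP[xq|/flatten_mapP[r rr xr]]|]; first by left.
    by right; exists r.
  case=> [->//|[r rr xr]]; apply/orP; right; apply/flatten_mapP.
  by exists r.
have monosU v : v \in monos -> uniq v /\ {subset v <= U}.
  rewrite inE => /orP[/eqP-> //|/mapP[[g v'] gL ->]].
  exact: lines_sub lL gL.
have monos_size v : v \in monos -> size (enc_toks v) <= n * n.
  move=> /monosU[uv vU]; apply: leq_trans (@size_enc_toks n _ _) _.
    by move=> t /vU/tokU.
  by rewrite leq_mul2r (leq_trans (uniq_leq_size uv vU) szU) orbT.
have raw_size r : r \in raws -> size (enc_toks r) <= bound_size n.
  case/allpairsP=> -[w12 w3v] [/allpairsP[[w1 w2] [h1 h2 E12]]].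
  case/allpairsP=> -[w3 v] [h3 hv E3] ->; rewrite /= in h1 h2 E12 h3 hv E3 *.
  rewrite E12 E3.
  rewrite !enc_toks_cat !size_cat.
  have := monos_size _ h1; have := monos_size _ h2; have := monos_size _ h3.
  have : size (enc_toks v) <= n.
    move: hv; rewrite inE => /orP[/eqP-> //|/mapP[t tU ->]].
    by rewrite /enc_toks /= cats0 tokU.
  by rewrite /bound_size !mulSn !mulnS /=; lia.
have W_size x : x \in W -> size x <= bound_size n.
  move=> /memW[/size_query_word|[r /raw_size rs /size_infix xs]].
    by rewrite /bound_size -/n; nia.
  exact: leq_trans xs rs.
have szL' : size L <= bound_lines n.
  apply: leq_trans szL _; rewrite /query_facts size_allpairs size_query_words.
  rewrite -/n -/(bound_facts n) /bound_lines leq_add2l leq_mul2l -mulnn.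
  by rewrite leq_mul ?orbT // (leq_trans szU).
have szW : size W <= bound_words n.
  rewrite size_cat size_query_words leq_add2l.
  pose k := (bound_size n).+1 * (bound_size n).+1.
  apply: leq_trans (@size_flatten_le _ _ _ k _ _) _.
    move=> r /raw_size rs; rewrite size_infixes.
    by rewrite leq_mul // ltnS; apply: rs.
  rewrite leq_mul2r; apply/orP; right.
  rewrite /raws !size_allpairs /monos /marks /= !size_map.
  by rewrite !leq_mul // !ltnS // (leq_trans szU).
exists ([:: w] :: all_atoms W); split.
- rewrite -[size _]/((size (all_atoms W)).+1) size_all_atoms.
  apply: leq_trans pb; rewrite /bound_atoms.
  by rewrite (leq_trans _ (leq_addr _ _)) // ltnS !leq_mul.
- exact: mem_head.
- move=> a; rewrite inE => /orP[/eqP->|].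
    apply: leq_trans pb; rewrite /bound_atoms /bound_size /atom_size /= -/n.
    by rewrite (leq_trans _ (leq_addl _ _)) //; nia.
  move=> /allpairsP[[[t x] [y z]] [/allpairsP[[t' x'] [_ xW [_ ->]]]]].
  move=> /allpairsP[[y' z'] [yW zW [-> ->]]] -> /=.
  rewrite /atom_size /=; apply: leq_trans pb.
  have := W_size _ xW; have := W_size _ yW; have := W_size _ zW; rewrite /= /bound_atoms.
  by lia.
apply: (@D_goal w W p.[n]%R _ _ _ T A0 rest U monos _ _ _ L B0 m u) => //.
- move=> x y z /memW[/query_closed yq|[r rr /infixes_closed yr]]; apply/memW; first by left.
  by right; exists r.
- move=> x /W_size xs; apply: leq_trans pb; rewrite /bound_atoms.
  by lia.
- by move=> x xq; apply/memW; left.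
- move=> w1 w2 w3 v h1 h2 h3 vU szv; apply/memW; right.
  exists (w1 ++ w2 ++ w3 ++ v); last first.
    by apply/mem_infixes; exists [::], [::]; rewrite cats0.
  rewrite catA; apply: (allpairs_f cat); apply: (allpairs_f cat) => //.
  case: v vU szv => [|t [|? ?]] // vU _; rewrite inE; apply/orP; right.
  by apply: map_f; apply: vU; rewrite mem_head.
- by move=> g v gL; rewrite inE; apply/orP; right; apply/mapP; exists (g, v).
- by move=> t; rewrite Eu Emu.
Qed.

Theorem theorem4 : in_NP entailment_problem.
Proof.
have [p pb] := bound_atoms_poly.
apply: (@in_NP_horn _ 7 clauses goal_atom _ (fun w => valid_atom w) p).
- by [].
- by move=> w c s; apply: clauses_valid.
- by [].
- by move=> w; apply: entailment_derivable.
Qed.
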